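(* There exist constants $C,\beta>0$ such that $$E(u(t))\le CE(u_0)e^{-\beta t},\quad\forall t\ge0,$$ for any $u_0\in H^1(\mathbb{T})$, where $u(t)$ is the solution of $$iu_t+u_{xx}+ia(x)u=|u|^{p-1}u,\qquad u(0,x)=u_0(x).$$
   Context: $\mathbb{T}=\mathbb{R}/2\pi\mathbb{Z}$; functions are complex-valued; $p\ge3$ is a fixed odd integer. The function $a:\mathbb{T}\to[0,\infty)$ is smooth and there are $a_0>0$ and a nonempty open set $\mathcal I_1\subset\mathbb{T}$ with $a\ge a_0$ on $\mathcal I_1$. Solutions are mild: $u\in C([0,\infty);H^1)$ satisfying $u(t)=S_a(t)u_0-i\int_0^tS_a(t-\tau)|u|^{p-1}u\,d\tau$, where $S_a(t)$ is the $C_0$-group generated by $i\partial_x^2-a(x)$. The energy is $E(u)=\frac12\int_{\mathbb{T}}|u|^2+\frac12\int_{\mathbb{T}}|u_x|^2+\frac1{p+1}\int_{\mathbb{T}}|u|^{p+1}$. *)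

(* Defs.v *)
From HB Require Import structures.
From mathcomp Require Export all_boot all_order all_algebra.
From mathcomp Require Export complex.
From mathcomp Require Export all_classical all_reals all_analysis.
Export numFieldNormedType.Exports.
Export Order.TTheory GRing.Theory Num.Theory.

Set Implicit Arguments.
Unset Strict Implicit.
Unset Printing Implicit Defensive.

Local Open Scope classical_set_scope.
Local Open Scope ring_scope.
Local Open Scope complex_scope.

(* The torus is R/2piZ: functions on it are 2pi-periodic functions on R, its
   subsets are 2pi-periodic subsets of R, and integrals over it are integrals
   over a period.  Elements of the Lebesgue and Sobolev spaces are represented
   by periodic functions; equality in these spaces is equality almost
   everywhere, i.e. the difference has L^2 norm 0. *)

Section Torus.
Context {R : realType}.

Implicit Types (f g u v : R -> R[i]) (a phi : R -> R).

Definition torus_smooth phi : Prop :=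
  periodic phi (pi *+ 2) /\ forall (n : nat) (x : R), derivable (derive1n n phi) x 1.

Definition torus_open_set (I : set R) : Prop :=
  open I /\ forall x, I (x + pi *+ 2) <-> I x.

Definition period_cell : set R := `[0, pi *+ 2].

Definition torus_int (h : R -> R) : R :=
  \int[lebesgue_measure]_(x in period_cell) h x.

Definition torus_cint f : R[i] :=
  torus_int (fun x => complex.Re (f x)) +i* torus_int (fun x => complex.Im (f x)).

Definition cmod (z : R[i]) : R := ComplexField.Normc.normc z.

Definition L2 f : Prop :=
  [/\ periodic f (pi *+ 2),
      measurable_fun setT (fun x => complex.Re (f x)),
      measurable_fun setT (fun x => complex.Im (f x)) &
      (\int[lebesgue_measure]_(x in period_cell) ((cmod (f x)) ^+ 2)%:E
         < +oo)%E].

Definition normL2 f : R := Num.sqrt (torus_int (fun x => cmod (f x) ^+ 2)).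

Definition weak_derivative f g : Prop :=
  L2 g /\
  forall phi, torus_smooth phi ->
    torus_cint (fun x => f x * (derive1 phi x)%:C) =
    - torus_cint (fun x => g x * (phi x)%:C).

(* [Hs k] is the Sobolev space H^k on the torus. *)
Fixpoint Hs (k : nat) f : Prop :=
  if k is k'.+1 then L2 f /\ exists2 g, weak_derivative f g & Hs k' g
  else L2 f.

(* Some representative of the weak derivative of [f], if there is one. *)
Definition wderiv f : R -> R[i] := xget (cst 0) [set g | weak_derivative f g].

Definition normH1 f : R := Num.sqrt (normL2 f ^+ 2 + normL2 (wderiv f) ^+ 2).

(* Operators on L^2 are maps of representatives, so the identities between
   elements of L^2 below hold up to functions of norm 0. *)
Definition C0_group (S : R -> (R -> R[i]) -> (R -> R[i])) : Prop :=
  [/\ forall t f, L2 f -> L2 (S t f),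
      forall t (c : R[i]) f g, L2 f -> L2 g ->
        normL2 (S t (c \*o f + g) - (c \*o S t f + S t g)) = 0,
      forall t, exists M : R, forall f, L2 f -> normL2 (S t f) <= M * normL2 f,
      (forall f, L2 f -> normL2 (S 0 f - f) = 0) /\
      (forall s t f, L2 f -> normL2 (S (s + t) f - S s (S t f)) = 0) &
      forall f, L2 f -> normL2 (S t f - f) @[t --> (0 : R)] --> (0 : R)].

(* [A], with domain [D], is the infinitesimal generator of [S]: [D] is exactly
   the set of [f] for which the difference quotients converge in L^2. *)
Definition is_generator (S : R -> (R -> R[i]) -> (R -> R[i]))
    (D : set (R -> R[i])) (A : (R -> R[i]) -> (R -> R[i])) : Prop :=
  forall f g, L2 f -> L2 g ->
    (normL2 (h^-1%:C \*o (S h f - f) - g) @[h --> (0 : R)^'] --> (0 : R)) <->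
    (D f /\ normL2 (g - A f) = 0).

Definition schrodinger_op a f : R -> R[i] :=
  fun x => 'i * wderiv (wderiv f) x - (a x)%:C * f x.

(* [S] is the C_0-group S_a on L^2 generated by i d_x^2 - a, of domain H^2. *)
Definition damped_schrodinger_group a
    (S : R -> (R -> R[i]) -> (R -> R[i])) : Prop :=
  C0_group S /\ is_generator S (Hs 2) (schrodinger_op a).

(* [J] is the integral from [s] to [t] ([s <= t]) of the L^2-valued function [F]: limit in
   L^2 of the Riemann sums over tagged partitions as the mesh tends to 0.  For
   continuous [F] this is the Bochner integral. *)
Definition is_L2_integral (F : R -> (R -> R[i])) (s t : R) (J : R -> R[i])
  : Prop :=
  L2 J /\
  forall eps : R, 0 < eps -> exists2 delta : R, 0 < delta &
    forall (n : nat) (sigma xi : nat -> R),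
      sigma 0%N = s -> sigma n = t ->
      (forall k, (k < n)%N ->
         sigma k <= xi k <= sigma k.+1 /\ sigma k.+1 - sigma k < delta) ->
      normL2 (\sum_(k < n) ((sigma k.+1 - sigma k)%:C \*o F (xi k)) - J) < eps.

Definition nonlinearity (p : nat) f : R -> R[i] :=
  fun x => `|f x| ^+ p.-1 * f x.

Definition continuous_in_H1 (u : R -> (R -> R[i])) : Prop :=
  (forall t : R, 0 <= t -> Hs 1 (u t)) /\
  forall t : R, 0 <= t ->
    normH1 (u s - u t) @[s --> within [set s : R | 0 <= s] (nbhs t)] --> (0 : R).

Definition mild_solution (p : nat) a (u0 : R -> R[i]) (u : R -> (R -> R[i]))
  : Prop :=
  continuous_in_H1 u /\
  exists2 S, damped_schrodinger_group a S &
    forall t : R, 0 <= t -> exists2 J,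
      is_L2_integral (fun tau => S (t - tau) (nonlinearity p (u tau))) 0 t J &
      normL2 (u t - (S t u0 - 'i \*o J)) = 0.

Definition energy (p : nat) u : R :=
  2^-1 * torus_int (fun x => cmod (u x) ^+ 2) +
  2^-1 * torus_int (fun x => cmod (wderiv u x) ^+ 2) +
  (p.+1)%:R^-1 * torus_int (fun x => cmod (u x) ^+ p.+1).

End Torus.

(* Main.v *)
(* Let theta = lam a with mean 1 and let psi be a periodic primitive of 1 - theta.  For kap large and
   eps small the functional
     L(v) = int kap/2 |v|^2 + 1/2 |v_x|^2 + |v|^(p+1)/(p+1) - eps psi Im(conj(v) v_x)
   is comparable to the energy, and along smooth solutions L' <= - delta L.  Indeed psi produces the
   dissipation - eps (1 - theta) (2 |v_x|^2 + ...), whose theta part is absorbed by the damping of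
   |v_x|^2 and |v|^(p+1); the bad term a' Re(conj(v) v_x) is absorbed because a >= 0 forces
   a'^2 <= K a; and the identity int (psi |v|^2)' = 0 is a Poincare inequality controlling |v|^2 by
   |v_x|^2 and a |v|^2.  No unique continuation is involved.
   A mild solution is only H^1 in space, so L is differentiated along its Fourier partial sums.  The
   Duhamel formula and the contraction property of the group give a right derivative of each Fourier
   coefficient; the truncated solution solves the equation up to an error that vanishes in H^1, and
   the decay of L follows from a one-sided (Dini) differential inequality by letting the truncation
   go to infinity. *)

Require Import Defs.
From mathcomp Require Import measurable_realfun ring lra zify.

Set Implicit Arguments.
Unset Strict Implicit.
Unset Printing Implicit Defensive.

Local Open Scope classical_set_scope.
Local Open Scope ring_scope.

(** * Square-integrable functions on the torus *)

Section RealL2.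
Context {R : realType}.
Implicit Types (f g h : R -> R) (c : R).
Local Notation mu := (@lebesgue_measure R).

(** Why psi works: the damping acts only where a does, while decay must be seen everywhere.
    Integrating the momentum term by parts makes psi' = 1 - lam a appear, which equals 1 off the
    damped region and elsewhere differs from 1 by something the damping controls; periodicity of psi
    fixes the mean of theta. Several features of the statement shape the rest. The group is known
    only through its generator, without any bound uniform in time, so contraction has to be derived.
    Solutions are classes of functions, hence identities between complex functions read
    [dC f g = 0]. The Duhamel formula yields increments to the right only, so two-sided time
    derivatives of the solution never appear. Since p = 2 m + 1, |v|^(p-1) is a polynomial in the
    real part r and the imaginary part s of v; calculus is done on real pairs (r, s), where the key
    identities are polynomial. The truncation error is the commutator of the Fourier projection with
    the nonlinearity g. It has to vanish in H^1, not just in L^2, because the functional contains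
    |v_x|^2; it does because g is continuous on H^1, whose elements are bounded functions. *)

Definition intg f : Prop := mu.-integrable period_cell (EFin \o f).

Definition l2 f : Prop := measurable_fun setT f /\ intg (fun x => f x ^+ 2).

Definition ip f g : R := torus_int (fun x => f x * g x).

Definition n2 f : R := Num.sqrt (ip f f).

Lemma sqr_normr (x : R) : `|x| ^+ 2 = x ^+ 2.
Proof. exact: real_normK (num_real x). Qed.

(** Explicit unfolding equations, needed once [ip] and [n2] are made opaque. *)
Lemma ipE f g : ip f g = torus_int (fun x => f x * g x). Proof. by []. Qed.
Lemma n2E f : n2 f = Num.sqrt (ip f f). Proof. by []. Qed.

Lemma measurable_cell : measurable (period_cell : set (measurableTypeR R)).
Proof. exact: measurable_itv. Qed.
Hint Resolve measurable_cell : core.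

Lemma twopi_gt0 : 0 < pi *+ 2 :> R.
Proof. by rewrite mulrn_wgt0 // pi_gt0. Qed.

Lemma mu_cell : mu period_cell = (pi *+ 2)%:E.
Proof. by rewrite /period_cell lebesgue_measure_itv /= lte_fin twopi_gt0 sube0. Qed.

Lemma mu_cell_lty : (mu period_cell < +oo)%E.
Proof. by rewrite mu_cell ltry. Qed.

Lemma intgD f g : intg f -> intg g -> intg (f \+ g).
Proof. by move=> hf hg; have := integrableD measurable_cell hf hg. Qed.

Lemma intgZ c f : intg f -> intg (c \*o f).
Proof. by move=> hf; have := integrableZl measurable_cell c hf. Qed.

Lemma intgN f : intg f -> intg (\- f).
Proof.
move=> /(intgZ (-1)); have -> // : (-1 \*o f) = (\- f).
by apply/funext => x /=; rewrite mulN1r.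
Qed.

Lemma intgB f g : intg f -> intg g -> intg (f \- g).
Proof. by move=> hf /intgN hg; exact: (intgD hf hg). Qed.

Lemma intg_cst c : intg (fun=> c).
Proof.
apply: measurable_bounded_integrable => //; first exact: mu_cell_lty.
by exists `|c|; split; [exact: num_real | move=> x cx y _ /=; exact: ltW].
Qed.

Lemma intg_le f g : measurable_fun setT f -> (forall x, period_cell x -> `|f x| <= g x) -> intg g -> intg f.
Proof.
move=> mf fg hg; apply: (le_integrable measurable_cell _ _ hg).
  by apply/measurable_EFinP; exact: measurable_funS mf.
move=> x Dx; rewrite /= lee_fin (le_trans (fg x Dx)) //; exact: ler_norm.
Qed.

Lemma intg_bounded f (M : R) : measurable_fun setT f -> (forall x, period_cell x -> `|f x| <= M) -> intg f.
Proof.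
move=> mf fM; apply: (@intg_le f (fun=> M) mf fM).
exact: intg_cst.
Qed.

Lemma tintD f g : intg f -> intg g -> torus_int (f \+ g) = torus_int f + torus_int g.
Proof. by move=> hf hg; exact: (RintegralD measurable_cell hf hg). Qed.

Lemma tintB f g : intg f -> intg g -> torus_int (f \- g) = torus_int f - torus_int g.
Proof. by move=> hf hg; exact: (RintegralB measurable_cell hf hg). Qed.

Lemma tintZ c f : intg f -> torus_int (c \*o f) = c * torus_int f.
Proof. by move=> hf; exact: (RintegralZl c measurable_cell hf). Qed.

Lemma tint_ge0 f : (forall x, period_cell x -> 0 <= f x) -> 0 <= torus_int f.
Proof. by move=> h; rewrite /torus_int; apply: Rintegral_ge0. Qed.

Lemma tint_le f g : intg f -> intg g -> (forall x, period_cell x -> f x <= g x) -> torus_int f <= torus_int g.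
Proof. by move=> hf hg; exact: (le_Rintegral measurable_cell hf hg). Qed.

Lemma tint_cst c : torus_int (fun=> c) = c * (pi *+ 2).
Proof. 
rewrite /torus_int Rintegral_cst //.
by have /(congr1 fine) /= <- := mu_cell. Qed.

Lemma tint_norm_le f : intg f -> `|torus_int f| <= torus_int (fun x => `|f x|).
Proof. by move=> hf; exact: (le_normr_Rintegral measurable_cell hf). Qed.

Lemma tint_norm_bound f (M : R) : intg f -> (forall x, period_cell x -> `|f x| <= M) ->
  `|torus_int f| <= M * (pi *+ 2).
Proof.
move=> hf fM; rewrite -tint_cst (le_trans (tint_norm_le hf)) //.
apply: tint_le => //; first exact: (integrable_norm hf).
exact: intg_cst.
Qed.

Lemma l2_measurable f : l2 f -> measurable_fun setT f. Proof. by case. Qed.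
Lemma l2_intg f : l2 f -> intg (fun x => f x ^+ 2). Proof. by case. Qed.

Lemma l2M_intg f g : l2 f -> l2 g -> intg (f \* g).
Proof.
move=> [mf hf] [mg hg].
apply: (intg_le (measurable_funM mf mg) _ (intgD hf hg)) => x _ /=.
rewrite normrM -(sqr_normr (f x)) -(sqr_normr (g x)).
nra.
Qed.

Lemma l2_bounded f (M : R) : measurable_fun setT f -> (forall x, period_cell x -> `|f x| <= M) -> l2 f.
Proof.
move=> mf fM; split => //.
apply: (@intg_bounded _ (M ^+ 2)); first exact: measurable_funX.
move=> x Dx; rewrite normrX; have := fM x Dx; have := normr_ge0 (f x); nra.
Qed.

Lemma l2D f g : l2 f -> l2 g -> l2 (f \+ g).
Proof.
move=> hf hg; have [mf h2f] := hf; have [mg h2g] := hg; split; first exact: measurable_funD.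
have -> : (fun x => (f \+ g) x ^+ 2) =
  ((fun x => f x ^+ 2) \+ (2 \*o (f \* g))) \+ (fun x => g x ^+ 2).
  by apply/funext => x /=; ring.
by apply: intgD => //; apply: intgD => //; apply: intgZ; exact: l2M_intg.
Qed.

Lemma l2Z c f : l2 f -> l2 (c \*o f).
Proof.
move=> [mf hf]; split; first by apply: measurable_funM.
have -> : (fun x => (c \*o f) x ^+ 2) = (c ^+ 2 \*o (fun x => f x ^+ 2)).
  by apply/funext => x /=; ring.
exact: intgZ.
Qed.

Lemma l2N f : l2 f -> l2 (\- f).
Proof.
move=> /(l2Z (-1)); have -> : (-1 \*o f) = (\- f) => //.
by apply/funext => x /=; rewrite mulN1r.
Qed.

Lemma l2B f g : l2 f -> l2 g -> l2 (f \- g).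
Proof. by move=> hf /l2N; exact: l2D. Qed.

Lemma l2M_bounded f g (M : R) : measurable_fun setT f -> (forall x, `|f x| <= M) -> l2 g -> l2 (f \* g).
Proof.
move=> mf fM [mg hg]; split; first exact: measurable_funM.
apply: (intg_le _ _ (intgZ (M ^+ 2) hg)); first by apply: measurable_funX; exact: measurable_funM.
move=> x _ /=; rewrite normrX normrM exprMn (sqr_normr (g x)) ler_wpM2r ?sqr_ge0 //.
by have := fM x; have := normr_ge0 (f x); nra.
Qed.

Lemma l2_cst c : l2 (fun=> c).
Proof. by apply: (@l2_bounded _ `|c|). Qed.

Lemma l2_0 : l2 (fun=> 0). Proof. exact: l2_cst. Qed.

Lemma l2_sum (I : Type) (s : seq I) (F : I -> R -> R) : (forall i, l2 (F i)) ->
  l2 (fun x => \sum_(i <- s) F i x).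
Proof.
move=> hF; elim: s => [|i s ih].
  by under eq_fun do rewrite big_nil; exact: l2_0.
by under eq_fun do rewrite big_cons; exact: (l2D (hF i) ih).
Qed.

Lemma ipC f g : ip f g = ip g f.
Proof. by rewrite /ip; congr (torus_int _); apply/funext => x; rewrite mulrC. Qed.

Lemma ipDl f g h : l2 f -> l2 g -> l2 h -> ip (f \+ g) h = ip f h + ip g h.
Proof.
move=> hf hg hh; rewrite /ip -tintD; try exact: l2M_intg.
by congr (torus_int _); apply/funext => x /=; rewrite mulrDl.
Qed.

Lemma ipBl f g h : l2 f -> l2 g -> l2 h -> ip (f \- g) h = ip f h - ip g h.
Proof.
move=> hf hg hh; rewrite /ip -tintB; try exact: l2M_intg.
by congr (torus_int _); apply/funext => x /=; rewrite mulrBl.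
Qed.

Lemma ipZl c f h : l2 f -> l2 h -> ip (c \*o f) h = c * ip f h.
Proof.
move=> hf hh; rewrite /ip -tintZ; try exact: l2M_intg.
by congr (torus_int _); apply/funext => x /=; rewrite mulrA.
Qed.

Lemma ipNl f h : l2 f -> l2 h -> ip (\- f) h = - ip f h.
Proof.
move=> hf hh; rewrite -mulN1r -ipZl //; congr (ip _ h).
by apply/funext => x /=; rewrite mulN1r.
Qed.

Lemma ipDr f g h : l2 f -> l2 g -> l2 h -> ip h (f \+ g) = ip h f + ip h g.
Proof. by move=> *; rewrite !(ipC h) ipDl. Qed.

Lemma ipBr f g h : l2 f -> l2 g -> l2 h -> ip h (f \- g) = ip h f - ip h g.
Proof. by move=> *; rewrite !(ipC h) ipBl. Qed.

Lemma ipZr c f h : l2 f -> l2 h -> ip h (c \*o f) = c * ip h f.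
Proof. by move=> *; rewrite !(ipC h) ipZl. Qed.

Lemma ipNr f h : l2 f -> l2 h -> ip h (\- f) = - ip h f.
Proof. by move=> *; rewrite !(ipC h) ipNl. Qed.

Lemma ip0l h : ip (fun=> 0) h = 0.
Proof.
rewrite /ip; under [fun x => _]eq_fun do rewrite mul0r.
by rewrite tint_cst mul0r.
Qed.

Lemma ip_suml (I : Type) (s : seq I) (F : I -> R -> R) h : (forall i, l2 (F i)) -> l2 h ->
  ip (fun x => \sum_(i <- s) F i x) h = \sum_(i <- s) ip (F i) h.
Proof.
move=> hF hh; elim: s => [|i s ih].
  by rewrite big_nil; under [fun x => _]eq_fun do rewrite big_nil; exact: ip0l.
rewrite big_cons -ih; under [fun x => _]eq_fun do rewrite big_cons.
by rewrite -ipDl //; exact: l2_sum.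
Qed.

Lemma ip_ge0 f : 0 <= ip f f.
Proof. by apply: tint_ge0 => x _; rewrite -expr2 sqr_ge0. Qed.

Lemma n2_ge0 f : 0 <= n2 f. Proof. exact: sqrtr_ge0. Qed.

Lemma n2_sqr f : n2 f ^+ 2 = ip f f.
Proof. by rewrite sqr_sqrtr // ip_ge0. Qed.

Lemma cauchy_schwarz f g : l2 f -> l2 g -> `|ip f g| <= n2 f * n2 g.
Proof.
move=> hf hg.
have quad c : 0 <= ip f f + 2 * c * ip f g + c ^+ 2 * ip g g.
  have -> : ip f f + 2 * c * ip f g + c ^+ 2 * ip g g = ip (f \+ (c \*o g)) (f \+ (c \*o g)).
    rewrite ipDl ?ipDr ?ipZl ?ipZr //; try (by repeat (apply: l2D || apply: l2Z)).
    by rewrite (ipC g f); ring.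
  exact: ip_ge0.
have key : ip f g ^+ 2 <= ip f f * ip g g.
  (* For [ip g g = 0] the quadratic is affine in [c], and the value used below makes it -1;
     otherwise [c] is its minimiser. *)
  have [g0|g0] := eqVneq (ip g g) 0.
    have [->|fg0] := eqVneq (ip f g) 0; first by rewrite g0; lra.
    have := quad (- (ip f f + 1) / (2 * ip f g)); rewrite g0.
    have -> : 2 * (- (ip f f + 1) / (2 * ip f g)) * ip f g = - (ip f f + 1) by field.
    lra.
  have gp : 0 < ip g g by rewrite lt_neqAle eq_sym g0 ip_ge0.
  have := quad (- ip f g / ip g g).
  have -> : ip f f + 2 * (- ip f g / ip g g) * ip f g + (- ip f g / ip g g) ^+ 2 * ip g g =
     (ip f f * ip g g - ip f g ^+ 2) / ip g g by field.
  by rewrite pmulr_lge0 ?invr_gt0 // subr_ge0.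
rewrite /n2 -sqrtrM ?ip_ge0 // -sqrtr_sqr ler_sqrt //.
by rewrite mulr_ge0 // ip_ge0.
Qed.

Lemma n2D f g : l2 f -> l2 g -> n2 (f \+ g) <= n2 f + n2 g.
Proof.
move=> hf hg; have hfg := l2D hf hg.
rewrite -(ler_pXn2r (ltn0Sn 1)) ?nnegrE ?addr_ge0 ?n2_ge0 //.
rewrite n2_sqr ipDl // !ipDr // (ipC g f) sqrrD !n2_sqr.
have := cauchy_schwarz hf hg; have := ler_norm (ip f g); lra.
Qed.

Lemma n2Z c f : l2 f -> n2 (c \*o f) = `|c| * n2 f.
Proof.
move=> hf; rewrite /n2 ipZl // ?ipZr //; last exact: l2Z.
by rewrite mulrA -expr2 sqrtrM ?sqr_ge0 // sqrtr_sqr.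
Qed.

Lemma n2N f : n2 (\- f) = n2 f.
Proof. by rewrite /n2 /ip; congr (Num.sqrt (torus_int _)); apply/funext => x /=; ring. Qed.

Lemma n2B f g : l2 f -> l2 g -> n2 (f \- g) <= n2 f + n2 g.
Proof. by move=> hf hg; rewrite -(n2N g); apply: n2D => //; exact: l2N. Qed.

Lemma n2BC f g : n2 (f \- g) = n2 (g \- f).
Proof. by rewrite -n2N; congr n2; apply/funext => x /=; ring. Qed.

Lemma n2_tri g f h : l2 f -> l2 g -> l2 h -> n2 (f \- h) <= n2 (f \- g) + n2 (g \- h).
Proof.
move=> hf hg hh; have -> : f \- h = (f \- g) \+ (g \- h) by apply/funext => x /=; ring.
by apply: n2D; exact: l2B.
Qed.

Lemma n2_le_bound f (M : R) : measurable_fun setT f -> 0 <= M ->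
  (forall x, period_cell x -> `|f x| <= M) -> n2 f <= M * Num.sqrt (pi *+ 2).
Proof.
move=> mf M0 fM; rewrite -[M in M * _]ger0_norm // -sqrtr_sqr -sqrtrM ?sqr_ge0 //.
apply: ler_wsqrtr; rewrite -tint_cst; apply: tint_le.
- by have := l2_intg (l2_bounded mf fM).
- exact: (l2_intg (l2_cst M)).
- by move=> x Dx /=; rewrite -expr2 -sqr_normr; have := fM x Dx; have := normr_ge0 (f x); nra.
Qed.

Lemma n2M_bounded f g (M : R) : measurable_fun setT f -> 0 <= M -> (forall x, `|f x| <= M) ->
  l2 g -> n2 (f \* g) <= M * n2 g.
Proof.
move=> mf M0 fM hg; rewrite -[M in M * _]ger0_norm // -(n2Z _ hg); apply: ler_wsqrtr.
apply: tint_le.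
- exact: (l2_intg (l2M_bounded mf fM hg)).
- exact: (l2_intg (l2Z M hg)).
- move=> x _ /=; have -> : f x * g x * (f x * g x) = f x ^+ 2 * g x ^+ 2 by ring.
  have -> : M * g x * (M * g x) = M ^+ 2 * g x ^+ 2 by ring.
  rewrite ler_wpM2r ?sqr_ge0 // -sqr_normr.
  by have := fM x; have := normr_ge0 (f x); nra.
Qed.

Lemma n2_eq0_ip f h : l2 f -> l2 h -> n2 f = 0 -> ip f h = 0.
Proof.
move=> hf hh f0; have := cauchy_schwarz hf hh; rewrite f0 mul0r.
by rewrite normr_le0 => /eqP.
Qed.

Lemma n2_eq0_l f g : l2 f -> l2 g -> n2 (f \- g) = 0 -> n2 f = n2 g.
Proof.
move=> hf hg h0; apply/eqP; rewrite eq_le.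
have e1 : f = (f \- g) \+ g by apply/funext => x /=; ring.
have e2 : g = (g \- f) \+ f by apply/funext => x /=; ring.
apply/andP; split.
  by rewrite {1}e1 (le_trans (n2D (l2B hf hg) hg)) // h0 add0r.
by rewrite {1}e2 (le_trans (n2D (l2B hg hf) hf)) // n2BC h0 add0r.
Qed.

End RealL2.
#[export] Hint Resolve measurable_cell : core.

(** * Continuous and C^1 periodic functions, integration by parts *)

Section PeriodicC1.
Context {R : realType}.
Implicit Types (f g h : R -> R) (c : R).

Record pC f : Prop := PC { pC_per : periodic f (pi *+ 2); pC_cont : continuous f }.

(** The derivative is a parameter instead of [derive1 f]: the closure rules then compute it
    symbolically, and [ring] compares the result with the intended formula. *)
Record pC1 f f' : Prop := PC1 {
  pC1_per : periodic f (pi *+ 2);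
  pC1_der : forall x : R, is_derive x (1 : R) f (f' x);
  pC1_cont : continuous f' }.

Lemma derive_continuous f f' : (forall x : R, is_derive x (1 : R) f (f' x)) -> continuous f.
Proof.
by move=> df x; apply: differentiable_continuous; apply/derivable1_diffP; case: (df x).
Qed.

Lemma pC1_pC f f' : pC1 f f' -> pC f.
Proof. by move=> [pf df cf]; split => //; exact: derive_continuous df. Qed.

Lemma derive_periodic f f' : periodic f (pi *+ 2) -> (forall x : R, is_derive x (1 : R) f (f' x)) ->
  periodic f' (pi *+ 2).
Proof.
move=> pf df x.
have h1 := df x; have h2 := df (x + pi *+ 2).
have e : f \o shift (pi *+ 2) = f by apply/funext => y /=; rewrite pf.
have h3 := @is_derive1_comp R f (shift (pi *+ 2)) x _ 1 h2 (is_derive_shift x 1 _).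
rewrite e mulr1 in h3.
by rewrite -(@derive_val _ _ _ _ _ _ _ h3) (@derive_val _ _ _ _ _ _ _ h1).
Qed.

Lemma pC1_pC' f f' : pC1 f f' -> pC f'.
Proof. by move=> [pf df cf]; split => //; exact: derive_periodic df. Qed.

Lemma pCD f g : pC f -> pC g -> pC (f \+ g).
Proof.
move=> [pf cf] [pg cg]; split; first by move=> x /=; rewrite pf pg.
by move=> x; apply: cvgD; [exact: cf | exact: cg].
Qed.

Lemma pCM f g : pC f -> pC g -> pC (f \* g).
Proof.
move=> [pf cf] [pg cg]; split; first by move=> x /=; rewrite pf pg.
by move=> x; apply: cvgM; [exact: cf | exact: cg].
Qed.

Lemma pC_cst c : pC (fun=> c).
Proof. by split => // x; exact: cvg_cst. Qed.

Lemma pCZ c f : pC f -> pC (c \*o f).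
Proof. exact: pCM (pC_cst c). Qed.

Lemma pCN f : pC f -> pC (\- f).
Proof.
move=> /(pCZ (-1)); have -> // : (-1 \*o f) = (\- f).
by apply/funext => x /=; rewrite mulN1r.
Qed.

Lemma pCB f g : pC f -> pC g -> pC (f \- g).
Proof. by move=> hf /pCN; exact: pCD. Qed.

Lemma pCX n f : pC f -> pC (fun x => f x ^+ n).
Proof.
move=> hf; elim: n => [|n ih]; first exact: (pC_cst 1).
by under eq_fun do rewrite exprS; exact: pCM.
Qed.

Lemma pC1_cst c : pC1 (fun=> c) (fun=> 0).
Proof. by split => // x; [exact: is_derive_cst | exact: cvg_cst]. Qed.

Lemma pC1D f f' g g' : pC1 f f' -> pC1 g g' -> pC1 (f \+ g) (f' \+ g').
Proof.
move=> hf hg; have [pf df cf] := hf; have [pg dg cg] := hg; split.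
- by move=> x /=; rewrite pf pg.
- by move=> x; have h1 := df x; have h2 := dg x; exact: (is_deriveD h1 h2).
- exact: (pC_cont (pCD (pC1_pC' hf) (pC1_pC' hg))).
Qed.

Lemma pC1M f f' g g' : pC1 f f' -> pC1 g g' -> pC1 (f \* g) ((f' \* g) \+ (f \* g')).
Proof.
move=> hf hg; have [pf df cf] := hf; have [pg dg cg] := hg; split.
- by move=> x /=; rewrite pf pg.
- move=> x; have h1 := df x; have h2 := dg x.
  apply: (is_derive_eq (is_deriveM h1 h2)) => /=.
  by rewrite /GRing.scale /=; ring.
- exact: (pC_cont (pCD (pCM (pC1_pC' hf) (pC1_pC hg)) (pCM (pC1_pC hf) (pC1_pC' hg)))).
Qed.

Lemma pC1_eq f f' g' : pC1 f f' -> f' =1 g' -> pC1 f g'.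
Proof. by move=> h /funext <-. Qed.

Lemma pC1_ext f f' g g' : pC1 f f' -> f =1 g -> f' =1 g' -> pC1 g g'.
Proof. by move=> h /funext <- /funext <-. Qed.

Lemma pC1_derive1 f f' : pC1 f f' -> pC1 f (derive1 f).
Proof.
move=> h; apply: (pC1_eq h) => x; rewrite derive1E.
by have hx := pC1_der h x; rewrite derive_val.
Qed.

Lemma pC1Z c f f' : pC1 f f' -> pC1 (c \*o f) (c \*o f').
Proof.
by move=> hf; apply: (pC1_eq (pC1M (pC1_cst c) hf)) => x /=; rewrite mul0r add0r.
Qed.

Lemma pC1N f f' : pC1 f f' -> pC1 (\- f) (\- f').
Proof.
move=> /(pC1Z (-1)).
have -> : (-1 \*o f) = (\- f) by apply/funext => x /=; rewrite mulN1r.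
by have -> : (-1 \*o f') = (\- f') by apply/funext => x /=; rewrite mulN1r.
Qed.

Lemma pC1B f f' g g' : pC1 f f' -> pC1 g g' -> pC1 (f \- g) (f' \- g').
Proof. by move=> hf /pC1N; exact: pC1D. Qed.

Lemma pC1X n f f' : pC1 f f' -> pC1 (fun x => f x ^+ n) (fun x => n%:R * f x ^+ n.-1 * f' x).
Proof.
move=> hf; elim: n => [|n ih].
  by apply: (pC1_eq (pC1_cst 1)) => x; rewrite !mul0r.
have -> : (fun x => f x ^+ n.+1) = (f \* (fun x => f x ^+ n)).
  by apply/funext => x /=; rewrite exprS.
apply: (pC1_eq (pC1M hf ih)) => x /=.
case: n {ih} => [|n] /=; first by rewrite expr0; ring.
by rewrite -[n.+2]addn1 natrD exprS; ring.
Qed.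

Lemma pC1_sum (I : Type) (s : seq I) (F F' : I -> R -> R) : (forall i, pC1 (F i) (F' i)) ->
  pC1 (fun x => \sum_(i <- s) F i x) (fun x => \sum_(i <- s) F' i x).
Proof.
move=> hF; elim: s => [|i s ih].
  under eq_fun do rewrite big_nil; apply: (pC1_eq (pC1_cst 0)) => x.
  by rewrite big_nil.
under eq_fun do rewrite big_cons.
by apply: (pC1_eq (pC1D (hF i) ih)) => x; rewrite big_cons.
Qed.

Lemma cell0 : period_cell (0 : R).
Proof. by rewrite /period_cell /= in_itv /= lexx ltW // twopi_gt0. Qed.

Lemma cont_bounded_cell f : continuous f -> exists2 M : R, 0 <= M & forall x, period_cell x -> `|f x| <= M.
Proof.
move=> cf.
have cc : compact (f @` period_cell).
  apply: continuous_compact; first exact: continuous_subspaceT.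
  exact: segment_compact.
have [M [_ hM]] := compact_bounded cc.
exists (`|M| + 1); first by rewrite addr_ge0.
move=> x Dx; apply: (hM (`|M| + 1)); last by exists x.
by rewrite (le_lt_trans (ler_norm M)) // ltrDl.
Qed.

Lemma period_reduce (x : R) : exists2 y, period_cell y & forall f, periodic f (pi *+ 2) -> f x = f y.
Proof.
pose T : R := pi *+ 2; pose k := Num.floor (x / T).
have T0 : 0 < T := twopi_gt0.
have pn (f : R -> R) : periodic f T -> forall n y, f (y + T *+ n) = f y by move=> pf n y; exact: periodicn.
exists (x - T *~ k).
  rewrite /period_cell /= in_itv /=.
  have h1 : k%:~R <= x / T by exact: ge_floor.
  have h2 : x / T < (k + 1)%:~R by exact: lt_succ_floor.
  rewrite -mulrzl subr_ge0 lerBlDr.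
  move: h1 h2; rewrite ler_pdivlMr // ltr_pdivrMr // => h1 h2.
  rewrite h1 /= (le_trans (ltW h2)) // intrD mulrDl mul1r /T; lra.
move=> f pf; case: k => n.
  by rewrite -[in LHS](subrK (T *~ n) x) -pmulrn; rewrite pn.
have -> : x - T *~ Negz n = x + T *+ n.+1 by rewrite NegzE mulrNz opprK -pmulrn.
by rewrite pn.
Qed.

Lemma pC_bounded f : pC f -> exists2 M : R, 0 <= M & forall x, `|f x| <= M.
Proof.
move=> [pf cf]; have [M M0 hM] := cont_bounded_cell cf; exists M => // x.
by have [y Dy ->] := period_reduce x; auto.
Qed.

Lemma cont_measurable f : continuous f -> measurable_fun setT f.
Proof. exact: continuous_measurable_fun. Qed.

Lemma cont_l2 f : continuous f -> l2 f.
Proof.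
move=> cf; have [M M0 hM] := cont_bounded_cell cf.
by apply: l2_bounded hM; exact: cont_measurable.
Qed.

Lemma pC_l2 f : pC f -> l2 f. Proof. by move=> [_ /cont_l2]. Qed.

Lemma cont_intg f : continuous f -> intg f.
Proof.
move=> cf; have [M M0 hM] := cont_bounded_cell cf.
by apply: intg_bounded hM; exact: cont_measurable.
Qed.

Lemma pC_intg f : pC f -> intg f. Proof. by move=> [_ /cont_intg]. Qed.

Lemma tint_deriv f f' : (forall x : R, is_derive x (1 : R) f (f' x)) -> continuous f' ->
  torus_int f' = f (pi *+ 2) - f 0.
Proof.
move=> df cf.
have cF := derive_continuous df.
have h1 : derivable_oo_LRcontinuous f 0 (pi *+ 2).
  split.
  - by move=> x _; case: (df x).
  - by apply: cvg_at_right_filter; exact: cF.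
  - by apply: cvg_at_left_filter; exact: cF.
have h2 : {in `]0, (pi *+ 2)[, (f^`())%classic =1 f'}.
  by move=> x _; rewrite derive1E; have hx := df x; rewrite derive_val.
have h3 : {within `[0, (pi *+ 2)], continuous f'} by exact: continuous_subspaceT.
by rewrite /torus_int /Rintegral (continuous_FTC2 twopi_gt0 h3 h1 h2).
Qed.

Lemma tint_deriv0 f f' : pC1 f f' -> torus_int f' = 0.
Proof. by move=> [pf df cf]; rewrite (tint_deriv df cf) -[X in f X - _]add0r pf subrr. Qed.

Lemma ip_ibp f f' g g' : pC1 f f' -> pC1 g g' -> ip f g' = - ip f' g.
Proof.
move=> hf hg.
have := tint_deriv0 (pC1M hf hg); rewrite tintD; last 2 first.
- exact: pC_intg (pCM (pC1_pC' hf) (pC1_pC hg)).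
- exact: pC_intg (pCM (pC1_pC hf) (pC1_pC' hg)).
by move=> /eqP; rewrite addrC addr_eq0 => /eqP.
Qed.

End PeriodicC1.

(** * Trigonometric system and Fourier partial sums *)

Section Trig.
Context {R : realType}.
Implicit Types (f g h : R -> R) (c : R).

Definition cc (k : nat) (x : R) : R := cos (k%:R * x).
Definition ss (k : nat) (x : R) : R := sin (k%:R * x).

Lemma scal_per (F : R -> R) k : periodic F (pi *+ 2) -> periodic (fun x => F (k%:R * x)) (pi *+ 2).
Proof.
move=> pF x; rewrite mulrDr mulr_natl [k%:R * (pi *+ 2)]mulr_natl.
exact: periodicn.
Qed.

Lemma scal_derive (F F' : R -> R) k : (forall x : R, is_derive x (1 : R) F (F' x)) ->
  forall x : R, is_derive x (1 : R) (fun x => F (k%:R * x)) (k%:R * F' (k%:R * x)).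
Proof.
move=> dF x.
have h1 : is_derive x (1 : R) (fun y : R => k%:R * y) k%:R.
  by apply: is_derive_eq; rewrite /GRing.scale /= mulr1.
have := @is_derive1_comp R F _ x _ _ (dF (k%:R * x)) h1.
by rewrite mulrC.
Qed.

Lemma scal_cont (F : R -> R) k : continuous F -> continuous (fun x : R => F (k%:R * x)).
Proof.
move=> cF x; apply: (@continuous_comp _ _ _ (fun y : R => k%:R * y) F); last exact: cF.
exact: mulrl_continuous.
Qed.

Lemma cc_pC k : pC (cc k).
Proof. by split; [apply: scal_per; exact: cosD2pi | exact: (scal_cont (@continuous_cos R))]. Qed.

Lemma ss_pC k : pC (ss k).
Proof. by split; [apply: scal_per; exact: sinD2pi | exact: (scal_cont (@continuous_sin R))]. Qed.

Lemma cc_pC1 k : pC1 (cc k) (- k%:R \*o ss k).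
Proof.
split; first by apply: scal_per; exact: cosD2pi.
- move=> x; have := @scal_derive cos (fun x => - sin x) k (@is_derive_cos R) x.
  by rewrite mulrN -mulNr.
- exact: (pC_cont (pCZ _ (ss_pC k))).
Qed.

Lemma ss_pC1 k : pC1 (ss k) (k%:R \*o cc k).
Proof.
split; first by apply: scal_per; exact: sinD2pi.
- exact: (@scal_derive sin cos k (@is_derive_sin R)).
- exact: (pC_cont (pCZ _ (cc_pC k))).
Qed.

Lemma cc_l2 k : l2 (cc k). Proof. exact: pC_l2 (cc_pC k). Qed.
Lemma ss_l2 k : l2 (ss k). Proof. exact: pC_l2 (ss_pC k). Qed.
Hint Resolve cc_l2 ss_l2 : core.

Lemma cc0 : cc 0 = fun=> 1. Proof. by apply/funext => x; rewrite /cc mul0r cos0. Qed.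
Lemma ss0 : ss 0 = fun=> 0. Proof. by apply/funext => x; rewrite /ss mul0r sin0. Qed.

Let ibp_ss_cc j k : j%:R * ip (cc j) (ss k) = - (k%:R * ip (ss j) (cc k)).
Proof.
have := ip_ibp (ss_pC1 j) (ss_pC1 k).
by rewrite ipZr // ipZl // => /esym/eqP; rewrite eqr_oppLR => /eqP.
Qed.

Let ibp_cc j k : j%:R * ip (cc j) (cc k) = k%:R * ip (ss j) (ss k).
Proof.
have := ip_ibp (ss_pC1 j) (cc_pC1 k).
rewrite ipZr // ipZl // mulNr => /eqP; rewrite eqr_opp => /eqP ->; by [].
Qed.

Let sq_neq (j k : nat) : j != k -> (j%:R ^+ 2 - k%:R ^+ 2 : R) != 0.
Proof.
move=> jk; by rewrite subr_eq0 -!natrX eqr_nat eqn_exp2r.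
Qed.

(** Integration by parts replaces product-to-sum formulas: applied to both factors it shows that
    (j^2 - k^2) times the product is 0, which settles j != k. *)
Lemma ip_cc_ss j k : ip (cc j) (ss k) = 0.
Proof.
have e1 := ibp_ss_cc j k.
have e2 : j%:R * ip (ss j) (cc k) = - (k%:R * ip (cc j) (ss k)).
  have := ip_ibp (cc_pC1 j) (cc_pC1 k); rewrite ipZr // ipZl // !mulNr opprK => <- //.
have [jk|jk] := eqVneq j k; last first.
  apply: (mulfI (sq_neq jk)); rewrite mulr0 mulrBl !expr2 -!mulrA e1 mulrN.
  have -> : j%:R * (k%:R * ip (ss j) (cc k)) = k%:R * (j%:R * ip (ss j) (cc k)) by ring.
  by rewrite e2; ring.
(* For j = k the identity says j x = - j x: either x = 0, or j = 0 and [ss 0] vanishes. *)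
move: e1; rewrite -jk (ipC (ss j)) => /eqP.
rewrite -addr_eq0 -mulr2n -mulrnAl mulf_eq0 mulrn_eq0 /= pnatr_eq0 => /orP[/eqP ->|/eqP //].
by rewrite ss0 ipC ip0l.
Qed.

Lemma ip_cc_neq j k : j != k -> ip (cc j) (cc k) = 0.
Proof.
move=> jk; have e1 := ibp_cc j k; have e2 := ibp_cc k j.
rewrite (ipC (cc k)) (ipC (ss k)) in e2.
apply: (mulfI (sq_neq jk)); rewrite mulr0 mulrBl !expr2 -!mulrA e1 e2; ring.
Qed.

Lemma ip_ss_neq j k : j != k -> ip (ss j) (ss k) = 0.
Proof.
move=> jk; have e1 := ibp_cc j k; have e2 := ibp_cc k j.
rewrite (ipC (cc k)) (ipC (ss k)) in e2.
apply: (mulfI (sq_neq jk)); rewrite mulr0 mulrBl !expr2 -!mulrA -e1 -e2; ring.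
Qed.

Lemma cc2Dss2 k x : cc k x ^+ 2 + ss k x ^+ 2 = 1.
Proof. exact: cos2Dsin2. Qed.

(** Integration by parts equates the squared norms of [cc k] and [ss k], and they add up to 2 pi
    because cos^2 + sin^2 = 1. *)
Lemma ip_cc_eq k : (0 < k)%N -> ip (cc k) (cc k) = pi.
Proof.
move=> k0.
have e1 := ibp_cc k k.
have kn0 : (k%:R : R) != 0 by rewrite pnatr_eq0 -lt0n.
have {}e1 := mulfI kn0 e1.
have e2 : ip (cc k) (cc k) + ip (ss k) (ss k) = pi *+ 2.
  rewrite -[RHS]mul1r -tint_cst /ip -tintD; try exact: l2M_intg.
  by congr torus_int; apply/funext => x /=; rewrite -!expr2 cc2Dss2.
move: e2; rewrite -e1 -mulr2n => /eqP; rewrite -subr_eq0 -mulrnBl mulrn_eq0 subr_eq0.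
by move=> /orP[//|/eqP].
Qed.

Lemma ip_ss_eq k : (0 < k)%N -> ip (ss k) (ss k) = pi.
Proof.
move=> k0; rewrite -(ip_cc_eq k0); have kn0 : (k%:R : R) != 0 by rewrite pnatr_eq0 -lt0n.
exact: esym (mulfI kn0 (ibp_cc k k)).
Qed.

Lemma ip_cc_0 : ip (cc 0) (cc 0) = pi *+ 2.
Proof.
rewrite cc0 -[RHS]mul1r -tint_cst /ip; congr torus_int; apply/funext => x /=.
by rewrite mulr1.
Qed.

End Trig.
#[export] Hint Resolve cc_l2 ss_l2 : core.

Section Fourier.
Context {R : realType}.
Implicit Types (f g h : R -> R) (c : R) (N : nat).

(** Inverse of the squared norm of [cc k], and of [ss k] as well unless k = 0, where [ss 0 = 0]. *)
Definition fw (k : nat) : R := if k is 0 then (pi *+ 2)^-1 else pi^-1.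

Lemma fw_gt0 k : 0 < fw k.
Proof. by case: k => [|k]; rewrite invr_gt0 ?twopi_gt0 // pi_gt0. Qed.

Definition fterm f (k : nat) : R -> R :=
  fun x => fw k * (ip f (cc k) * cc k x + ip f (ss k) * ss k x).

Definition fproj N f : R -> R := fun x => \sum_(k < N) fterm f k x.

Definition fterm' f (k : nat) : R -> R :=
  fun x => fw k * (- (k%:R * ip f (cc k)) * ss k x + k%:R * ip f (ss k) * cc k x).

Definition fproj' N f : R -> R := fun x => \sum_(k < N) fterm' f k x.

Lemma fterm_pC1 f k : pC1 (fterm f k) (fterm' f k).
Proof.
apply: (pC1_eq (pC1Z (fw k) (pC1D (pC1Z (ip f (cc k)) (cc_pC1 k)) (pC1Z (ip f (ss k)) (ss_pC1 k))))).
by move=> x /=; rewrite /fterm'; ring.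
Qed.

Lemma fproj_pC1 N f : pC1 (fproj N f) (fproj' N f).
Proof. by apply: pC1_sum => i; exact: fterm_pC1. Qed.

Lemma fproj_pC N f : pC (fproj N f). Proof. exact: pC1_pC (fproj_pC1 N f). Qed.
Lemma fproj'_pC N f : pC (fproj' N f). Proof. exact: pC1_pC' (fproj_pC1 N f). Qed.
Lemma fterm_l2 f k : l2 (fterm f k). Proof. exact: pC_l2 (pC1_pC (fterm_pC1 f k)). Qed.
Lemma fproj_l2 N f : l2 (fproj N f). Proof. exact: pC_l2 (fproj_pC N f). Qed.
Lemma fproj'_l2 N f : l2 (fproj' N f). Proof. exact: pC_l2 (fproj'_pC N f). Qed.
Hint Resolve fterm_l2 fproj_l2 fproj'_l2 : core.

Lemma ip_fterm f g k : l2 g ->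
  ip (fterm f k) g = fw k * (ip f (cc k) * ip (cc k) g + ip f (ss k) * ip (ss k) g).
Proof.
move=> hg; rewrite /fterm.
have e : (fun x => fw k * (ip f (cc k) * cc k x + ip f (ss k) * ss k x)) =
  (fw k \*o ((ip f (cc k) \*o cc k) \+ (ip f (ss k) \*o ss k))) by [].
by rewrite e ipZl ?ipDl ?ipZl //; try (apply: l2D); try (apply: l2Z).
Qed.

Lemma ip_fproj N f g : l2 g ->
  ip (fproj N f) g = \sum_(k < N) fw k * (ip f (cc k) * ip (cc k) g + ip f (ss k) * ip (ss k) g).
Proof.
move=> hg; rewrite /fproj ip_suml //; apply: eq_bigr => i _; exact: ip_fterm.
Qed.

Lemma fproj_sym N f g : l2 f -> l2 g -> ip (fproj N f) g = ip f (fproj N g).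
Proof.
move=> hf hg; rewrite ip_fproj // (ipC f) ip_fproj //; apply: eq_bigr => i _.
by rewrite (ipC g (cc _)) (ipC g (ss _)) (ipC _ f) (ipC _ f); ring.
Qed.

Lemma fprojD N f g : l2 f -> l2 g -> fproj N (f \+ g) = fproj N f \+ fproj N g.
Proof.
move=> hf hg; apply/funext => x /=; rewrite /fproj -big_split /=; apply: eq_bigr => k _.
by rewrite /fterm !ipDl //; ring.
Qed.

Lemma fprojZ N c f : l2 f -> fproj N (c \*o f) = c \*o fproj N f.
Proof.
move=> hf; apply/funext => x /=; rewrite /fproj mulr_sumr /=; apply: eq_bigr => k _.
by rewrite /fterm !ipZl //; ring.
Qed.

Lemma fprojB N f g : l2 f -> l2 g -> fproj N (f \- g) = fproj N f \- fproj N g.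
Proof.
move=> hf hg; apply/funext => x /=; rewrite /fproj -sumrB /=; apply: eq_bigr => k _.
by rewrite /fterm !ipBl //; ring.
Qed.

Lemma fterm_cc j k : fterm (cc j) k = if k == j then cc j else fun=> 0.
Proof.
apply/funext => x; rewrite /fterm ip_cc_ss.
have [->|kj] := eqVneq k j; last by rewrite ip_cc_neq 1?eq_sym //; ring.
rewrite mul0r addr0 mulrA -[RHS]mul1r; congr (_ * _).
case: j => [|j] /=; first by rewrite ip_cc_0 mulVf // gt_eqF // twopi_gt0.
by rewrite ip_cc_eq // mulVf // gt_eqF // pi_gt0.
Qed.

Lemma fterm_ss j k : fterm (ss j) k = if k == j then ss j else fun=> 0.
Proof.
apply/funext => x; rewrite /fterm (ipC _ (cc _)) ip_cc_ss.
have [->|kj] := eqVneq k j; last by rewrite ip_ss_neq 1?eq_sym //; ring.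
rewrite mul0r add0r; case: j => [|j]; first by rewrite ss0 !mulr0.
by rewrite mulrA ip_ss_eq // mulVf ?mul1r // gt_eqF // pi_gt0.
Qed.

Lemma fproj_cc N j : (j < N)%N -> fproj N (cc j) = cc j.
Proof.
move=> jN; apply/funext => x; rewrite /fproj (bigD1 (Ordinal jN)) //= fterm_cc eqxx.
by rewrite big1 ?addr0 // => i ij; rewrite fterm_cc ifN.
Qed.

Lemma fproj_ss N j : (j < N)%N -> fproj N (ss j) = ss j.
Proof.
move=> jN; apply/funext => x; rewrite /fproj (bigD1 (Ordinal jN)) //= fterm_ss eqxx.
by rewrite big1 ?addr0 // => i ij; rewrite fterm_ss ifN.
Qed.

Lemma fproj_sum N (I : Type) (s : seq I) (F : I -> R -> R) : (forall i, l2 (F i)) ->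
  fproj N (fun x => \sum_(i <- s) F i x) = fun x => \sum_(i <- s) fproj N (F i) x.
Proof.
move=> hF; elim: s => [|i s ih].
  apply/funext => x; rewrite big_nil /fproj big1 // => k _.
  under [X in fterm X]eq_fun do rewrite big_nil.
  by rewrite /fterm !ip0l; ring.
under [X in fproj N X]eq_fun do rewrite big_cons.
under [RHS]eq_fun do rewrite big_cons.
by rewrite (fprojD N (hF i) (l2_sum s hF)) ih.
Qed.

Lemma fproj_fproj M N f : (M <= N)%N -> fproj N (fproj M f) = fproj M f.
Proof.
move=> MN; rewrite {2}/fproj fproj_sum //; apply/funext => x; apply: eq_bigr => k _.
have kN : (k < N)%N by exact: leq_trans MN.
have -> : fterm f k = (fw k \*o ((ip f (cc k) \*o cc k) \+ (ip f (ss k) \*o ss k))) by [].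
by rewrite fprojZ ?fprojD ?fprojZ ?fproj_cc ?fproj_ss //;
  do ?[apply: l2D]; apply: l2Z.
Qed.

(** [fproj N] is symmetric and idempotent, so the squared norm of [fproj N f] is [ip f (fproj N f)]
    and Cauchy-Schwarz applies. *)
Lemma n2_fproj N f : l2 f -> n2 (fproj N f) <= n2 f.
Proof.
move=> hf; have h : ip (fproj N f) (fproj N f) = ip f (fproj N f).
  by rewrite (fproj_sym _ hf (fproj_l2 N f)) (fproj_fproj _ (leqnn N)).
have := cauchy_schwarz hf (fproj_l2 N f); rewrite -h -n2_sqr ger0_norm ?sqr_ge0 // expr2.
have [->|n0] := eqVneq (n2 (fproj N f)) 0; first by rewrite n2_ge0.
by rewrite ler_pM2r // lt_neqAle eq_sym n0 n2_ge0.
Qed.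

Inductive trigp : (R -> R) -> Prop :=
| trigp_cc k : trigp (cc k)
| trigp_ss k : trigp (ss k)
| trigpD f g : trigp f -> trigp g -> trigp (f \+ g)
| trigpZ c f : trigp f -> trigp (c \*o f).

Lemma trigp_pC f : trigp f -> pC f.
Proof.
elim=> [k|k|{}f g _ hf _ hg|c {}f _ hf]; [exact: cc_pC|exact: ss_pC|exact: pCD|exact: pCZ].
Qed.

Lemma trigp_l2 f : trigp f -> l2 f. Proof. by move/trigp_pC/pC_l2. Qed.

Lemma fproj_trigp f : trigp f -> exists N0, forall N, (N0 <= N)%N -> fproj N f = f.
Proof.
elim=> [k|k|{}f g tf [Nf hf] tg [Ng hg]|c {}f tf [N0 hf]].
- by exists k.+1 => N; exact: fproj_cc.
- by exists k.+1 => N; exact: fproj_ss.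
- exists (maxn Nf Ng) => N; rewrite geq_max => /andP[h1 h2].
  by rewrite fprojD ?hf ?hg //; exact: trigp_l2.
- by exists N0 => N hN; rewrite fprojZ ?hf //; exact: trigp_l2.
Qed.

(* Separated trigonometric kernels: the convolution-type operators they define have
   trigonometric polynomials as values. *)
Inductive sepk : (R -> R -> R) -> Prop :=
| sepk1 p q : trigp p -> pC q -> sepk (fun x y => p x * q y)
| sepkD K L : sepk K -> sepk L -> sepk (fun x y => K x y + L x y).

Lemma trigp_cosM f : trigp f -> trigp (cos \* f).
Proof.
have c1 : cos = @cc R 1 by apply/funext => x; rewrite /cc mul1r.
elim=> [k|k|{}f g _ hf _ hg|c {}f _ hf].
- case: k => [|k].
    have -> : cos \* cc 0 = @cc R 1 by rewrite cc0 c1; apply/funext => x /=; rewrite mulr1.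
    exact: trigp_cc.
  have -> : cos \* cc k.+1 = 2^-1 \*o (@cc R k.+2 \+ @cc R k).
    apply/funext => x /=; rewrite /cc.
    have -> : k.+2%:R * x = k.+1%:R * x + x by rewrite -[k.+2]addn1 natrD; ring.
    have -> : k%:R * x = k.+1%:R * x - x by rewrite -[k.+1]addn1 natrD; ring.
    by rewrite cosD cosB; field.
  exact: trigpZ (trigpD (trigp_cc _) (trigp_cc _)).
- case: k => [|k].
    have -> : cos \* ss 0 = @ss R 0 by rewrite ss0; apply/funext => x /=; rewrite mulr0.
    exact: trigp_ss.
  have -> : cos \* ss k.+1 = 2^-1 \*o (@ss R k.+2 \+ @ss R k).
    apply/funext => x /=; rewrite /ss.
    have -> : k.+2%:R * x = k.+1%:R * x + x by rewrite -[k.+2]addn1 natrD; ring.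
    have -> : k%:R * x = k.+1%:R * x - x by rewrite -[k.+1]addn1 natrD; ring.
    by rewrite sinD sinB; field.
  exact: trigpZ (trigpD (trigp_ss _) (trigp_ss _)).
- have -> : cos \* (f \+ g) = (cos \* f) \+ (cos \* g) by apply/funext => x /=; ring.
  exact: trigpD.
- have -> : cos \* (c \*o f) = c \*o (cos \* f) by apply/funext => x /=; ring.
  exact: trigpZ.
Qed.

Lemma trigp_sinM f : trigp f -> trigp (sin \* f).
Proof.
have s1 : sin = @ss R 1 by apply/funext => x; rewrite /ss mul1r.
elim=> [k|k|{}f g _ hf _ hg|c {}f _ hf].
- case: k => [|k].
    have -> : sin \* cc 0 = @ss R 1 by rewrite cc0 s1; apply/funext => x /=; rewrite mulr1.
    exact: trigp_ss.
  have -> : sin \* cc k.+1 = 2^-1 \*o (@ss R k.+2 \+ (-1) \*o @ss R k).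
    apply/funext => x /=; rewrite /ss /cc.
    have -> : k.+2%:R * x = k.+1%:R * x + x by rewrite -[k.+2]addn1 natrD; ring.
    have -> : k%:R * x = k.+1%:R * x - x by rewrite -[k.+1]addn1 natrD; ring.
    by rewrite sinD sinB; field.
  exact: trigpZ (trigpD (trigp_ss _) (trigpZ _ (trigp_ss _))).
- case: k => [|k].
    have -> : sin \* ss 0 = @ss R 0 by rewrite ss0; apply/funext => x /=; rewrite mulr0.
    exact: trigp_ss.
  have -> : sin \* ss k.+1 = 2^-1 \*o (@cc R k \+ (-1) \*o @cc R k.+2).
    apply/funext => x /=; rewrite /ss /cc.
    have -> : k.+2%:R * x = k.+1%:R * x + x by rewrite -[k.+2]addn1 natrD; ring.
    have -> : k%:R * x = k.+1%:R * x - x by rewrite -[k.+1]addn1 natrD; ring.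
    by rewrite cosB cosD; field.
  exact: trigpZ (trigpD (trigp_cc _) (trigpZ _ (trigp_cc _))).
- have -> : sin \* (f \+ g) = (sin \* f) \+ (sin \* g) by apply/funext => x /=; ring.
  exact: trigpD.
- have -> : sin \* (c \*o f) = c \*o (sin \* f) by apply/funext => x /=; ring.
  exact: trigpZ.
Qed.

Let cos_pC : pC (@cos R). Proof. by split; [exact: cosD2pi | exact: continuous_cos]. Qed.
Let sin_pC : pC (@sin R). Proof. by split; [exact: sinD2pi | exact: continuous_sin]. Qed.

Lemma sepkM_cosB K : sepk K -> sepk (fun x y => (1 + cos (x - y)) * K x y).
Proof.
elim=> [p q tp cq|{}K L _ hK _ hL].
  have -> : (fun x y => (1 + cos (x - y)) * (p x * q y)) =
    (fun x y => p x * q y + ((cos \* p) x * (cos \* q) y + (sin \* p) x * (sin \* q) y)).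
    by apply/funext => x; apply/funext => y /=; rewrite cosB; ring.
  apply: (sepkD (sepk1 tp cq)).
  apply: (@sepkD (fun x y => (cos \* p) x * (cos \* q) y) (fun x y => (sin \* p) x * (sin \* q) y)).
  - by apply: sepk1; [exact: trigp_cosM | exact: pCM].
  - by apply: sepk1; [exact: trigp_sinM | exact: pCM].
have -> : (fun x y => (1 + cos (x - y)) * (K x y + L x y)) =
  (fun x y => (1 + cos (x - y)) * K x y + (1 + cos (x - y)) * L x y).
  by apply/funext => x; apply/funext => y /=; ring.
exact: sepkD.
Qed.

Lemma sepk_int K f : sepk K -> l2 f -> trigp (fun x => ip f (K x)) /\ forall x, pC (K x).
Proof.
move=> hK hf; elim: hK => [p q tp cq|{}K L _ [h1 h2] _ [h3 h4]].
  split; last by move=> x; exact: pCZ.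
  have -> : (fun x => ip f (fun y => p x * q y)) = (ip f q \*o p).
    apply/funext => x; transitivity (p x * ip f q); last exact: mulrC.
    exact: (ipZr (p x) (pC_l2 cq) hf).
  exact: trigpZ.
split; last by move=> x; exact: pCD.
have -> : (fun x => ip f (fun y => K x y + L x y)) = (fun x => ip f (K x)) \+ (fun x => ip f (L x)).
  by apply/funext => x; exact: (ipDr (pC_l2 (h2 x)) (pC_l2 (h4 x)) hf).
exact: trigpD.
Qed.

(** Up to normalisation the de la Vallee Poussin kernel (2 cos^2 ((x - y) / 2))^n. It is
    nonnegative, and a single integration by parts gives both its mass and its concentration. *)
Definition jker (n : nat) (x y : R) : R := (1 + cos (x - y)) ^+ n.

Lemma sepk_jker n : sepk (jker n).
Proof.
elim: n => [|n ih].
  have -> : jker 0 = (fun x y => cc 0 x * cc 0 y).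
    by apply/funext => x; apply/funext => y; rewrite /jker expr0 !cc0 mulr1.
  by apply: sepk1; [exact: trigp_cc | exact: cc_pC].
have -> : jker n.+1 = (fun x y => (1 + cos (x - y)) * jker n x y).
  by apply/funext => x; apply/funext => y; rewrite /jker exprS.
exact: sepkM_cosB.
Qed.

Lemma jker_ge0 n x y : 0 <= jker n x y.
Proof. by apply: exprn_ge0; have := cos_geN1 (x - y); lra. Qed.

Lemma jker_pC n x : pC (jker n x).
Proof. exact: (sepk_int (sepk_jker n) l2_0).2 x. Qed.

Lemma cosB_pC1 (x : R) : pC1 (fun y : R => cos (x - y)) (fun y : R => sin (x - y)).
Proof.
apply: (pC1_ext (pC1D (pC1Z (cos x) (cc_pC1 1)) (pC1Z (sin x) (ss_pC1 1)))) => y /=.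
  by rewrite cosB /cc /ss mul1r.
by rewrite sinB /cc /ss mul1r; ring.
Qed.

Lemma sinB_pC1 (x : R) : pC1 (fun y : R => sin (x - y)) (fun y : R => - cos (x - y)).
Proof.
apply: (pC1_ext (pC1B (pC1Z (sin x) (cc_pC1 1)) (pC1Z (cos x) (ss_pC1 1)))) => y /=.
  by rewrite sinB /cc /ss mul1r.
by rewrite cosB /cc /ss mul1r; ring.
Qed.

(* The derivative of sin(x-y)(1+cos(x-y))^n in y is (n - (n+1)cos(x-y))(1+cos(x-y))^n. *)
Lemma tint_jker_cos n x :
  (n.+1)%:R * torus_int (fun y => cos (x - y) * jker n x y) = n%:R * torus_int (jker n x).
Proof.
have h1 := pC1D (pC1_cst 1) (cosB_pC1 x).
have := tint_deriv0 (pC1M (sinB_pC1 x) (pC1X n h1)).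
set F := (X in torus_int X).
have -> : F = (n%:R \*o jker n x) \- (n.+1%:R \*o (fun y => cos (x - y) * jker n x y)).
  apply/funext => y; rewrite /F /= /jker; have := cos2Dsin2 (x - y).
  case: n {F} => [|n] /=; first by rewrite !expr0 => _; ring.
  rewrite (exprS _ n) add0r -[n.+2%:R]natr1 -[n.+1%:R]natr1.
  set C := cos (x - y); set S := sin (x - y); set K := (1 + C) ^+ n => hCS.
  have -> : S * ((n%:R + 1) * K * S) = (n%:R + 1) * K * (S ^+ 2) by ring.
  have -> : S ^+ 2 = 1 - C ^+ 2 by rewrite -hCS; ring.
  ring.
have j1 := pC_intg (jker_pC n x).
have j2 := pC_intg (pCM (pC1_pC (cosB_pC1 x)) (jker_pC n x)).
rewrite tintB ?tintZ //; try exact: intgZ.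
by move=> /eqP; rewrite subr_eq0 => /eqP <-.
Qed.

(** This is 2 pi C(2n, n) / 2^n. The recursion comes from [tint_jker_cos]: the next mass is the
    present one times 1 + n / (n + 1). *)
Fixpoint jmass (n : nat) : R :=
  if n is n'.+1 then jmass n' * (n'.*2.+1%:R / n'.+1%:R) else pi *+ 2.

Lemma jmass_gt0 n : 0 < jmass n.
Proof. by elim: n => [|n ih] /=; rewrite ?twopi_gt0 // mulr_gt0 // divr_gt0. Qed.

Lemma tint_jker n x : torus_int (jker n x) = jmass n.
Proof.
elim: n => [|n ih]; first by rewrite /jker; under [fun y => _]eq_fun do rewrite expr0; rewrite tint_cst mul1r.
have -> : jker n.+1 x = jker n x \+ (fun y => cos (x - y) * jker n x y).
  by apply/funext => y /=; rewrite /jker exprS; ring.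
have j1 := pC_intg (jker_pC n x).
have j2 := pC_intg (pCM (pC1_pC (cosB_pC1 x)) (jker_pC n x)).
have n0 : (n.+1%:R : R) != 0 by rewrite pnatr_eq0.
rewrite tintD //; apply: (mulfI n0); rewrite mulrDr tint_jker_cos ih /=.
by rewrite -addnn -[(n + n).+1%:R]natr1 natrD -[n.+1%:R]natr1 in n0 *; field.
Qed.

(** Concentration on the diagonal: relative to the mass, the moment of 1 - cos(x - y) is of order
    1/n. This is the only test function that a Korovkin argument needs. *)
Lemma tint_jker_var n x :
  torus_int (fun y => (1 - cos (x - y)) * jker n x y) = jmass n / n.+1%:R.
Proof.
have n0 : (n.+1%:R : R) != 0 by rewrite pnatr_eq0.
have -> : (fun y => (1 - cos (x - y)) * jker n x y) = jker n x \- (fun y => cos (x - y) * jker n x y).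
  by apply/funext => y /=; ring.
have j1 := pC_intg (jker_pC n x).
have j2 := pC_intg (pCM (pC1_pC (cosB_pC1 x)) (jker_pC n x)).
rewrite tintB //; apply: (mulfI n0); rewrite mulrBr tint_jker_cos tint_jker.
by rewrite -[n.+1]addn1 natrD in n0 *; field.
Qed.

(** A Wallis-type bound on C(2n, n) / 4^n. With t = 2n the inductive step is (t + 1)(t + 3) <= (t +
    2)^2. *)
Lemma jmass_sqr n : (jmass n / 2 ^+ n) ^+ 2 <= (pi *+ 2) ^+ 2 / (n.*2.+1)%:R.
Proof.
elim: n => [|n ih]; first by rewrite /= expr0 !divr1.
rewrite /= (exprS _ n).
have -> : jmass n * (n.*2.+1%:R / n.+1%:R) / (2 * 2 ^+ n) =
   (jmass n / 2 ^+ n) * (n.*2.+1%:R / n.+1.*2%:R).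
  have -> : (n.+1.*2%:R : R) = 2 * n.+1%:R by rewrite -mul2n natrM.
  by field; rewrite expf_neq0 // andbT addrC natr1 pnatr_eq0.
rewrite exprMn.
apply: (le_trans (ler_wpM2r (sqr_ge0 _) ih)).
rewrite -mulrA ler_wpM2l ?sqr_ge0 //.
have -> : (n.+1.*2%:R : R) = n.*2%:R + 2 by rewrite doubleS -addn2 natrD.
have -> : (n.*2.+1%:R : R) = n.*2%:R + 1 by rewrite -addn1 natrD.
have -> : (n.*2.+3%:R : R) = n.*2%:R + 3 by rewrite -addn3 natrD.
have t0 : 0 <= n.*2%:R :> R by [].
set t := n.*2%:R in t0 *.
have -> : (t + 1)^-1 * ((t + 1) / (t + 2)) ^+ 2 = (t + 1) / (t + 2) ^+ 2.
  by field; apply/andP; split; lra.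
rewrite ler_pdivrMr ?exprn_gt0 //; last by lra.
by rewrite mulrC ler_pdivlMr; [nra | lra].
Qed.

End Fourier.
#[export] Hint Resolve fterm_l2 fproj_l2 fproj'_l2 : core.

(** * Density of trigonometric polynomials and L^2 convergence of Fourier sums *)

Section Density.
Context {R : realType}.
Implicit Types (f g h : R -> R) (c : R) (N : nat).

Lemma cont_unif_cell h (eps : R) : continuous h -> 0 < eps ->
  exists2 d : R, 0 < d & forall x y, period_cell x -> `|x - y| < d -> `|h x - h y| < eps.
Proof.
move=> ch e0.
have := @compact_near_coveringP R (@period_cell R).
move=> [/(_ (@segment_compact _ 0 (pi *+ 2))) nc _].
have := nc R (0 : R)^'+ (fun d x => forall y, `|x - y| < d -> `|h x - h y| < eps) _.
have hyp x : period_cell x -> \forall x' \near x & d \near (0 : R)^'+,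
    (forall y, `|x' - y| < d -> `|h x' - h y| < eps).
  move=> Dx; have e2 : 0 < eps / 2 by rewrite divr_gt0.
  have := ch x; move/cvgrPdist_lt => /(_ _ e2) [r /= r0 hr].
  have r2 : 0 < r / 2 by rewrite divr_gt0.
  exists (ball x (r / 2), [set d | 0 < d < r / 2]).
    split; first exact: nbhsx_ballx.
    exists (r / 2) => //= d /=; rewrite sub0r normrN => hd d0.
    by rewrite d0 (le_lt_trans (ler_norm d)).
  move=> [x' d] /= [hx' /andP[d0 hd]] y hy.
  have hx'0 : `|x - x'| < r / 2 by exact: hx'.
  have h1 : `|h x - h x'| < eps / 2.
    by apply: hr => /=; lra.
  have h2 : `|h x - h y| < eps / 2.
    by apply: hr => /=; have := ler_distD x' x y; lra.
  by have := ler_distD (h x) (h x') (h y); rewrite (distrC (h x') (h x)); lra.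
move=> /(_ _ hyp) [r /= r0 hr]; exists (r / 2); first by rewrite divr_gt0.
move=> x y Dx; apply: (hr (r / 2)) => //=; last by rewrite divr_gt0.
by rewrite sub0r normrN gtr0_norm; lra.
Qed.

Lemma cos_gap (d z : R) : 0 < d < pi -> d <= z <= pi *+ 2 - d -> cos z <= cos d.
Proof.
move=> /andP[d0 dpi] /andP[dz zd]; have := pi_gt0 R => p0.
have key w : d <= w <= pi -> cos w <= cos d.
  move=> /andP[]; rewrite le_eqVlt => /predU1P[-> // | dw] wp.
  have id : d \in `[0, pi] by rewrite in_itv /= !ltW.
  have iw : w \in `[0, pi] by rewrite in_itv /= wp (le_trans (ltW d0)) // ltW.
  by rewrite ltW // (ltr_cos id iw).
have [zpi|zpi] := leP z pi; first by apply: key; rewrite dz.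
have -> : cos z = cos (pi *+ 2 - z) by rewrite -[RHS]cosN opprB -[RHS]cosD2pi subrK.
by apply: key; rewrite mulr2n in zd *; apply/andP; split; lra.
Qed.

(** Near the diagonal uniform continuity is enough; near opposite ends of the cell [h 0 = h (2 pi)]
    links the two values; everywhere else 1 - cos(x - y) is bounded below. *)
Lemma korovkin_bound h (eps : R) : continuous h -> h 0 = h (pi *+ 2) -> 0 < eps ->
  exists2 C : R, 0 <= C &
    forall x y, period_cell x -> period_cell y -> `|h x - h y| <= eps + C * (1 - cos (x - y)).
Proof.
move=> ch h0 e0; have e2 : 0 < eps / 2 by rewrite divr_gt0.
have [d0 d00 hd0] := cont_unif_cell ch e2.
have [M M0 hM] := cont_bounded_cell ch.
have p0 := pi_gt0 R.
pose d := Num.min d0 (pi / 2).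
have dd0 : 0 < d by rewrite lt_min d00 divr_gt0.
have dle : d <= d0 by rewrite ge_min lexx.
have dpi : d < pi by rewrite (le_lt_trans (_ : d <= pi / 2)) ?ge_min ?lexx ?orbT //; lra.
have cd1 : cos d < 1.
  have i0 : 0 \in `[0, pi :> R] by rewrite in_itv /= lexx ltW.
  have id : d \in `[0, pi] by rewrite in_itv /= !ltW.
  by rewrite -[X in _ < X]cos0 (ltr_cos i0 id).
(* Chosen so that C (1 - cos(x - y)) is at least 2 M, the largest possible oscillation, as soon as x
   - y stays at distance d from 0 and from the full period. *)
pose C := 2 * M / (1 - cos d).
have C0 : 0 <= C by rewrite divr_ge0 ?mulr_ge0 //; lra.
exists C => //.
have cos1 z : 0 <= C * (1 - cos z) by rewrite mulr_ge0 //; have := cos_le1 z; lra.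
suff H x y : period_cell x -> period_cell y -> x <= y -> `|h x - h y| <= eps + C * (1 - cos (x - y)).
  move=> x y Dx Dy; have [xy|/ltW yx] := leP x y; first exact: H.
  by rewrite distrC -cosN opprB; exact: H.
move=> Dx Dy xy.
have := Dx; have := Dy; rewrite /period_cell /= !in_itv /= => /andP[y0 y1] /andP[x0 x1].
have D0 := @cell0 R.
have D1 : @period_cell R (pi *+ 2) by rewrite /period_cell /= in_itv /= lexx ltW ?twopi_gt0.
have [near1|far1] := ltP (y - x) d.
  have : `|h x - h y| < eps / 2 by apply: hd0 => //; rewrite distrC ger0_norm; lra.
  by have := cos1 (x - y); lra.
(* In the second case, treated first, x is near 0 and y is near 2 pi. *)
have [far2|near2] := leP (y - x) (pi *+ 2 - d); last first.
  have a1 : `|h 0 - h x| < eps / 2 by apply: hd0 => //; rewrite distrC ger0_norm; lra.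
  have a2 : `|h (pi *+ 2) - h y| < eps / 2 by apply: hd0 => //; rewrite ger0_norm; lra.
  have := ler_distD (h 0) (h x) (h y); rewrite {2}h0 (distrC (h x) (h 0)).
  by have := cos1 (x - y); lra.
have hc : cos (x - y) <= cos d by rewrite -cosN opprB; apply: cos_gap; apply/andP.
have : 2 * M <= C * (1 - cos (x - y)).
  rewrite /C mulrAC ler_pdivlMr; last by lra.
  by apply: ler_wpM2l; [rewrite mulr_ge0 | lra].
have := hM x Dx; have := hM y Dy; have := ler_normB (h x) (h y); lra.
Qed.

(** [q x - h x] is the kernel average of [h y - h x]. Averaging [korovkin_bound] with tolerance
    eps/2 leaves eps/2 + C / (n + 1), by [tint_jker_var]. *)
Lemma jackson h (eps : R) : continuous h -> h 0 = h (pi *+ 2) -> 0 < eps ->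
  exists2 q, trigp q & forall x, period_cell x -> `|q x - h x| <= eps.
Proof.
move=> ch h0 e0; have e2 : 0 < eps / 2 by rewrite divr_gt0.
have [C C0 hC] := korovkin_bound ch h0 e2.
pose n := Num.bound (2 * C / eps).
have hn : 2 * C / eps < n%:R.
  by have := archi_boundP (divr_ge0 (mulr_ge0 (ler0n R 2) C0) (ltW e0)).
have hl := cont_l2 ch.
have [tq _] := sepk_int (sepk_jker n) hl.
exists ((jmass n)^-1 \*o (fun x => ip h (jker n x))); first exact: trigpZ.
move=> x Dx /=.
have j0 := @jmass_gt0 R n.
have hj := pC_l2 (jker_pC n x).
have i1 := l2M_intg hl hj.
have i2 := pC_intg (jker_pC n x).
have i3 : intg ((fun y => 1 - cos (x - y)) \* jker n x).
  exact: pC_intg (pCM (pCB (pC_cst 1) (pC1_pC (cosB_pC1 x))) (jker_pC n x)).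
have -> : (jmass n)^-1 * ip h (jker n x) - h x =
    (jmass n)^-1 * torus_int ((h \* jker n x) \- (h x \*o jker n x)).
  rewrite (tintB i1 (intgZ _ i2)) (tintZ _ i2) tint_jker.
  by rewrite -[torus_int (h \* jker n x)]/(ip h (jker n x)) mulrBr mulrCA mulVf ?mulr1 ?gt_eqF.
rewrite normrM gtr0_norm ?invr_gt0 // mulrC ler_pdivrMr //.
apply: (le_trans (tint_norm_le (intgB i1 (intgZ _ i2)))).
have -> : eps * jmass n = eps / 2 * jmass n + eps / 2 * jmass n by rewrite -mulrDl -splitr.
have hle : torus_int (fun y => `|((h \* jker n x) \- (h x \*o jker n x)) y|) <=
  torus_int ((eps / 2 \*o jker n x) \+ (C \*o ((fun y => 1 - cos (x - y)) \* jker n x))).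
  apply: tint_le.
  - exact: (integrable_norm (intgB i1 (intgZ _ i2))).
  - exact: intgD (intgZ _ i2) (intgZ _ i3).
  - move=> y Dy /=; rewrite -mulrBl normrM (ger0_norm (jker_ge0 _ _ _)) mulrA -mulrDl.
    by apply: ler_wpM2r; [exact: jker_ge0 | rewrite distrC; exact: hC].
apply: (le_trans hle); rewrite (tintD (intgZ _ i2) (intgZ _ i3)) (tintZ _ i2) (tintZ _ i3) tint_jker.
rewrite tint_jker_var lerD2l mulrCA mulrC ler_wpM2r ?(ltW j0) //.
rewrite ler_pdivrMr ?ltr0Sn // -[n.+1%:R]natr1.
have := hn; rewrite ltr_pdivrMr // => hn'; nra.
Qed.

Lemma l2_closure f : l2 f ->
  (forall eps : R, 0 < eps -> exists2 g, l2 g /\ n2 (f \- g) <= eps &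
     forall e : R, 0 < e -> exists2 q, trigp q & n2 (g \- q) <= e) ->
  forall e : R, 0 < e -> exists2 q, trigp q & n2 (f \- q) <= e.
Proof.
move=> hf H e e0; have e2 : 0 < e / 2 by rewrite divr_gt0.
have [g [hg fg] /(_ _ e2)[q tq gq]] := H _ e2.
exists q => //; apply: (le_trans (n2_tri hf hg (trigp_l2 tq))).
by rewrite [leRHS]splitr lerD.
Qed.

Lemma dense_cont0 h : continuous h -> h 0 = h (pi *+ 2) ->
  forall e : R, 0 < e -> exists2 q, trigp q & n2 (h \- q) <= e.
Proof.
move=> ch h0 e e0.
have s0 : 0 < Num.sqrt (pi *+ 2) :> R by rewrite sqrtr_gt0 twopi_gt0.
have e1 : 0 < e / Num.sqrt (pi *+ 2) by rewrite divr_gt0.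
have [q tq hq] := jackson ch h0 e1; exists q => //.
have -> : e = e / Num.sqrt (pi *+ 2) * Num.sqrt (pi *+ 2) by rewrite divfK // gt_eqF.
apply: n2_le_bound; last by move=> x Dx; rewrite distrC; exact: hq.
- by apply: measurable_funB; [exact: cont_measurable | exact: l2_measurable (trigp_l2 tq)].
- exact: ltW.
Qed.

(** A bump of height 1 at the ends of the cell whose L^2 norm tends to 0. Subtracting [h \* bumpk n]
    from [h] removes the condition that [h] agrees at both ends. *)
Definition bumpk (n : nat) : R -> R := (2 ^+ n)^-1 \*o jker n 0.

Lemma bumpk_pC n : pC (bumpk n). Proof. exact: pCZ (jker_pC _ _). Qed.

Lemma bumpk0 n : bumpk n 0 = 1.
Proof. by rewrite /bumpk /jker /= subrr cos0 -[1 + 1]/(2 : R) mulVf // expf_neq0 // pnatr_eq0. Qed.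

Lemma n2_bumpk n : n2 (bumpk n) ^+ 4 <= (pi *+ 2) ^+ 2 / n.+1%:R.
Proof.
have -> : n2 (bumpk n) ^+ 4 = (n2 (bumpk n) ^+ 2) ^+ 2 by rewrite -exprM.
(* The square of a power of 1 + cos is again such a power, so the norm is an explicit mass; that
   mass is bounded through its square, hence the fourth power. *)
have -> : n2 (bumpk n) ^+ 2 = jmass (n + n) / 2 ^+ (n + n).
  rewrite n2_sqr mulrC -(tint_jker (n + n) 0) -tintZ; last exact: pC_intg (jker_pC _ _).
  rewrite /ip; congr torus_int; apply/funext => x.
  by rewrite /bumpk /jker /= !exprD; field; rewrite expf_neq0.
apply: (le_trans (jmass_sqr (n + n))).
rewrite ler_wpM2l ?sqr_ge0 // lef_pV2 ?posrE // ler_nat ltnS -addnn; lia.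
Qed.

Lemma bumpk_small (e : R) : 0 < e -> exists n, n2 (bumpk n) <= e.
Proof.
move=> e0; pose n := Num.bound ((pi *+ 2) ^+ 2 / e ^+ 4); exists n.
have hn : (pi *+ 2) ^+ 2 / e ^+ 4 < n%:R.
  by have := archi_boundP (divr_ge0 (sqr_ge0 (pi *+ 2 : R)) (exprn_ge0 4 (ltW e0))).
rewrite -(ler_pXn2r (ltn0Sn 3)) ?nnegrE ?n2_ge0 ?(ltW e0) //.
apply: (le_trans (n2_bumpk n)); rewrite ler_pdivrMr // -[n.+1%:R]natr1.
move: hn; rewrite ltr_pdivrMr ?exprn_gt0 // => hn.
by have := exprn_gt0 4 e0; lra.
Qed.

Lemma dense_cont_bounded h (M : R) : continuous h -> (forall x, `|h x| <= M) ->
  forall e : R, 0 < e -> exists2 q, trigp q & n2 (h \- q) <= e.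
Proof.
move=> ch hM; have M0 : 0 <= M := le_trans (normr_ge0 _) (hM 0).
apply: l2_closure; first exact: cont_l2.
move=> e e0; have M1 : 0 < M + 1 by lra.
have [n hn] := bumpk_small (divr_gt0 e0 M1).
have bl := pC_l2 (bumpk_pC n).
(* The difference vanishes at 0 and at 2 pi, so [dense_cont0] applies to it. *)
have cg : continuous (h \- (h \* bumpk n)).
  move=> x; apply: cvgB; first exact: ch.
  by apply: cvgM; [exact: ch | exact: (pC_cont (bumpk_pC n))].
exists (h \- (h \* bumpk n)).
  split; first exact: cont_l2.
  have -> : h \- (h \- (h \* bumpk n)) = h \* bumpk n by apply/funext => x /=; ring.
  apply: (le_trans (n2M_bounded (cont_measurable ch) M0 hM bl)).
  move: hn; rewrite ler_pdivlMr // => hn.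
  have := n2_ge0 (bumpk n); nra.
apply: dense_cont0 => //=.
by rewrite -[X in _ = _ - _ * bumpk n X]add0r (pC_per (bumpk_pC n)) bumpk0 !mulr1 !subrr.
Qed.

(** Continuous functions are dense in L^1. Clamping the approximant to the bound of [f] upgrades
    this to L^2, since |f - k|^2 <= 2 M |f - k|. *)
Lemma dense_bounded f (M : R) : measurable_fun setT f -> (forall x, `|f x| <= M) ->
  forall e : R, 0 < e -> exists2 q, trigp q & n2 (f \- q) <= e.
Proof.
move=> mf fM; have M0 : 0 <= M := le_trans (normr_ge0 _) (fM 0).
have hf : l2 f by apply: l2_bounded.
have fint : intg f by apply: intg_bounded.
apply: l2_closure => // e e0.
have [g_ [cg ig hg]] := approximation_continuous_integrable measurable_cell mu_cell_lty fint.
(* An L^1 distance below d gives a squared L^2 distance of at most 2 M d <= e^2; the added 1 covers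
   M = 0. *)
pose d := e ^+ 2 / (2 * M + 1).
have d0 : 0 < d by rewrite divr_gt0 ?exprn_gt0 //; lra.
have [n hn] : exists n, torus_int (fun x => `|f x - g_ n x|) < d.
  move/fine_cvgP : hg => [_ /cvgrPdist_lt /(_ _ d0) [n _ hn]]; exists n.
  have := hn n (leqnn n); rewrite /= sub0r normrN; apply: le_lt_trans; exact: ler_norm.
(* [k] is [g_ n] clamped to [-M, M]. *)
pose k x := 2^-1 * (`|g_ n x + M| - `|g_ n x - M|).
have kM x : `|k x| <= M.
  rewrite /k ler_norml; case: (ger0P (g_ n x + M)); case: (ger0P (g_ n x - M)); lra.
have ck : continuous k.
  move=> x; apply: cvgM; first exact: cvg_cst.
  apply: cvgB; apply: cvg_norm; [apply: cvgD|apply: cvgB]; by [exact: cg | exact: cvg_cst].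
exists k; last exact: dense_cont_bounded ck kM.
split; first exact: cont_l2.
have fk x : `|f x - k x| <= `|f x - g_ n x|.
  have := fM x; rewrite ler_norml => /andP[h1 h2].
  by rewrite /k; case: (ger0P (g_ n x + M)) => ?; case: (ger0P (g_ n x - M)) => ?;
    case: (ger0P (f x - g_ n x)) => ?; rewrite ler_norml; apply/andP; split; lra.
rewrite -(ler_pXn2r (ltn0Sn 1)) ?nnegrE ?n2_ge0 ?(ltW e0) // n2_sqr.
have hk := cont_l2 ck.
have ifg : intg (fun x => `|f x - g_ n x|) by exact: (integrable_norm (intgB fint (ig n))).
apply: (le_trans (_ : _ <= torus_int ((2 * M) \*o (fun x => `|f x - g_ n x|)))).
  apply: tint_le; [exact: l2M_intg (l2B hf hk) (l2B hf hk) | exact: intgZ |].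
  move=> x Dx /=; rewrite -expr2 -sqr_normr expr2.
  have := fk x; have := ler_normB (f x) (k x); have := fM x; have := kM x.
  have := normr_ge0 (f x - k x) => h1 h2 h3 h4 h5.
  apply: ler_pM => //; lra.
rewrite tintZ //; move: hn; rewrite /d ltr_pdivlMr; last by lra.
have := @tint_ge0 R (fun x => `|f x - g_ n x|) (fun x _ => normr_ge0 _); nra.
Qed.

(** Setting f to 0 where |f| > n reduces to bounded functions, by dominated convergence under
    f^2. *)
Theorem trigp_dense f : l2 f -> forall e : R, 0 < e -> exists2 q, trigp q & n2 (f \- q) <= e.
Proof.
move=> hf; have [mf if2] := hf; apply: (l2_closure hf) => e e0.
pose fn n x := if `|f x| <= n%:R then f x else 0.
have mfn n : measurable_fun setT (fn n).
  apply: measurable_fun_ifT => //.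
  by apply: measurable_fun_ler => //; exact: measurableT_comp.
have fnM n x : `|fn n x| <= n%:R by rewrite /fn; case: ifP => //; rewrite normr0.
pose F n x := ((f x - fn n x) ^+ 2)%:E.
have := @dominated_convergence _ _ _ (@lebesgue_measure R) _ measurable_cell F (fun=> 0%E) (fun x => (f x ^+ 2)%:E).
case.
- move=> n; apply/measurable_EFinP; apply: measurable_funTS.
  by apply: measurable_funX; exact: measurable_funB (mfn n).
- exact: measurable_cst.
- apply: aeW => x _; apply: cvg_near_cst.
  exists (Num.bound `|f x|) => // n /= hn; rewrite /F /fn ifT ?subrr ?expr0n //.
  have /ltW h := archi_boundP (normr_ge0 (f x)).
  by rewrite (le_trans h) // ler_nat.
- exact: if2.
- apply: aeW => x n _; rewrite /F /= lee_fin ger0_norm ?sqr_ge0 // /fn.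
  by case: ifP => _; rewrite ?subrr ?subr0 // expr0n sqr_ge0.
move=> _ _; rewrite integral0 => /fine_cvgP[_ /cvgrPdist_le].
move=> /(_ _ (exprn_gt0 2 e0))[n _ hn]; exists (fn n); last exact: dense_bounded (mfn n) (fnM n).
split; first exact: l2_bounded (mfn n) (fun x _ => fnM n x).
rewrite -(ler_pXn2r (ltn0Sn 1)) ?nnegrE ?n2_ge0 ?(ltW e0) // n2_sqr.
have := hn n (leqnn n); rewrite /= sub0r normrN; apply: le_trans; apply: le_trans (ler_norm _).
by rewrite le_eqVlt; apply/orP; left; apply/eqP.
Qed.

(** A trigonometric polynomial within e/2 of f is fixed by [fproj N] for large N, and projections
    contract, so the error is at most e. *)
Theorem fproj_cvg f : l2 f -> n2 (fproj N f \- f) @[N --> \oo] --> (0 : R).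
Proof.
move=> hf; apply/cvgrPdist_le => e e0; have e2 : 0 < e / 2 by rewrite divr_gt0.
have [q tq fq] := trigp_dense hf e2.
have [N0 hN] := fproj_trigp tq; exists N0 => // N /= N0N.
rewrite sub0r normrN ger0_norm ?n2_ge0 //.
have lq := trigp_l2 tq.
apply: (le_trans (n2_tri (fproj_l2 N f) lq hf)).
rewrite -[X in n2 (_ \- X) + _](hN N N0N) -(fprojB N hf lq) (n2BC q).
have := n2_fproj N (l2B hf lq); lra.
Qed.

End Density.

(* Otherwise unification unfolds integrals. *)
Opaque ip n2.

(** * Weak derivatives *)

Section WeakDerivative.
Context {R : realType}.
Implicit Types (f g h : R -> R) (c : R) (N : nat).

(** The span of [cc k] and [ss k] is stable under differentiation, so every iterated derivative
    stays in it. *)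
Lemma trig_smooth k : torus_smooth (@cc R k) /\ torus_smooth (@ss R k).
Proof.
pose T (f : R -> R) := exists a b : R, f = (a \*o cc k) \+ (b \*o ss k).
have Td f : T f -> pC1 f (derive1 f) /\ T (derive1 f).
  move=> [a [b ->]].
  have h := pC1D (pC1Z a (cc_pC1 k)) (pC1Z b (ss_pC1 k)).
  have e : derive1 ((a \*o cc k) \+ (b \*o ss k)) = a \*o (- k%:R \*o ss k) \+ b \*o (k%:R \*o cc k).
    by apply/funext => x; rewrite derive1E; have hx := pC1_der h x; rewrite derive_val.
  rewrite e; split => //; exists (b * k%:R), (- (a * k%:R)).
  by apply/funext => x /=; ring.
have Tn n f : T f -> T (derive1n n f).
  elim: n f => [|n ih] f Tf //.
  by rewrite derive1nS; exact: (Td _ (ih _ Tf)).2.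
have Ts f : T f -> torus_smooth f.
  move=> Tf; split; first exact: (pC1_per (Td _ Tf).1).
  by move=> n x; case: (pC1_der (Td _ (Tn n _ Tf)).1 x).
split; apply: Ts.
- by exists 1, 0; apply/funext => x /=; ring.
- by exists 0, 1; apply/funext => x /=; ring.
Qed.

Lemma smooth_pC1 f : torus_smooth f -> pC1 f (derive1 f).
Proof.
move=> [pf df].
have d1 x : is_derive x (1 : R) f (derive1 f x).
  by apply: DeriveDef; [exact: (df 0%N x) | rewrite derive1E].
split => // x; apply: differentiable_continuous; apply/derivable1_diffP.
exact: (df 1%N x).
Qed.

Lemma smooth_derive f : torus_smooth f -> torus_smooth (derive1 f).
Proof.
move=> sf; split; first exact: (pC_per (pC1_pC' (smooth_pC1 sf))).
by move=> n x; have := sf.2 n.+1 x; rewrite derive1Sn.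
Qed.

(* Testing against the trigonometric system is enough for a weak derivative. *)
Record wdF f f' : Prop := WdF {
  wdF_l2 : l2 f;
  wdF_l2' : l2 f';
  wdF_cc : forall k, ip f' (cc k) = k%:R * ip f (ss k);
  wdF_ss : forall k, ip f' (ss k) = - (k%:R * ip f (cc k)) }.

Lemma wdF_smooth f f' : l2 f -> l2 f' ->
  (forall phi, torus_smooth phi -> ip f (derive1 phi) = - ip f' phi) -> wdF f f'.
Proof.
move=> hf hf' H; split => // k.
- have := H _ (trig_smooth k).1.
  have -> : derive1 (@cc R k) = - k%:R \*o ss k.
    by apply/funext => x; rewrite derive1E; have hx := pC1_der (cc_pC1 k) x; rewrite derive_val.
  by rewrite ipZr // mulNr => /eqP; rewrite eqr_opp => /eqP <-.
- have := H _ (trig_smooth k).2.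
  have -> : derive1 (@ss R k) = k%:R \*o cc k.
    by apply/funext => x; rewrite derive1E; have hx := pC1_der (ss_pC1 k) x; rewrite derive_val.
  by rewrite ipZr // => ->; rewrite opprK.
Qed.

Lemma pC1_wdF f f' : pC1 f f' -> wdF f f'.
Proof.
move=> hf; apply: wdF_smooth; first exact: pC_l2 (pC1_pC hf).
  exact: pC_l2 (pC1_pC' hf).
by move=> phi sp; apply: ip_ibp => //; exact: smooth_pC1.
Qed.

Lemma wdFB f f' g g' : wdF f f' -> wdF g g' -> wdF (f \- g) (f' \- g').
Proof.
move=> [f1 f2 f3 f4] [g1 g2 g3 g4]; split; try exact: l2B.
- by move=> k; rewrite !ipBl // f3 g3; ring.
- by move=> k; rewrite !ipBl // f4 g4; ring.
Qed.

Lemma wdF_fproj N f f' : wdF f f' -> fproj' N f = fproj N f'.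
Proof.
move=> [f1 f2 f3 f4]; apply/funext => x; apply: eq_bigr => k _.
by rewrite /fterm' /fterm f3 f4; ring.
Qed.

Lemma fproj_wdF_pC1 N f f' : wdF f f' -> pC1 (fproj N f) (fproj N f').
Proof. by move=> /(wdF_fproj N) <-; exact: fproj_pC1. Qed.

Lemma cvg0_le_eq0 (x : R) (y : nat -> R) : 0 <= x -> (forall n, x <= y n) -> y n @[n --> \oo] --> (0 : R) -> x = 0.
Proof.
move=> x0 xy y0; apply/eqP; rewrite eq_le x0 andbT.
by apply: (cvgr_to_ge y0); apply: nearW.
Qed.

Lemma fproj_eq0 f : l2 f -> (forall k, ip f (cc k) = 0) -> (forall k, ip f (ss k) = 0) -> n2 f = 0.
Proof.
move=> hf hc hs; apply: (cvg0_le_eq0 (n2_ge0 f) _ (fproj_cvg hf)) => N.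
have -> : fproj N f = fun=> 0.
  by apply/funext => x; rewrite /fproj big1 // => k _; rewrite /fterm hc hs; ring.
rewrite -n2N le_eqVlt; apply/orP; left; apply/eqP; congr n2.
by apply/funext => x /=; rewrite sub0r.
Qed.

Lemma wdF_unique f g' h' : wdF f g' -> wdF f h' -> n2 (g' \- h') = 0.
Proof.
move=> [f1 f2 f3 f4] [_ h2 h3 h4]; apply: fproj_eq0; first exact: l2B.
- by move=> k; rewrite ipBl // f3 h3 subrr.
- by move=> k; rewrite ipBl // f4 h4 subrr.
Qed.

Lemma wdF_ae f f' g g' : wdF f f' -> l2 g -> l2 g' -> n2 (f \- g) = 0 -> n2 (f' \- g') = 0 -> wdF g g'.
Proof.
move=> [f1 f2 f3 f4] hg hg' e e'.
have E h : l2 h -> ip f h = ip g h.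
  by move=> hh; apply/eqP; rewrite -subr_eq0 -ipBl //; apply/eqP/n2_eq0_ip => //; exact: l2B.
have E' h : l2 h -> ip f' h = ip g' h.
  by move=> hh; apply/eqP; rewrite -subr_eq0 -ipBl //; apply/eqP/n2_eq0_ip => //; exact: l2B.
by split => // k; rewrite -E' // -E.
Qed.

Lemma pC1_osc f f' : pC1 f f' -> forall x y, period_cell x -> period_cell y ->
  `|f x - f y| <= torus_int (fun z => `|f' z|).
Proof.
move=> [pf df cf].
suff H x y : period_cell x -> period_cell y -> y < x -> `|f x - f y| <= torus_int (fun z => `|f' z|).
  move=> x y Dx Dy; have [xy|yx|->] := ltgtP x y; last 2 first.
  - exact: H.
  - by rewrite subrr normr0; exact: tint_ge0.
  - by rewrite distrC; exact: H.
move=> Dx Dy yx.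
have cF := derive_continuous df.
have h1 : derivable_oo_LRcontinuous f y x.
  split.
  - by move=> z _; case: (df z).
  - by apply: cvg_at_right_filter; exact: cF.
  - by apply: cvg_at_left_filter; exact: cF.
have h2 : {in `]y, x[, (f^`())%classic =1 f'}.
  by move=> z _; rewrite derive1E; have hz := df z; rewrite derive_val.
have h3 : {within `[y, x], continuous f'} by exact: continuous_subspaceT.
have mE : measurable (`[y, x]%classic : set (measurableTypeR R)) by exact: measurable_itv.
have sE : `[y, x] `<=` @period_cell R.
  move=> z; move: Dx Dy; rewrite /period_cell /= !in_itv /= => /andP[_ x1] /andP[y0 _] /andP[yz zx].
  by rewrite (le_trans y0) //= (le_trans zx).
have ii := cont_intg cf.
have iE := integrableS measurable_cell mE sE ii.
have -> : f x - f y = (\int[@lebesgue_measure R]_(z in `[y, x]) f' z)%R.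
  by rewrite /Rintegral (continuous_FTC2 yx h3 h1 h2).
apply: (le_trans (le_normr_Rintegral mE iE)).
rewrite /torus_int /Rintegral; apply: fine_le.
- exact: (integrable_fin_num mE (integrable_norm iE)).
- exact: (integrable_fin_num measurable_cell (integrable_norm ii)).
- apply: ge0_subset_integral => //.
  by have /integrableP[] := integrable_norm ii.
Qed.

Lemma n2_cst1 : n2 (fun=> 1 : R) = Num.sqrt (pi *+ 2).
Proof.
rewrite n2E ipE; congr Num.sqrt; rewrite -[RHS]mul1r -tint_cst; congr torus_int.
by apply/funext => x; rewrite mulr1.
Qed.

Lemma tint_abs_n2 f : l2 f -> torus_int (fun z => `|f z|) <= Num.sqrt (pi *+ 2) * n2 f.
Proof.
move=> hf; have [mf if2] := hf.
have hn : l2 (fun z => `|f z|).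
  split; first exact: measurableT_comp.
  by have -> : (fun x => `|f x| ^+ 2) = (fun x => f x ^+ 2) by apply/funext => x; rewrite sqr_normr.
have -> : n2 f = n2 (fun z => `|f z|).
  rewrite !n2E !ipE; congr (Num.sqrt (torus_int _)); apply/funext => x.
  by rewrite -!expr2 sqr_normr.
rewrite -n2_cst1; apply: le_trans (cauchy_schwarz (l2_cst 1) hn).
apply: le_trans (ler_norm _).
rewrite le_eqVlt; apply/orP; left; apply/eqP; rewrite ipE; congr torus_int.
by apply/funext => x; rewrite mul1r.
Qed.

(** Constant of the embedding of H^1 into bounded functions: by Cauchy-Schwarz the mean of |f| costs
    sqrt(2 pi) / (2 pi) times the norm of f, and the oscillation costs sqrt(2 pi) times the norm of
    f'. *)
Definition Csup : R := Num.sqrt (pi *+ 2) * (1 + (pi *+ 2)^-1).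

Lemma Csup_ge0 : 0 <= Csup.
Proof. by rewrite mulr_ge0 ?sqrtr_ge0 // addr_ge0 // invr_ge0 ltW // twopi_gt0. Qed.

Lemma pC1_sup f f' : pC1 f f' -> forall x, `|f x| <= Csup * (n2 f + n2 f').
Proof.
move=> hf x; have [y Dy ->] := period_reduce x; last exact: pC1_per hf.
have lf := pC_l2 (pC1_pC hf); have lf' := pC_l2 (pC1_pC' hf).
have T0 := @twopi_gt0 R.
have s0 := sqrtr_ge0 (pi *+ 2 : R).
have K1 := tint_abs_n2 lf'; have K2 := tint_abs_n2 lf.
set K := torus_int _ in K1.
(* Average over z in the cell the bound |f y| <= |f z| + K, where K controls the oscillation. *)
have h1 : torus_int (fun=> `|f y|) <= torus_int ((fun z => `|f z|) \+ (fun=> K)).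
  have i1 : intg (fun z => `|f z|) by exact: integrable_norm (pC_intg (pC1_pC hf)).
  apply: tint_le; [exact: intg_cst | exact: intgD i1 (intg_cst _) |].
  move=> z Dz /=; have := pC1_osc hf Dy Dz; have := ler_distD 0 (f y) 0.
  have := ler_normD (f y - f z) (f z); rewrite subrK -/K; lra.
rewrite tintD ?tint_cst in h1; last 2 first.
- exact: integrable_norm (pC_intg (pC1_pC hf)).
- exact: intg_cst.
have h2 : `|f y| <= torus_int (fun z => `|f z|) / (pi *+ 2) + K.
  by rewrite -(ler_pM2r T0) mulrDl divfK ?gt_eqF.
apply: (le_trans h2); rewrite /Csup.
have i0 : 0 <= (pi *+ 2 : R)^-1 by rewrite invr_ge0 ltW.
have h3 : torus_int (fun z => `|f z|) / (pi *+ 2) <= Num.sqrt (pi *+ 2) * n2 f / (pi *+ 2).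
  by rewrite ler_wpM2r.
apply: (le_trans (lerD h3 K1)).
have n0 := n2_ge0 f; have n0' := n2_ge0 f'.
set s := Num.sqrt _ in s0 *; set i := (pi *+ 2)^-1 in i0 *.
have -> : s * (1 + i) * (n2 f + n2 f') = s * n2 f * i + s * n2 f' + (s * n2 f + s * i * n2 f') by ring.
by rewrite lerDl addr_ge0 // !mulr_ge0.
Qed.

Definition fprojerr f N := n2 (fproj N f \- f).

(** By [pC1_sup] the Fourier sums are uniformly Cauchy, and their limit is the continuous
    representative. The rate is recorded because later limits are taken jointly in N and time. *)
Lemma wdF_rep f f' : wdF f f' -> exists w, [/\ pC w, n2 (w \- f) = 0,
  (forall N x, `|fproj N f x - w x| <= Csup * (fprojerr f N + fprojerr f' N)) &
  forall x, `|w x| <= Csup * (n2 f + n2 f')].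
Proof.
move=> hw; have [hf hf' _ _] := hw.
pose e N := fprojerr f N + fprojerr f' N.
have e0 : e N @[N --> \oo] --> (0 : R).
  by rewrite -[0]addr0; apply: cvgD; exact: fproj_cvg.
have osc M N x : `|fproj N f x - fproj M f x| <= Csup * (e N + e M).
  have h := pC1_sup (pC1B (fproj_wdF_pC1 N hw) (fproj_wdF_pC1 M hw)) x.
  apply: (le_trans h); apply: ler_wpM2l; first exact: Csup_ge0.
  have h1 := n2_tri (fproj_l2 N f) hf (fproj_l2 M f).
  have h2 := n2_tri (fproj_l2 N f') hf' (fproj_l2 M f').
  apply: (le_trans (lerD h1 h2)).
  by rewrite (n2BC f) (n2BC f') addrACA lexx.
have cv x : cvg (fproj N f x @[N --> \oo]).
  apply/cauchy_cvgP/cauchy_ballP => eps eps0.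
  have e1 : 0 < eps / (2 * (Csup + 1)) by rewrite divr_gt0 // mulr_gt0 //; have := Csup_ge0; lra.
  move/cvgrPdist_lt : e0 => /(_ _ e1) [n _ hn].
  exists ([set y | exists2 N, (n <= N)%N & y = fproj N f x], [set y | exists2 N, (n <= N)%N & y = fproj N f x]).
    by split; exists n => // N /= nN; exists N.
  move=> [y z] /= [[N nN ->] [M nM ->]]; rewrite /ball /=.
  apply: (le_lt_trans (osc M N x)).
  have := hn N nN; have := hn M nM; rewrite /= !sub0r !normrN.
  have eN i : 0 <= e i by rewrite addr_ge0 // n2_ge0.
  rewrite !ger0_norm // => hM hN.
  have C1 : 0 < Csup + 1 by have := Csup_ge0; lra.
  have : (Csup + 1) * (e N + e M) < eps.
    rewrite mulrC -ltr_pdivlMr //.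
    have -> : eps / (Csup + 1) = eps / (2 * (Csup + 1)) + eps / (2 * (Csup + 1)).
      by field; rewrite gt_eqF.
    exact: ltrD.
  by have := eN N; have := eN M; lra.
pose w x := limn (fun N => fproj N f x).
have wP x : fproj N f x @[N --> \oo] --> w x by exact: cv.
have err N x : `|fproj N f x - w x| <= Csup * e N.
  have c1 : `|fproj N f x - fproj M f x| @[M --> \oo] --> `|fproj N f x - w x|.
    by apply: cvg_norm; apply: cvgB; [exact: cvg_cst | exact: wP].
  have c2 : Csup * (e N + e M) @[M --> \oo] --> Csup * (e N + 0).
    by apply: cvgM; [exact: cvg_cst | apply: cvgD; [exact: cvg_cst | exact: e0]].
  by rewrite -[e N in leRHS]addr0; apply: ler_cvg_to c1 c2 _; apply: nearW => M; exact: osc.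
have Ce0 : Csup * e N @[N --> \oo] --> (0 : R).
  by rewrite -[0 in X in _ --> X](mulr0 Csup); apply: cvgM; [exact: cvg_cst | exact: e0].
have pw : pC w.
  split.
    by move=> x; rewrite /w; congr (limn _); apply/funext => N; rewrite (pC_per (fproj_pC N f)).
  move=> x; apply/cvgrPdist_lt => eps eps0.
  have e3 : 0 < eps / 3 by rewrite divr_gt0.
  move/cvgrPdist_lt : Ce0 => /(_ _ e3) [N _ /(_ N (leqnn N))]; rewrite /= sub0r normrN => hN.
  have hN' : Csup * e N < eps / 3 by exact: le_lt_trans (ler_norm _) hN.
  have cN : continuous (fproj N f) := pC_cont (fproj_pC N f).
  have := cN x; move/cvgrPdist_lt => /(_ _ e3) h.
  near=> y.
  have h1 : `|fproj N f x - fproj N f y| < eps / 3 by near: y.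
  have := err N x; have := err N y; have := ler_distD (fproj N f x) (w x) (w y).
  have := ler_distD (fproj N f y) (fproj N f x) (w y).
  by rewrite (distrC (w x) (fproj N f x)); lra.
have lw := pC_l2 pw.
exists w; split => //.
- have c : Num.sqrt (pi *+ 2) * (Csup * e N) + fprojerr f N @[N --> \oo] --> (0 : R).
    rewrite -[0]addr0; apply: cvgD; last exact: fproj_cvg.
    by rewrite -[0 in X in _ --> X](mulr0 (Num.sqrt (pi *+ 2))); apply: cvgM; [exact: cvg_cst | exact: Ce0].
  apply: (cvg0_le_eq0 (n2_ge0 _) _ c) => N.
  apply: (le_trans (n2_tri lw (fproj_l2 N f) hf)); rewrite lerD2r mulrC.
  apply: n2_le_bound.
  + by apply: measurable_funB; apply: cont_measurable; [exact: pC_cont pw | exact: pC_cont (fproj_pC N f)].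
  + by rewrite mulr_ge0 ?Csup_ge0 // addr_ge0 // n2_ge0.
  + by move=> x _; rewrite distrC; exact: err.
- move=> x; have c1 : `|fproj M f x| @[M --> \oo] --> `|w x| by apply: cvg_norm; exact: wP.
  apply: (cvgr_to_le c1); apply: nearW => N.
  apply: (le_trans (pC1_sup (fproj_wdF_pC1 N hw) x)); rewrite ler_wpM2l ?Csup_ge0 //.
  by apply: lerD; exact: n2_fproj.
Unshelve. all: by end_near.
Qed.

End WeakDerivative.

(** * Uniform and L^2 convergence along a filter *)

Section Convergence.
Context {R : realType} {I : Type} {F : set_system I} {FF : Filter F}.
Implicit Types (f g h : R -> R) (v u : I -> R -> R).

(** An arbitrary filter, because the same continuity facts serve for N to infinity, for time s
    tending to t, and for both at once. *)
Record ucv v f : Prop := UCv {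
  ucv_pC : forall i, pC (v i);
  ucv_lim : pC f;
  ucv_cvg : forall e : R, 0 < e -> \forall i \near F, forall x, `|v i x - f x| <= e }.

Record lcv v f : Prop := LCv {
  lcv_l2 : forall i, l2 (v i);
  lcv_lim : l2 f;
  lcv_cvg : n2 (v i \- f) @[i --> F] --> (0 : R) }.

Lemma cvg0_le (a b : I -> R) : (forall i, 0 <= a i) -> (\forall i \near F, a i <= b i) ->
  b i @[i --> F] --> (0 : R) -> a i @[i --> F] --> (0 : R).
Proof.
move=> a0 ab b0; apply: (squeeze_cvgr _ (cvg_cst 0) b0).
by apply: filterS ab => i abi; rewrite a0.
Qed.

Lemma ucv_cst f : pC f -> ucv (fun=> f) f.
Proof. by move=> hf; split => // e e0; near=> i => x; rewrite subrr normr0 ltW. Unshelve. all: by end_near. Qed.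

Lemma lcv_cst f : l2 f -> lcv (fun=> f) f.
Proof.
move=> hf; split => //.
have -> : n2 (f \- f) = 0; last exact: cvg_cst.
by rewrite n2E (_ : f \- f = fun=> 0) ?ip0l ?sqrtr0 //; apply/funext => x /=; rewrite subrr.
Qed.

Lemma ucvD v f u g : ucv v f -> ucv u g -> ucv (fun i => v i \+ u i) (f \+ g).
Proof.
move=> [v1 v2 v3] [u1 u2 u3]; split; [by move=> i; exact: pCD | exact: pCD |].
move=> e e0; have e2 : 0 < e / 2 by rewrite divr_gt0.
apply: filterS2 (v3 _ e2) (u3 _ e2) => i hv hu x /=.
rewrite opprD addrACA [leRHS]splitr (le_trans (ler_normD _ _)) //.
by apply: lerD; [exact: hv | exact: hu].
Qed.

Lemma ucvM v f u g : ucv v f -> ucv u g -> ucv (fun i => v i \* u i) (f \* g).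
Proof.
move=> [v1 v2 v3] [u1 u2 u3]; split; [by move=> i; exact: pCM | exact: pCM |].
move=> e e0; have [M M0 hM] := pC_bounded v2; have [L L0 hL] := pC_bounded u2.
pose d := Num.min 1 (e / (M + L + 1)).
have d0 : 0 < d by rewrite lt_min ltr01 divr_gt0 //; lra.
have d1 : d <= 1 by rewrite ge_min lexx.
have de : d * (M + L + 1) <= e.
  by rewrite -ler_pdivlMr ?ge_min ?lexx ?orbT //; lra.
apply: filterS2 (v3 _ d0) (u3 _ d0) => i hv hu x /=.
have -> : v i x * u i x - f x * g x = (v i x - f x) * (u i x - g x) + ((v i x - f x) * g x + f x * (u i x - g x)) by ring.
apply: (le_trans (ler_normD _ _)); apply: (le_trans (lerD (lexx _) (ler_normD _ _))); rewrite !normrM.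
have := hv x; have := hu x; have := hM x; have := hL x.
have := normr_ge0 (v i x - f x); have := normr_ge0 (u i x - g x).
move: `|v i x - f x| `|u i x - g x| `|f x| `|g x| (normr_ge0 (f x)) (normr_ge0 (g x)).
move=> A B P Q P0 Q0 B0 A0 QL PM Bd Ad.
have h1 : A * B <= d * 1 by apply: ler_pM => //; lra.
have h2 : A * Q <= d * L by apply: ler_pM.
have h3 : P * B <= M * d by apply: ler_pM.
have : d * 1 + d * L + M * d <= e by rewrite (le_trans _ de) //; lra.
lra.
Qed.

Lemma ucvZ c v f : ucv v f -> ucv (fun i => c \*o v i) (c \*o f).
Proof. exact: ucvM (ucv_cst (pC_cst c)). Qed.

Lemma ucvX n v f : ucv v f -> ucv (fun i x => v i x ^+ n) (fun x => f x ^+ n).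
Proof.
move=> h; elim: n => [|n ih]; first exact: (ucv_cst (pC_cst 1)).
have -> : (fun i x => v i x ^+ n.+1) = (fun i => v i \* (fun x => v i x ^+ n)).
  by apply/funext => i; apply/funext => x /=; rewrite exprS.
have -> : (fun x => f x ^+ n.+1) = f \* (fun x => f x ^+ n).
  by apply/funext => x /=; rewrite exprS.
exact: ucvM.
Qed.

Lemma ucv_lcv v f : ucv v f -> lcv v f.
Proof.
move=> [v1 v2 v3]; split; [by move=> i; exact: pC_l2 | exact: pC_l2 |].
apply/cvgrPdist_le => e e0.
have s0 : 0 < Num.sqrt (pi *+ 2) :> R by rewrite sqrtr_gt0 twopi_gt0.
have e1 : 0 < e / Num.sqrt (pi *+ 2) by rewrite divr_gt0.
apply: filterS (v3 _ e1) => i hi; rewrite sub0r normrN ger0_norm ?n2_ge0 //.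
have -> : e = e / Num.sqrt (pi *+ 2) * Num.sqrt (pi *+ 2) by rewrite divfK // gt_eqF.
apply: n2_le_bound; [|exact: ltW|by move=> x _; exact: hi].
by apply: cont_measurable; exact: pC_cont (pCB (v1 i) v2).
Qed.

Lemma lcvD v f u g : lcv v f -> lcv u g -> lcv (fun i => v i \+ u i) (f \+ g).
Proof.
move=> [v1 v2 v3] [u1 u2 u3]; split; [by move=> i; exact: l2D | exact: l2D |].
apply: (@cvg0_le _ (fun i => n2 (v i \- f) + n2 (u i \- g))); first by move=> i; exact: n2_ge0.
  apply: nearW => i; have -> : (v i \+ u i) \- (f \+ g) = (v i \- f) \+ (u i \- g).
    by apply/funext => x /=; ring.
  by apply: n2D; exact: l2B.
by rewrite -[0]addr0; exact: cvgD.
Qed.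

Lemma pCl2_l2 f g : pC f -> l2 g -> l2 (f \* g).
Proof.
move=> hf hg; have [M M0 hM] := pC_bounded hf.
by apply: l2M_bounded hM hg; exact: cont_measurable (pC_cont hf).
Qed.

Lemma lcv_bounded v f : lcv v f -> \forall i \near F, n2 (v i) <= n2 f + 1.
Proof.
move=> [v1 v2 /cvgrPdist_le v3]; apply: filterS (v3 _ ltr01) => i.
rewrite sub0r normrN ger0_norm ?n2_ge0 // => hi.
have -> : v i = f \+ (v i \- f) by apply/funext => x /=; ring.
by apply: (le_trans (n2D v2 (l2B (v1 i) v2))); rewrite lerD2l.
Qed.

(** One factor has to converge uniformly: two L^2 limits would only give convergence in L^1.
    Functions play the first role and their derivatives the second. *)
Lemma ulcvM v f u g : ucv v f -> lcv u g -> lcv (fun i => v i \* u i) (f \* g).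
Proof.
move=> [v1 v2 v3] hu; have [u1 u2 u3] := hu; split; [by move=> i; exact: pCl2_l2 | exact: pCl2_l2 |].
have [M M0 hM] := pC_bounded v2.
apply/cvgrPdist_le => e e0.
have n0 := n2_ge0 g.
have e1 : 0 < e / 2 / (n2 g + 1) by rewrite divr_gt0 ?divr_gt0 //; lra.
have e2 : 0 < e / 2 / (M + 1) by rewrite divr_gt0 ?divr_gt0 //; lra.
move/cvgrPdist_le : u3 => /(_ _ e2) u3.
apply: filterS3 (v3 _ e1) u3 (lcv_bounded hu) => i hv hu3 hb.
rewrite sub0r normrN ger0_norm ?n2_ge0 //.
have -> : (v i \* u i) \- (f \* g) = ((v i \- f) \* u i) \+ (f \* (u i \- g)).
  by apply/funext => x /=; ring.
apply: (le_trans (n2D (pCl2_l2 (pCB (v1 i) v2) (u1 i)) (pCl2_l2 v2 (l2B (u1 i) u2)))).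
rewrite [leRHS]splitr; apply: lerD.
  apply: (le_trans (n2M_bounded (cont_measurable (pC_cont (pCB (v1 i) v2))) (ltW e1) hv (u1 i))).
  rewrite mulrAC ler_pdivrMr; last by lra.
  by apply: ler_wpM2l => //; lra.
apply: (le_trans (n2M_bounded (cont_measurable (pC_cont v2)) M0 hM (l2B (u1 i) u2))).
move: hu3; rewrite sub0r normrN ger0_norm ?n2_ge0 // ler_pdivlMr; last by lra.
by have := n2_ge0 (u i \- g); nra.
Qed.

Lemma lcvZ c v f : lcv v f -> lcv (fun i => c \*o v i) (c \*o f).
Proof. exact: ulcvM (ucv_cst (pC_cst c)). Qed.

Lemma ip_lcv v f u g : lcv v f -> lcv u g -> ip (v i) (u i) @[i --> F] --> ip f g.
Proof.
move=> [v1 v2 v3] hu; have [u1 u2 u3] := hu.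
apply/subr_cvg0; apply/norm_cvg0P.
apply: (@cvg0_le _ (fun i => n2 (v i \- f) * (n2 g + 1) + n2 f * n2 (u i \- g))).
- by move=> i; exact: normr_ge0.
- apply: filterS (lcv_bounded hu) => i hb.
  have -> : ip (v i) (u i) - ip f g = ip (v i \- f) (u i) + ip f (u i \- g).
    by rewrite ipBl // ipBr //; ring.
  apply: (le_trans (ler_normD _ _)); apply: lerD.
    apply: (le_trans (cauchy_schwarz (l2B (v1 i) v2) (u1 i))).
    by rewrite ler_wpM2l ?n2_ge0.
  exact: cauchy_schwarz v2 (l2B (u1 i) u2).
- have c := cvgD (cvgM v3 (cvg_cst (n2 g + 1))) (cvgM (cvg_cst (n2 f)) u3).
  by rewrite mul0r mulr0 addr0 in c; exact: c.
Qed.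

Lemma lcv_fproj v f : lcv v f -> forall N, lcv (fun i => fproj N (v i)) (fproj N f).
Proof.
move=> [v1 v2 v3] N; split; [by []|by []|].
apply: (@cvg0_le _ (fun i => n2 (v i \- f))) => //; first by move=> i; exact: n2_ge0.
by apply: nearW => i; rewrite -fprojB //; apply: n2_fproj; exact: l2B.
Qed.

End Convergence.

Section FourierConvergence.
Context {R : realType}.
Implicit Types (f g h : R -> R).

Lemma lcv_fproj_oo f : l2 f -> lcv (F := \oo) (fun N => fproj N f) f.
Proof. by move=> hf; split => //; exact: fproj_cvg. Qed.

(** Classical integration by parts for the Fourier sums, whose derivatives are the Fourier sums of
    the weak derivatives, followed by the limit. *)
Lemma wdF_ibp f f' g g' : wdF f f' -> wdF g g' -> ip f g' = - ip f' g.
Proof.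
move=> hwf hwg; have [hf hf' _ _] := hwf; have [hg hg' _ _] := hwg.
have c1 : ip (fproj N f) (fproj N g') @[N --> \oo] --> ip f g'.
  by apply: ip_lcv; exact: lcv_fproj_oo.
have c2 : ip (fproj N f') (fproj N g) @[N --> \oo] --> ip f' g.
  by apply: ip_lcv; exact: lcv_fproj_oo.
have e : (fun N => ip (fproj N f) (fproj N g')) = (fun N => - ip (fproj N f') (fproj N g)).
  by apply/funext => N; exact: ip_ibp (fproj_wdF_pC1 N hwf) (fproj_wdF_pC1 N hwg).
rewrite e in c1; have := cvg_lim (@Rhausdorff R) c1.
by rewrite (cvg_lim (@Rhausdorff R) (cvgN c2)) => <-.
Qed.

(** Joint convergence comes for free since the projections are contractions, uniformly in N. *)
Lemma lcv_fproj_pair (I : Type) (F : set_system I) (FF : Filter F) (v : I -> R -> R) f :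
  lcv (F := F) v f -> lcv (F := filter_prod \oo F) (fun Ni => fproj Ni.1 (v Ni.2)) f.
Proof.
move=> [v1 v2 v3]; split => //.
apply: (@cvg0_le _ _ _ _ _ (fun Ni => n2 (v Ni.2 \- f) + n2 (fproj Ni.1 f \- f))).
- by move=> i; exact: n2_ge0.
- apply: nearW => -[N i] /=.
  have -> : fproj N (v i) \- f = (fproj N (v i) \- fproj N f) \+ (fproj N f \- f).
    by apply/funext => x /=; ring.
  apply: (le_trans (n2D (l2B (fproj_l2 _ _) (fproj_l2 _ _)) (l2B (fproj_l2 _ _) v2))).
  by rewrite lerD2r -fprojB //; apply: n2_fproj; exact: l2B.
- rewrite -[0]addr0; apply: cvgD.
    exact: (cvg_comp _ _ cvg_snd v3).
  exact: (cvg_comp _ _ cvg_fst (fproj_cvg v2)).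
Qed.

End FourierConvergence.

(** * The Lyapunov functional *)

Ltac pc_step :=
  match goal with
  | H : pC ?f |- pC ?f => exact: H
  | |- pC (?f \+ ?g) => refine (@pCD _ f g _ _)
  | |- pC (?f \- ?g) => refine (@pCB _ f g _ _)
  | |- pC (?f \* ?g) => refine (@pCM _ f g _ _)
  | |- pC (?c \*o ?f) => refine (@pCZ _ c f _)
  | |- pC (fun x => @?f x + @?g x) => refine (@pCD _ f g _ _); cbv beta
  | |- pC (fun x => - @?f x) => refine (@pCN _ f _); cbv beta
  | |- pC (fun x => ?c * @?f x) => refine (@pCZ _ c f _); cbv beta
  | |- pC (fun x => @?f x * @?g x) => refine (@pCM _ f g _ _); cbv beta
  | |- pC (fun x => @?f x ^+ ?n) => refine (@pCX _ n f _); cbv beta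
  | |- pC (fun _ => ?c) => refine (@pC_cst _ c)
  | H : pC1 ?f _ |- pC ?f => exact: pC1_pC H
  | H : pC1 _ ?f |- pC ?f => exact: pC1_pC' H
  | |- pC (fun x => ?f x) => change (pC f)
  end.
Ltac pc := repeat pc_step.

(** The derivative is an evar filled in by the rules; [pc1] thus computes it, and [pC1_eq] compares
    it with the expected one. *)
Ltac pc1_step :=
  match goal with
  | H : pC1 ?f _ |- pC1 ?f _ => exact: H
  | |- pC1 (fun _ => ?c) _ => refine (@pC1_cst _ c)
  | |- pC1 (fun x => @?f x + @?g x) _ => refine (@pC1D _ f _ g _ _ _); cbv beta
  | |- pC1 (fun x => - @?f x) _ => refine (@pC1N _ f _ _); cbv beta
  | |- pC1 (fun x => ?c * @?f x) _ => refine (@pC1Z _ c f _ _); cbv beta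
  | |- pC1 (fun x => @?f x * @?g x) _ => refine (@pC1M _ f _ g _ _ _); cbv beta
  | |- pC1 (fun x => @?f x ^+ ?n) _ => refine (@pC1X _ n f _ _); cbv beta
  | |- pC1 (fun x => ?f x) _ => change (pC1 f _)
  end.
Ltac pc1 := repeat pc1_step.

Section Lyapunov.
Context {R : realType}.
Variables (a a1 psi : R -> R) (lam K A Psi : R) (m : nat).
Hypotheses (ha : pC1 a a1) (a_ge0 : forall x, 0 <= a x) (a_le : forall x, a x <= A)
  (a1K : forall x, a1 x ^+ 2 <= K * a x) (lam_ge0 : 0 <= lam)
  (hpsi : pC1 psi (fun x => 1 - lam * a x)) (psi_le : forall x, `|psi x| <= Psi) (m_gt0 : (0 < m)%N).

Definition rho2 (r s : R) : R := r ^+ 2 + s ^+ 2.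

(** With v = r + i s and p = 2 m + 1, the term |v|^(p+1) is [rho2 r s ^+ m.+1]; [r1] and [s1] stand
    for the space derivatives. *)
Definition edens (r r1 s s1 : R) : R :=
  2^-1 * rho2 r s + 2^-1 * rho2 r1 s1 + (2 * m + 2)%:R^-1 * rho2 r s ^+ m.+1.

Definition ldens (kap eps x r r1 s s1 : R) : R :=
  kap / 2 * rho2 r s + 2^-1 * rho2 r1 s1 + (2 * m + 2)%:R^-1 * rho2 r s ^+ m.+1 -
  eps * psi x * (r * s1 - s * r1).

(** Differential of [ldens] at (r, r1, s, s1) in the direction (al, al1, be, be1). *)
Definition dldens (kap eps x r r1 s s1 al al1 be be1 : R) : R :=
  kap * (r * al + s * be) + (r1 * al1 + s1 * be1) + rho2 r s ^+ m * (r * al + s * be) -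
  eps * psi x * (al * s1 + r * be1 - be * r1 - s * al1).

(** The first line is the damping of the energy, where [a1] comes from differentiating a v in the
    |v_x|^2 term; the [eps] line is the contribution of the momentum weighted by psi, after
    integration by parts. *)
Definition diss (kap eps x r r1 s s1 : R) : R :=
  - kap * a x * rho2 r s - a x * rho2 r1 s1 - a1 x * (r * r1 + s * s1) - a x * rho2 r s ^+ m.+1
  + eps * (lam * a1 x * (r * r1 + s * s1) - 2 * (1 - lam * a x) * rho2 r1 s1
     - (1 - lam * a x) * rho2 r s ^+ m.+1 * (m%:R / m.+1%:R) - 2 * psi x * a x * (r1 * s - s1 * r)).

Definition derr (kap eps x r r1 s s1 e e1 f f1 : R) : R :=
  kap * (r * e + s * f) + (r1 * e1 + s1 * f1) + rho2 r s ^+ m * (r * e + s * f)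
  + eps * ((1 - lam * a x) * (r * f - s * e) + 2 * psi x * (r1 * f - s1 * e)).

(* Along a smooth solution of the equation perturbed by [e, f], the derivative of the
   Lyapunov density is [diss - derr] up to an exact derivative. *)
Lemma tint_dldens (kap eps : R) (r r1 r2 r3 s s1 s2 s3 e e1 f f1 : R -> R) :
  pC1 r r1 -> pC1 r1 r2 -> pC1 r2 r3 -> pC1 s s1 -> pC1 s1 s2 -> pC1 s2 s3 ->
  pC1 e e1 -> pC1 f f1 ->
  forall al al1 be be1 : R -> R,
  al =1 (fun x => - s2 x - a x * r x + rho2 (r x) (s x) ^+ m * s x - e x) ->
  be =1 (fun x => r2 x - a x * s x - rho2 (r x) (s x) ^+ m * r x - f x) ->
  pC1 al al1 -> pC1 be be1 ->
  torus_int (fun x => dldens kap eps x (r x) (r1 x) (s x) (s1 x) (al x) (al1 x) (be x) (be1 x)) =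
  torus_int (fun x => diss kap eps x (r x) (r1 x) (s x) (s1 x)
     - derr kap eps x (r x) (r1 x) (s x) (s1 x) (e x) (e1 x) (f x) (f1 x)).
Proof.
move=> hr hr1 hr2 hs hs1 hs2 he hf al al1 be be1 eal ebe.
have hrho : pC1 (fun x => rho2 (r x) (s x)) (fun x => 2 * (r x * r1 x + s x * s1 x)).
  by rewrite /rho2; apply: pC1_eq; [pc1 | move=> x /=; ring].
have hal' : pC1 al (fun x => - s3 x - (a1 x * r x + a x * r1 x) +
  (m%:R * rho2 (r x) (s x) ^+ m.-1 * (2 * (r x * r1 x + s x * s1 x)) * s x + rho2 (r x) (s x) ^+ m * s1 x) - e1 x).
  by rewrite (funext eal); apply: pC1_eq; [pc1 | move=> x /=; ring].
have hbe' : pC1 be (fun x => r3 x - (a1 x * s x + a x * s1 x) -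
  (m%:R * rho2 (r x) (s x) ^+ m.-1 * (2 * (r x * r1 x + s x * s1 x)) * r x + rho2 (r x) (s x) ^+ m * r1 x) - f1 x).
  by rewrite (funext ebe); apply: pC1_eq; [pc1 | move=> x /=; ring].
move=> hal hbe.
(* The total flux: the [kap] term belongs to the mass, the next two to the energy, and the [eps]
   terms to the momentum weighted by psi. *)
pose Q x := kap * (s x * r1 x - r x * s1 x) + (s1 x * r2 x - r1 x * s2 x)
  + rho2 (r x) (s x) ^+ m * (s x * r1 x - r x * s1 x) - eps * (psi x * (r x * be x - s x * al x))
  + eps * ((1 - lam * a x) * (r x * r1 x + s x * s1 x) + psi x * (r1 x ^+ 2 + s1 x ^+ 2)
     - m.+1%:R^-1 * (psi x * rho2 (r x) (s x) ^+ m.+1)).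
have [Q' hQ] : exists Q', pC1 Q Q' /\ forall x,
  dldens kap eps x (r x) (r1 x) (s x) (s1 x) (al x) (al1 x) (be x) (be1 x) =
  diss kap eps x (r x) (r1 x) (s x) (s1 x)
     - derr kap eps x (r x) (r1 x) (s x) (s1 x) (e x) (e1 x) (f x) (f1 x) + Q' x.
  (* Derivatives are unique, so the given [al1] and [be1] may be replaced by the formulas of [hal']
     and [hbe']. *)
  have un (g g1 g2 : R -> R) : pC1 g g1 -> pC1 g g2 -> forall x, g1 x = g2 x.
    move=> [_ d1 _] [_ d2 _] x; have h1 := d1 x; have h2 := d2 x.
    by rewrite -(@derive_val _ _ _ _ _ _ _ h1) (@derive_val _ _ _ _ _ _ _ h2).
  eexists; split; first by rewrite /Q; pc1.
  move=> x /=; rewrite (un _ _ _ hal hal') (un _ _ _ hbe hbe') !eal !ebe /dldens /diss /derr.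
  (* Since m is positive, the exponent [m.-1] produced by differentiating the power becomes an
     actual predecessor. *)
  case: m m_gt0 => [//|n _] /=.
  rewrite !(exprS (rho2 (r x) (s x))) -![n.+2%:R]natr1 -![n.+1%:R]natr1.
  set q := rho2 (r x) (s x) ^+ n.
  have n1 : (n%:R + 1 + 1 : R) != 0 by rewrite !natr1 pnatr_eq0.
  by rewrite /rho2; field.
have [hQ1 hQ2] := hQ.
rewrite -[RHS]addr0 -(tint_deriv0 hQ1) -tintD; first by congr torus_int; apply/funext => x; exact: hQ2.
- by apply: pC_intg; rewrite /diss /derr /rho2; pc.
- exact: pC_intg (pC1_pC' hQ1).
Qed.

Lemma rho2_ge0 (x y : R) : 0 <= rho2 x y.
Proof. by rewrite addr_ge0 ?sqr_ge0. Qed.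

(** Young's inequality for both components at once, by completing squares. *)
Lemma cross_le (e w r r1 s s1 : R) : 0 < e ->
  w * (r * r1 + s * s1) <= e * rho2 r1 s1 + w ^+ 2 / (4 * e) * rho2 r s.
Proof.
move=> e0; rewrite -subr_ge0.
have -> : e * rho2 r1 s1 + w ^+ 2 / (4 * e) * rho2 r s - w * (r * r1 + s * s1) =
  e * ((r1 - w / (2 * e) * r) ^+ 2 + (s1 - w / (2 * e) * s) ^+ 2).
  by rewrite /rho2; field; rewrite gt_eqF.
by rewrite mulr_ge0 ?(ltW e0) // addr_ge0 ?sqr_ge0.
Qed.

Lemma psi2_le x : psi x ^+ 2 <= Psi ^+ 2.
Proof. by rewrite -sqr_normr; have := psi_le x; have := normr_ge0 (psi x); nra. Qed.

Lemma A_ge0 : 0 <= A. Proof. exact: le_trans (a_ge0 0) (a_le 0). Qed.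

Lemma rate_ge : (2^-1 : R) <= m%:R / m.+1%:R.
Proof.
rewrite ler_pdivlMr // -[m.+1%:R]natr1.
have : (1 : R) <= m%:R by rewrite ler1n.
lra.
Qed.

(* The bad term a' (r r' + s s') is absorbed because a'^2 <= K a. *)
Lemma diss_le kap eps x r r1 s s1 : 0 < eps -> 4 * (eps * lam) <= 1 ->
  diss kap eps x r r1 s s1 <= - eps * rho2 r1 s1
    - (kap - (K / (2 * eps) + eps * lam ^+ 2 * K + 4 * eps * Psi ^+ 2 * A)) * (a x * rho2 r s)
    - eps / 2 * rho2 r s ^+ m.+1.
Proof.
move=> e0 el.
have P0 : 0 <= rho2 r s ^+ m.+1 by rewrite exprn_ge0 // rho2_ge0.
have R0 := rho2_ge0 r s; have R1 := rho2_ge0 r1 s1.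
have A0 := a_ge0 x.
have q4 : (0 : R) < 4^-1 by rewrite invr_gt0.
(* Budget: psi provides 2 eps |v_x|^2, of which [t1] spends eps/2 and [t2], [t3] spend eps/4 each,
   leaving eps. The terms with lam a are absorbed by the damping in [t4] and [t5], because 4 eps lam
   <= 1. *)
have t1 : - a1 x * (r * r1 + s * s1) <= eps / 2 * rho2 r1 s1 + K / (2 * eps) * (a x * rho2 r s).
  have e2 : 0 < eps / 2 by rewrite divr_gt0.
  apply: (le_trans (cross_le (- a1 x) r r1 s s1 e2)); rewrite lerD2l sqrrN.
  rewrite [leRHS]mulrA ler_wpM2r //.
  have -> : 4 * (eps / 2) = 2 * eps by field.
  by rewrite [leRHS]mulrAC ler_wpM2r // invr_ge0 mulr_ge0 // ltW.
have t2 : lam * a1 x * (r * r1 + s * s1) <= 4^-1 * rho2 r1 s1 + lam ^+ 2 * K * (a x * rho2 r s).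
  apply: (le_trans (cross_le (lam * a1 x) r r1 s s1 q4)).
  rewrite lerD2l mulfV ?pnatr_eq0 // divr1.
  have := ler_wpM2l (sqr_ge0 lam) (ler_wpM2r R0 (a1K x)); lra.
have t3 : - (2 * psi x * a x) * (r1 * s - s1 * r) <= 4^-1 * rho2 r1 s1 + 4 * Psi ^+ 2 * A * (a x * rho2 r s).
  have -> : - (2 * psi x * a x) * (r1 * s - s1 * r) = (- (2 * psi x * a x)) * (s * r1 + (- r) * s1) by ring.
  apply: (le_trans (cross_le _ s r1 (- r) s1 q4)).
  have -> : rho2 s (- r) = rho2 r s by rewrite /rho2; ring.
  rewrite lerD2l mulfV ?pnatr_eq0 // divr1 mulrA ler_wpM2r //.
  have -> : (- (2 * psi x * a x)) ^+ 2 = 4 * psi x ^+ 2 * (a x * a x) by ring.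
  have -> : 4 * Psi ^+ 2 * A * a x = 4 * Psi ^+ 2 * (A * a x) by ring.
  have h1 : 4 * psi x ^+ 2 <= 4 * Psi ^+ 2 by have := psi2_le x; lra.
  have h2 : a x * a x <= A * a x by rewrite ler_wpM2r.
  by apply: ler_pM => //; rewrite mulr_ge0 // sqr_ge0.
have t4 : (eps * lam * (m%:R / m.+1%:R) - 1) * (a x * rho2 r s ^+ m.+1) <= 0.
  have h : m%:R / m.+1%:R <= 1 :> R by rewrite ler_pdivrMr // mul1r ler_nat.
  have h0 : 0 <= eps * lam by rewrite mulr_ge0 // ltW.
  have h2 := ler_wpM2l h0 h; set c := m%:R / m.+1%:R in h2 *.
  by apply: mulr_le0_ge0; [rewrite mulr1 in h2; lra | exact: mulr_ge0].
have t5 : (2 * (eps * lam) - 1) * (a x * rho2 r1 s1) <= 0.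
  by apply: mulr_le0_ge0; [lra | exact: mulr_ge0].
have t6 : eps * (2^-1 * rho2 r s ^+ m.+1) <= eps * (m%:R / m.+1%:R * rho2 r s ^+ m.+1).
  by rewrite ler_wpM2l ?(ltW e0) // ler_wpM2r // rate_ge.
have {}t2 := ler_wpM2l (ltW e0) t2; have {}t3 := ler_wpM2l (ltW e0) t3.
rewrite /diss.
set q := rho2 r s ^+ m.+1 in P0 t4 t6 *; set c := m%:R / m.+1%:R in t4 t6 *.
set d := K / (2 * eps) in t1 *.
rewrite /rho2 in t1 t2 t3 t5 *.
lra.
Qed.

Lemma edens_ge0 r r1 s s1 : 0 <= edens r r1 s s1.
Proof.
have h (x y : R) : 0 <= rho2 x y by rewrite addr_ge0 ?sqr_ge0.
by rewrite /edens !addr_ge0 // mulr_ge0 // ?invr_ge0 // exprn_ge0.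
Qed.

End Lyapunov.

Section LyapunovConstants.
Context {R : realType}.
Variables (a a1 psi : R -> R) (lam K A Psi : R) (m : nat).
Hypotheses (ha : pC1 a a1) (a_ge0 : forall x, 0 <= a x) (a_le : forall x, a x <= A)
  (a1K : forall x, a1 x ^+ 2 <= K * a x) (K_ge0 : 0 <= K) (lam_ge0 : 0 <= lam)
  (hpsi : pC1 psi (fun x => 1 - lam * a x)) (psi_le : forall x, `|psi x| <= Psi) (m_gt0 : (0 < m)%N).

Lemma inv_double_le1 : (2 * m + 2)%:R^-1 <= 1 :> R.
Proof. by rewrite invf_le1 ?ler1n ?ltr0n addn2. Qed.

Lemma psi_cross eps x r r1 s s1 :
  `|eps * psi x * (r * s1 - s * r1)| <= 4^-1 * rho2 r1 s1 + eps ^+ 2 * Psi ^+ 2 * rho2 r s.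
Proof.
have q4 : (0 : R) < 4^-1 by rewrite invr_gt0.
have h : (eps * psi x) ^+ 2 / (4 * 4^-1) * rho2 r s <= eps ^+ 2 * Psi ^+ 2 * rho2 r s.
  rewrite mulfV ?pnatr_eq0 // divr1 ler_wpM2r ?rho2_ge0 // exprMn ler_wpM2l ?sqr_ge0 //.
  exact: (psi2_le psi_le).
have e1 : rho2 (- s) r = rho2 r s by rewrite /rho2; ring.
have e2 : rho2 s (- r) = rho2 r s by rewrite /rho2; ring.
have h1 := cross_le (eps * psi x) (- s) r1 r s1 q4; have h2 := cross_le (eps * psi x) s r1 (- r) s1 q4.
rewrite e1 in h1; rewrite e2 in h2.
rewrite ler_norml; apply/andP; split; lra.
Qed.

(** Twice the cross term takes at most half of |v_x|^2, by [psi_cross], together with 2 eps^2 Psi^2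
    |v|^2, which the lower bound on [kap] pays for. *)
Lemma edens_le_ldens kap eps x r r1 s s1 : 2^-1 + 2 * (eps ^+ 2 * Psi ^+ 2) <= kap ->
  edens m r r1 s s1 <= 2 * ldens psi m kap eps x r r1 s s1.
Proof.
move=> hk; have := psi_cross eps x r r1 s s1; rewrite ler_norml => /andP[h1 h2].
have h3 := ler_wpM2r (rho2_ge0 r s) hk.
have P0 : 0 <= (2 * m + 2)%:R^-1 * rho2 r s ^+ m.+1.
  by rewrite mulr_ge0 ?invr_ge0 // exprn_ge0 // rho2_ge0.
rewrite /edens /ldens.
move: ((2 * m + 2)%:R^-1 * rho2 r s ^+ m.+1) P0 => Z P0.
move: (rho2 r s) (rho2 r1 s1) (rho2_ge0 r s) (rho2_ge0 r1 s1) h1 h2 h3 => X X1 X0 X10 h1 h2 h3.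
lra.
Qed.

Lemma ldens_le_edens kap eps x r r1 s s1 : 0 <= kap ->
  ldens psi m kap eps x r r1 s s1 <= (kap + 2 + 2 * (eps ^+ 2 * Psi ^+ 2)) * edens m r r1 s s1.
Proof.
move=> hk; have := psi_cross eps x r r1 s s1; rewrite ler_norml => /andP[h1 h2].
have P0 : 0 <= (2 * m + 2)%:R^-1 * rho2 r s ^+ m.+1.
  by rewrite mulr_ge0 ?invr_ge0 // exprn_ge0 // rho2_ge0.
have E0 : 0 <= eps ^+ 2 * Psi ^+ 2 by rewrite mulr_ge0 ?sqr_ge0.
rewrite /edens /ldens.
move: ((2 * m + 2)%:R^-1 * rho2 r s ^+ m.+1) P0 => Z P0.
move: (rho2 r s) (rho2 r1 s1) (rho2_ge0 r s) (rho2_ge0 r1 s1) h1 h2 => X X1 X0 X10 h1 h2.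
move: (eps ^+ 2 * Psi ^+ 2) E0 h1 h2 => E E0 h1 h2.
have := mulr_ge0 hk X10; have := mulr_ge0 hk P0; have := mulr_ge0 E0 X10; have := mulr_ge0 E0 P0.
lra.
Qed.

Lemma tint_lin3 (c : R) (f g h : R -> R) : intg f -> intg g -> intg h ->
  torus_int (c \*o ((f \+ g) \+ h)) = c * (torus_int f + torus_int g + torus_int h).
Proof.
by move=> hf hg hh; rewrite (tintZ _ (intgD (intgD hf hg) hh)) (tintD (intgD hf hg) hh) (tintD hf hg).
Qed.

Lemma tint_le_lin3 (c d e : R) (f0 f g h : R -> R) : intg f0 -> intg f -> intg g -> intg h ->
  (forall x, f0 x <= c * f x + d * g x + e * h x) ->
  torus_int f0 <= c * torus_int f + d * torus_int g + e * torus_int h.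
Proof.
move=> h0 hf hg hh H.
rewrite -(tintZ _ hf) -(tintZ _ hg) -(tintZ _ hh) -(tintD (intgZ _ hf) (intgZ _ hg)).
rewrite -(tintD (intgD (intgZ _ hf) (intgZ _ hg)) (intgZ _ hh)).
by apply: tint_le => //; do ?apply: intgD; exact: intgZ.
Qed.

(* The multiplier psi, with psi' = 1 - lam a, gives the Poincare inequality. *)
Lemma poincare_damped (r r1 s s1 : R -> R) : pC1 r r1 -> pC1 s s1 ->
  torus_int (fun x => rho2 (r x) (s x)) <=
  2 * lam * torus_int (fun x => a x * rho2 (r x) (s x)) + 4 * Psi ^+ 2 * torus_int (fun x => rho2 (r1 x) (s1 x)).
Proof.
move=> hr hs.
have hQ : pC1 (fun x => psi x * (r x ^+ 2 + s x ^+ 2)) (fun x => rho2 (r x) (s x) - lam * (a x * rho2 (r x) (s x))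
   + 2 * psi x * (r x * r1 x + s x * s1 x)).
  by apply: pC1_eq; [pc1 | move=> x /=; rewrite /rho2; ring].
have i1 : intg (fun x => rho2 (r x) (s x)) by apply: pC_intg; rewrite /rho2; pc.
have i2 : intg (fun x => a x * rho2 (r x) (s x)) by apply: pC_intg; rewrite /rho2; pc.
have i3 : intg (fun x => rho2 (r1 x) (s1 x)) by apply: pC_intg; rewrite /rho2; pc.
have H := tint_deriv0 hQ.
have i4 := pC_intg (pC1_pC' hQ).
(* Twice the exact derivative is added to the pointwise inequality; its integral is 0. *)
have := @tint_le_lin3 (2 * lam) (4 * Psi ^+ 2) 2 _ _ _ _ i1 i2 i3 i4.
rewrite H mulr0 addr0; apply => x; have := psi2_le psi_le x.
have : - (4 * psi x) * (r x * r1 x + s x * s1 x) <= rho2 (r x) (s x) + 4 * psi x ^+ 2 * rho2 (r1 x) (s1 x).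
  rewrite -subr_ge0.
  have -> : rho2 (r x) (s x) + 4 * psi x ^+ 2 * rho2 (r1 x) (s1 x) - - (4 * psi x) * (r x * r1 x + s x * s1 x) =
    (r x + 2 * psi x * r1 x) ^+ 2 + (s x + 2 * psi x * s1 x) ^+ 2 by rewrite /rho2; ring.
  by rewrite addr_ge0 // sqr_ge0.
move=> h1 /(ler_wpM2r (rho2_ge0 (r1 x) (s1 x))) h2.
lra.
Qed.

Lemma lyapunov_exists : exists kap eps delta C : R, [/\ 0 < eps, 0 < delta, 0 < C,
  (forall x r r1 s s1, edens m r r1 s s1 <= 2 * ldens psi m kap eps x r r1 s s1 /\
     ldens psi m kap eps x r r1 s s1 <= C * edens m r r1 s s1) &
  forall r r1 s s1 : R -> R, pC1 r r1 -> pC1 s s1 ->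
    torus_int (fun x => diss a a1 psi lam m kap eps x (r x) (r1 x) (s x) (s1 x)) <=
    - delta * torus_int (fun x => ldens psi m kap eps x (r x) (r1 x) (s x) (s1 x))].
Proof.
(* Gives 4 eps lam <= 1; adding 1 to lam keeps it finite when lam = 0. *)
pose eps : R := (4 * (lam + 1))^-1.
have l0 := lam_ge0; have l1 : 0 < lam + 1 by rewrite ltr_wpDl.
have e0 : 0 < eps by rewrite invr_gt0 mulr_gt0.
have el : 4 * (eps * lam) <= 1.
  by rewrite /eps invfM mulrA mulrA mulfV ?pnatr_eq0 // mul1r ler_pdivrMl // mulr1 lerDl.
pose C0 := K / (2 * eps) + eps * lam ^+ 2 * K + 4 * eps * Psi ^+ 2 * A.
have A0 := A_ge0 a_ge0 a_le.
have C00 : 0 <= C0.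
  have e00 := ltW e0; rewrite /C0; do ?apply: addr_ge0.
  - by rewrite divr_ge0 // mulr_ge0.
  - exact: mulr_ge0 (mulr_ge0 e00 (sqr_ge0 _)) K_ge0.
  - exact: mulr_ge0 (mulr_ge0 (mulr_ge0 (ler0n R 4) e00) (sqr_ge0 _)) A0.
(* [kap - C0 >= eps] leaves damping of a |v|^2 at rate eps in [diss_le]; the other terms meet the
   hypothesis of [edens_le_ldens]. *)
pose kap := C0 + eps + 2^-1 + 2 * (eps ^+ 2 * Psi ^+ 2).
have E0 : 0 <= eps ^+ 2 * Psi ^+ 2 by rewrite mulr_ge0 ?sqr_ge0.
pose C := kap + 2 + 2 * (eps ^+ 2 * Psi ^+ 2).
have kap0 : 0 <= kap by rewrite /kap; lra.
have Cp : 0 < C by rewrite /C; lra.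
pose CP := 2 * lam + 4 * Psi ^+ 2.
have CP0 : 0 <= CP by rewrite addr_ge0 // mulr_ge0 // sqr_ge0.
(* The dissipation is eps/2 times (X1 + Y + Z), whereas L is at most C (X + X1 + Z), hence at most C
   (CP + 1) (X1 + Y + Z) by the Poincare inequality with constant CP. *)
pose delta := eps / 2 / (C * (CP + 1)).
have d0 : 0 < delta by rewrite divr_gt0 ?divr_gt0 // mulr_gt0 //; lra.
exists kap, eps, delta, C; split => //.
  move=> x r r1 s s1; split; last exact: ldens_le_edens.
  by apply: edens_le_ldens; rewrite /kap; lra.
move=> r r1 s s1 hr hs.
pose X := torus_int (fun x => rho2 (r x) (s x)).
pose X1 := torus_int (fun x => rho2 (r1 x) (s1 x)).
pose Y := torus_int (fun x => a x * rho2 (r x) (s x)).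
pose Z := torus_int (fun x => rho2 (r x) (s x) ^+ m.+1).
have iX : intg (fun x => rho2 (r x) (s x)) by apply: pC_intg; rewrite /rho2; pc.
have iY : intg (fun x => a x * rho2 (r x) (s x)) by apply: pC_intg; rewrite /rho2; pc.
have iX1 : intg (fun x => rho2 (r1 x) (s1 x)) by apply: pC_intg; rewrite /rho2; pc.
have iZ : intg (fun x => rho2 (r x) (s x) ^+ m.+1) by apply: pC_intg; rewrite /rho2; pc.
have X0 : 0 <= X by apply: tint_ge0 => x _; exact: rho2_ge0.
have X10 : 0 <= X1 by apply: tint_ge0 => x _; exact: rho2_ge0.
have Y0 : 0 <= Y by apply: tint_ge0 => x _; rewrite mulr_ge0 ?rho2_ge0.
have Z0 : 0 <= Z by apply: tint_ge0 => x _; rewrite exprn_ge0 ?rho2_ge0.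
have hD : torus_int (fun x => diss a a1 psi lam m kap eps x (r x) (r1 x) (s x) (s1 x)) <= - (eps / 2) * (X1 + Y + Z).
  have -> : - (eps / 2) * (X1 + Y + Z) = torus_int ((- (eps / 2)) \*o (((fun x => rho2 (r1 x) (s1 x)) \+
      (fun x => a x * rho2 (r x) (s x))) \+ (fun x => rho2 (r x) (s x) ^+ m.+1))).
    by rewrite tint_lin3.
  apply: tint_le.
  - by apply: pC_intg; rewrite /diss /rho2; pc.
  - exact: intgZ (intgD (intgD iX1 iY) iZ).
  - move=> x _ /=.
    have := diss_le a_ge0 a_le a1K lam_ge0 psi_le m_gt0 kap x (r x) (r1 x) (s x) (s1 x) e0 el.
    rewrite -/C0.
    have k1 : eps <= kap - C0 by rewrite /kap; lra.
    have aR := mulr_ge0 (a_ge0 x) (rho2_ge0 (r x) (s x)).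
    have := ler_wpM2r aR k1.
    have := mulr_ge0 (ltW e0) (rho2_ge0 (r1 x) (s1 x)); have := mulr_ge0 (ltW e0) aR.
    move: (kap - C0) => k; move: (a x * rho2 (r x) (s x)) (rho2 (r1 x) (s1 x)) (rho2 (r x) (s x) ^+ m.+1).
    by move=> y x1 z; lra.
have hL : torus_int (fun x => ldens psi m kap eps x (r x) (r1 x) (s x) (s1 x)) <= C * (X + X1 + Z).
  have -> : C * (X + X1 + Z) = torus_int (C \*o (((fun x => rho2 (r x) (s x)) \+
      (fun x => rho2 (r1 x) (s1 x))) \+ (fun x => rho2 (r x) (s x) ^+ m.+1))).
    by rewrite tint_lin3.
  apply: tint_le.
  - by apply: pC_intg; rewrite /ldens /rho2; pc.
  - exact: intgZ (intgD (intgD iX iX1) iZ).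
  - move=> x _ /=; apply: (le_trans (ldens_le_edens _ _ _ _ _ _ kap0)).
    apply: ler_wpM2l; first exact: ltW.
    rewrite /edens.
    have c1 := inv_double_le1.
    have z0 : 0 <= rho2 (r x) (s x) ^+ m.+1 by rewrite exprn_ge0 ?rho2_ge0.
    have h1 := ler_wpM2r z0 c1; have h2 := rho2_ge0 (r x) (s x); have h3 := rho2_ge0 (r1 x) (s1 x).
    set q := rho2 (r x) (s x) ^+ m.+1 in z0 h1 *; set c := (2 * m + 2)%:R^-1 in c1 h1 *.
    set X' := rho2 (r x) (s x) in h2 *; set X1' := rho2 (r1 x) (s1 x) in h3 *.
    lra.
have hP : X <= CP * (X1 + Y).
  apply: (le_trans (poincare_damped hr hs)); rewrite -/Y -/X1 /CP.
  have := mulr_ge0 lam_ge0 X10; have := mulr_ge0 (sqr_ge0 Psi) Y0; lra.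
apply: (le_trans hD).
have -> : - (eps / 2) * (X1 + Y + Z) = - delta * (C * (CP + 1) * (X1 + Y + Z)).
  by rewrite /delta; field; apply/andP; split; lra.
rewrite !mulNr lerN2 ler_wpM2l ?(ltW d0) //.
apply: (le_trans hL); rewrite -mulrA ler_wpM2l ?(ltW Cp) //.
have := mulr_ge0 CP0 Z0; lra.
Qed.

End LyapunovConstants.

(** * First-order expansion of the Lyapunov density, uniform in space *)

Section Expansion.
Context {R : realType}.

Lemma normD_le (x y b c : R) : `|x| <= b -> `|y| <= c -> `|x + y| <= b + c.
Proof. by move=> h1 h2; exact: le_trans (ler_normD _ _) (lerD h1 h2). Qed.

Lemma normM_le (x y b c : R) : `|x| <= b -> `|y| <= c -> `|x * y| <= b * c.
Proof. by move=> h1 h2; rewrite normrM; apply: ler_pM. Qed.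

Lemma normN_le (x b : R) : `|x| <= b -> `| - x| <= b.
Proof. by rewrite normrN. Qed.

Lemma normX_le (x b : R) n : `|x| <= b -> `|x ^+ n| <= b ^+ n.
Proof. by move=> h; rewrite normrX lerXn2r // nnegrE (le_trans (normr_ge0 x)). Qed.

Lemma pow_taylor (B : R) n : 0 <= B -> exists2 C : R, 0 <= C & forall x y : R, `|x| <= B -> `|y| <= B ->
  `|x ^+ n - y ^+ n - n%:R * y ^+ n.-1 * (x - y)| <= C * (x - y) ^+ 2.
Proof.
move=> B0; elim: n => [|n [C C0 ih]].
  by exists 0 => // x y _ _; rewrite !expr0 subrr !mul0r subr0 normr0.
exists (B * C + n%:R * B ^+ n.-1); first by rewrite addr_ge0 // mulr_ge0 // exprn_ge0.
move=> x y hx hy.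
have -> : x ^+ n.+1 - y ^+ n.+1 - n.+1%:R * y ^+ n.+1.-1 * (x - y) =
  x * (x ^+ n - y ^+ n - n%:R * y ^+ n.-1 * (x - y)) + n%:R * y ^+ n.-1 * (x - y) ^+ 2.
  case: n {ih} => [|n] /=; first by rewrite !expr1 !expr0; ring.
  by rewrite !(exprS _ n.+1) !(exprS _ n) -[n.+2%:R]natr1; ring.
rewrite mulrDl; apply: normD_le.
  by rewrite -[leRHS]mulrA; apply: normM_le => //; exact: ih.
apply: normM_le; last by rewrite ger0_norm ?sqr_ge0.
by apply: normM_le; [rewrite ger0_norm | exact: normX_le].
Qed.

Variables (psi : R -> R) (Psi : R) (m : nat).
Hypothesis (psi_le : forall x, `|psi x| <= Psi).

Lemma norm_psi_le x : `|psi x| <= Psi. Proof. exact: psi_le. Qed.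

Ltac nb_step :=
  match goal with
  | H : is_true (`|?x| <= _) |- is_true (`|?x| <= _) => exact: H
  | |- is_true (`|_ + _| <= _) => apply: normD_le
  | |- is_true (`|_ * _| <= _) => apply: normM_le
  | |- is_true (`|- _| <= _) => apply: normN_le
  | |- is_true (`|_ ^+ _| <= _) => apply: normX_le
  | |- is_true (`|psi _| <= _) => exact: norm_psi_le
  | |- is_true (`|?x| <= `|?x|) => exact: lexx
  end.
Ltac nb := repeat nb_step.

Lemma dldens_bound (kap eps B : R) : 0 <= B -> exists2 C : R, 0 <= C &
  forall (eta x r r1 s s1 al al1 be be1 : R), 
    `|r| <= B -> `|r1| <= B -> `|s| <= B -> `|s1| <= B ->
    `|al| <= eta -> `|al1| <= eta -> `|be| <= eta -> `|be1| <= eta ->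
    `|dldens psi m kap eps x r r1 s s1 al al1 be be1| <= C * eta.
Proof.
move=> B0.
have Psi0 : 0 <= Psi := le_trans (normr_ge0 _) (psi_le 0).
exists (`|kap| * (B + B) + (B + B) + (B ^+ 2 + B ^+ 2) ^+ m * (B + B) + `|eps| * Psi * (B + B + B + B)).
  by rewrite ?(addr_ge0, mulr_ge0, exprn_ge0).
move=> eta x r r1 s s1 al al1 be be1 *.
have -> : (`|kap| * (B + B) + (B + B) + (B ^+ 2 + B ^+ 2) ^+ m * (B + B) + `|eps| * Psi * (B + B + B + B)) * eta =
  `|kap| * (B * eta + B * eta) + (B * eta + B * eta) + (B ^+ 2 + B ^+ 2) ^+ m * (B * eta + B * eta)
  + `|eps| * Psi * (eta * B + B * eta + eta * B + B * eta) by ring.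
by rewrite /dldens /rho2; nb.
Qed.

Lemma ldens_taylor (kap eps B : R) : 0 <= B -> exists2 C : R, 0 <= C &
  forall (h x r r1 s s1 al al1 be be1 : R), 0 <= h <= 1 ->
    `|r| <= B -> `|r1| <= B -> `|s| <= B -> `|s1| <= B ->
    `|al| <= B -> `|al1| <= B -> `|be| <= B -> `|be1| <= B ->
    `|ldens psi m kap eps x (r + h * al) (r1 + h * al1) (s + h * be) (s1 + h * be1)
      - ldens psi m kap eps x r r1 s s1 - h * dldens psi m kap eps x r r1 s s1 al al1 be be1| <= C * h ^+ 2.
Proof.
move=> B0.
have Psi0 : 0 <= Psi := le_trans (normr_ge0 _) (psi_le 0).
(* Constants here are left unsimplified: [nb] builds its bounds from the shape of the expression,
   with [1] bounding |h|. *)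
pose D := (B + 1 * B) ^+ 2 + (B + 1 * B) ^+ 2.
have D0 : 0 <= D by rewrite ?(addr_ge0, mulr_ge0, exprn_ge0).
have [Cn Cn0 hCn] := pow_taylor m.+1 D0.
pose c : R := (2 * m + 2)%:R^-1.
have c0 : 0 <= c by rewrite invr_ge0.
pose G := 2 * (B * B + B * B) + 1 * (B ^+ 2 + B ^+ 2).
exists (`|kap / 2| * (B ^+ 2 + B ^+ 2) + `|2^-1| * (B ^+ 2 + B ^+ 2) + (c * (Cn * G ^+ 2) + c * (m.+1%:R * D ^+ m * (B ^+ 2 + B ^+ 2)))
  + `|eps| * Psi * (B * B + B * B)).
  by rewrite ?(addr_ge0, mulr_ge0, exprn_ge0) // normr_ge0.
move=> h x r r1 s s1 al al1 be be1 /andP[h0 h1] hr hr1 hs hs1 hal hal1 hbe hbe1.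
have hh : `|h| <= 1 by rewrite ger0_norm.
(* Except for the power, the density is quadratic and its expansion is exact; [P] is the Taylor
   remainder of the power. *)
pose P := rho2 (r + h * al) (s + h * be) ^+ m.+1 - rho2 r s ^+ m.+1
   - m.+1%:R * rho2 r s ^+ m * (rho2 (r + h * al) (s + h * be) - rho2 r s).
have -> : ldens psi m kap eps x (r + h * al) (r1 + h * al1) (s + h * be) (s1 + h * be1)
      - ldens psi m kap eps x r r1 s s1 - h * dldens psi m kap eps x r r1 s s1 al al1 be be1 =
  (kap / 2 * (al ^+ 2 + be ^+ 2) + 2^-1 * (al1 ^+ 2 + be1 ^+ 2)) * h ^+ 2 + (c * P + c * (m.+1%:R * rho2 r s ^+ m * (al ^+ 2 + be ^+ 2)) * h ^+ 2)
  + (- (eps * psi x * (al * be1 - be * al1)) * h ^+ 2).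
  rewrite /ldens /dldens /P -/c.
  have ec : c * m.+1%:R = 2^-1.
    have -> : c = (2 * m.+1%:R)^-1 by rewrite /c -natrM; congr (_%:R^-1); rewrite mulnS addnC.
    by field; rewrite addrC natr1 pnatr_eq0.
  set q := rho2 r s ^+ m; set q1 := rho2 _ _ ^+ m.+1; set q2 := rho2 _ _ ^+ m.+1.
  have -> : c * (q1 - q2 - m.+1%:R * q * (rho2 (r + h * al) (s + h * be) - rho2 r s)) =
    c * q1 - c * q2 - (c * m.+1%:R) * q * (rho2 (r + h * al) (s + h * be) - rho2 r s) by ring.
  have -> : c * (m.+1%:R * q * (al ^+ 2 + be ^+ 2)) = (c * m.+1%:R) * q * (al ^+ 2 + be ^+ 2) by ring.
  by rewrite ec /rho2; field.
have hP : `|P| <= Cn * G ^+ 2 * h ^+ 2.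
  apply: (le_trans (hCn _ _ _ _)).
  - by rewrite /rho2 /D; nb.
  - have : `|rho2 r s| <= B ^+ 2 + B ^+ 2 by rewrite /rho2; nb.
    move/le_trans; apply; rewrite /D mul1r.
    have := mulr_ge0 B0 B0; rewrite -expr2; have -> : (B + B) ^+ 2 = 4 * B ^+ 2 by ring.
    lra.
  - rewrite -mulrA ler_wpM2l // -exprMn -sqr_normr lerXn2r ?nnegrE //.
      by rewrite ?(addr_ge0, mulr_ge0, exprn_ge0).
    have -> : rho2 (r + h * al) (s + h * be) - rho2 r s = (2 * (r * al + s * be) + h * (al ^+ 2 + be ^+ 2)) * h.
      by rewrite /rho2; ring.
    by rewrite normrM (ger0_norm h0) ler_wpM2r // /G; nb; rewrite normr_nat.
have hq : `|rho2 r s ^+ m| <= D ^+ m.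
  apply: normX_le; have : `|rho2 r s| <= B ^+ 2 + B ^+ 2 by rewrite /rho2; nb.
  move/le_trans; apply; rewrite /D mul1r.
  have := mulr_ge0 B0 B0; rewrite -expr2; have -> : (B + B) ^+ 2 = 4 * B ^+ 2 by ring.
  lra.
have hs2 : `|h ^+ 2| <= h ^+ 2 by rewrite ger0_norm ?sqr_ge0.
set K1 := `|kap / 2| * (B ^+ 2 + B ^+ 2) + `|2^-1| * (B ^+ 2 + B ^+ 2).
set K2 := m.+1%:R * D ^+ m * (B ^+ 2 + B ^+ 2); set K3 := `|eps| * Psi * (B * B + B * B).
have -> : (K1 + (c * (Cn * G ^+ 2) + c * K2) + K3) * h ^+ 2 =
  K1 * h ^+ 2 + (c * (Cn * G ^+ 2 * h ^+ 2) + c * K2 * h ^+ 2) + K3 * h ^+ 2 by ring.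
have cc0 : `|c| <= c by rewrite ger0_norm.
have mm : `|m.+1%:R : R| <= m.+1%:R by rewrite normr_nat.
apply: normD_le; first apply: normD_le.
- by apply: normM_le => //; rewrite /K1; nb.
- apply: normD_le; first exact: normM_le.
  by apply: normM_le => //; apply: normM_le => //; rewrite /K2; nb.
- by apply: normM_le => //; rewrite /K3; nb.
Qed.

(** Increments are only known up to an error h eta. That error is moved into the direction, of size
    B + 1 at most, so that Taylor's formula applies exactly and linearity of [dldens] isolates its
    effect. The bound is uniform in x so that it can be integrated. *)
Lemma ldens_expand (kap eps B : R) : 0 <= B -> exists2 C : R, 0 <= C &
  forall (h eta x r r1 s s1 al al1 be be1 p p1 q q1 : R), 0 < h <= 1 -> 0 <= eta <= 1 ->
    `|r| <= B -> `|r1| <= B -> `|s| <= B -> `|s1| <= B ->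
    `|al| <= B -> `|al1| <= B -> `|be| <= B -> `|be1| <= B ->
    `|p - r - h * al| <= h * eta -> `|p1 - r1 - h * al1| <= h * eta ->
    `|q - s - h * be| <= h * eta -> `|q1 - s1 - h * be1| <= h * eta ->
    `|ldens psi m kap eps x p p1 q q1 - ldens psi m kap eps x r r1 s s1
       - h * dldens psi m kap eps x r r1 s s1 al al1 be be1| <= C * h * (h + eta).
Proof.
move=> B0; have B1 : 0 <= B + 1 by rewrite addr_ge0.
have [C1 C10 H1] := ldens_taylor kap eps B1.
have [C2 C20 H2] := dldens_bound kap eps B0.
exists (C1 + C2); first exact: addr_ge0.
move=> h eta x r r1 s s1 al al1 be be1 p p1 q q1 /andP[h0 h1] /andP[e0 e1].
move=> hr hr1 hs hs1 hal hal1 hbe hbe1 hp hp1 hq hq1.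
have W (y z w : R) : `|y| <= B -> `|z| <= B -> `|w - y - h * z| <= h * eta ->
    exists2 d, w = y + h * (z + d) & `|d| <= eta /\ `|z + d| <= B + 1.
  move=> hy hz hw; exists ((w - y - h * z) / h); first by field; rewrite gt_eqF.
  have hd : `|(w - y - h * z) / h| <= eta.
    by rewrite normrM (@gtr0_norm _ h^-1) ?invr_gt0 // ler_pdivrMr // [leRHS]mulrC.
  by split => //; apply: normD_le => //; exact: le_trans hd e1.
have [d -> [hd hd']] := W _ _ _ hr hal hp; have [d1 -> [hd1 hd1']] := W _ _ _ hr1 hal1 hp1.
have [f -> [hf hf']] := W _ _ _ hs hbe hq; have [f1 -> [hf1 hf1']] := W _ _ _ hs1 hbe1 hq1.
have BB (y : R) : `|y| <= B -> `|y| <= B + 1 by move/le_trans; apply; rewrite lerDl.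
have h01 : 0 <= h <= 1 by rewrite (ltW h0).
have T1 := H1 h x r r1 s s1 _ _ _ _ h01 (BB _ hr) (BB _ hr1) (BB _ hs) (BB _ hs1) hd' hd1' hf' hf1'.
have T2 := H2 eta x r r1 s s1 _ _ _ _ hr hr1 hs hs1 hd hd1 hf hf1.
have e : dldens psi m kap eps x r r1 s s1 (al + d) (al1 + d1) (be + f) (be1 + f1) =
  dldens psi m kap eps x r r1 s s1 al al1 be be1 + dldens psi m kap eps x r r1 s s1 d d1 f f1.
  by rewrite /dldens; ring.
rewrite e in T1.
set L1 := ldens _ _ _ _ _ (r + _) _ _ _ in T1 *; set L0 := ldens _ _ _ _ _ _ _ _ _ in T1 *.
set D1 := dldens _ _ _ _ _ _ _ _ _ al _ _ _ in T1 *; set D2 := dldens _ _ _ _ _ _ _ _ _ _ _ _ _ in T1 T2 *.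
have -> : L1 - L0 - h * D1 = (L1 - L0 - h * (D1 + D2)) + h * D2 by ring.
apply: (@le_trans _ _ (C1 * h ^+ 2 + h * (C2 * eta))).
  apply: normD_le => //; apply: normM_le => //; by rewrite gtr0_norm.
have -> : (C1 + C2) * h * (h + eta) = C1 * h ^+ 2 + h * (C2 * eta) + (C1 * (h * eta) + C2 * (h * h)) by ring.
by rewrite lerDl addr_ge0 // mulr_ge0 // mulr_ge0 // ltW.
Qed.

End Expansion.

(** * One-sided differential inequalities *)

Section Dini.
Context {R : realType}.

(** A mean value inequality for functions controlled only by their increments to the right; a
    supremum argument replaces the mean value theorem. *)
Lemma dini_le (f : R -> R) (c t0 t1 : R) : t0 <= t1 -> continuous f ->
  (forall s, t0 <= s < t1 -> forall eta : R, 0 < eta -> exists2 h0 : R, 0 < h0 &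
     forall h, 0 < h < h0 -> f (s + h) <= f s + h * (c + eta)) ->
  f t1 <= f t0 + (t1 - t0) * c.
Proof.
move=> t01 cf H.
suff K (eta : R) : 0 < eta -> f t1 <= f t0 + (t1 - t0) * (c + eta).
  have [->|t10] := eqVneq t1 t0; first by rewrite subrr mul0r addr0.
  have d0 : 0 < t1 - t0 by rewrite subr_gt0 lt_neqAle eq_sym t10.
  apply/ler_addgt0Pr => e e0; have := K (e / (t1 - t0)) (divr_gt0 e0 d0).
  by rewrite mulrDr mulrC -[in X in _ + X](mulrC (e / _)) divfK ?gt_eqF // addrA mulrC.
move=> eta0.
pose g s := f s - s * (c + eta).
have cg : continuous g.
  by move=> x; apply: cvgB; [exact: cf | apply: cvgM; [exact: cvg_id | exact: cvg_cst]].
suff : g t1 <= g t0 by rewrite /g; lra.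
(* By continuity the supremum of S satisfies the bound; if it were below t1, one more increment to
   the right would exceed it. *)
pose S := [set s | t0 <= s <= t1 /\ g s <= g t0].
have S0 : S t0 by split; rewrite ?lexx.
have hS : has_sup S by split; [exists t0 | exists t1 => s [/andP[]]].
pose tau := sup S.
have tau0 : t0 <= tau by exact: ub_le_sup hS.2 _ S0.
have tau1 : tau <= t1 by apply: ge_sup; [exists t0 | move=> s [/andP[]]].
have gtau : g tau <= g t0.
  rewrite leNgt; apply/negP => lt.
  have e0 : 0 < g tau - g t0 by rewrite subr_gt0.
  have := cg tau; move/cvgrPdist_lt => /(_ _ e0) [d /= d0 hd].
  have [s Ss hs] := sup_adherent d0 hS.
  have st : s <= tau by exact: ub_le_sup hS.2 _ Ss.
  have := hd s; rewrite /= ger0_norm ?subr_ge0 // => /(_ _).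
  have : tau - s < d by rewrite -/tau in hs; lra.
  move=> h1 /(_ h1) /(le_lt_trans (ler_norm _)).
  by have := Ss.2; lra.
have [->//|tt] := eqVneq t1 tau.
have tlt : tau < t1 by rewrite lt_neqAle eq_sym tt.
have [|h0 h00 hh] := H tau _ eta eta0; first by rewrite tau0.
pose h := Num.min (h0 / 2) (t1 - tau).
have hp : 0 < h by rewrite lt_min divr_gt0 // subr_gt0.
have hl : h < h0 by rewrite (le_lt_trans (_ : _ <= h0 / 2)) ?ge_min ?lexx //; lra.
have hl1 : h <= t1 - tau by rewrite ge_min lexx orbT.
have : S (tau + h).
  split; first by apply/andP; split; lra.
  by have := hh h; rewrite hp hl => /(_ isT); move: gtau; rewrite /g; lra.
by move=> /(ub_le_sup hS.2); rewrite -/tau; lra.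
Qed.

(** [y] times e^(delta t) has nonpositive upper right slope, because (1 - delta h) e^(delta h) <=
    1. *)
Lemma dini_decay (y : R -> R) (delta : R) : 0 < delta -> continuous y -> (forall t, 0 <= y t) ->
  (forall t, 0 <= t -> forall eta : R, 0 < eta -> exists2 h0 : R, 0 < h0 &
     forall h, 0 < h < h0 -> y (t + h) <= y t + h * (eta - delta * y t)) ->
  forall t, 0 <= t -> y t <= y 0 * expR (- delta * t).
Proof.
move=> d0 cy y0 H t t0.
have cf : continuous (fun s => y s * expR (delta * s)).
  move=> x; apply: cvgM; first exact: cy.
  apply: (@continuous_comp _ _ _ (fun s : R => delta * s) expR); last exact: continuous_expR.
  exact: mulrl_continuous.
have K := @dini_le _ 0 0 t t0 cf.
rewrite /= !mulr0 expR0 mulr1 addr0 in K.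
rewrite mulNr expRN ler_pdivlMr ?expR_gt0 //; apply: K => s /andP[s0 _] eta eta0.
(* The tolerance is scaled so that, after multiplication by e^(delta (s + h)) with h < 1, the error
   is still at most h eta. *)
have e0 : 0 < eta * expR (- (delta * (s + 1))) by rewrite mulr_gt0 ?expR_gt0.
have [h0 h00 hh] := H s s0 _ e0.
exists (Num.min 1 h0); first by rewrite lt_min ltr01.
move=> h /andP[hp]; rewrite lt_min => /andP[h1 hlt].
have := hh h; rewrite hp hlt => /(_ isT) hy.
rewrite add0r mulrDr expRD.
have E0 := expR_gt0 (delta * s); have E1 := expR_gt0 (delta * h).
have := ler_wpM2r (ltW (mulr_gt0 E0 E1)) hy.
move/le_trans; apply.
have k1 : (1 - delta * h) * expR (delta * h) <= 1.
  have := @expR_ge1Dx R (- (delta * h)); rewrite expRN => k.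
  by rewrite -ler_pdivlMr // div1r.
have k2 : h * (eta * expR (- (delta * (s + 1)))) * (expR (delta * s) * expR (delta * h)) <= h * eta.
  rewrite -!mulrA ler_wpM2l ?(ltW hp) // -[leRHS]mulr1 ler_wpM2l ?(ltW eta0) //.
  rewrite -!expRD -[leRHS]expR0 ler_expR.
  have := ler_wpM2l (ltW d0) (ltW h1); lra.
have k3 := ler_wpM2l (mulr_ge0 (y0 s) (ltW E0)) k1.
rewrite mulr1 in k3.
have -> : (y s + h * (eta * expR (- (delta * (s + 1))) - delta * y s)) * (expR (delta * s) * expR (delta * h)) =
  y s * expR (delta * s) * ((1 - delta * h) * expR (delta * h)) +
  h * (eta * expR (- (delta * (s + 1)))) * (expR (delta * s) * expR (delta * h)) by ring.
exact: lerD.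
Qed.

End Dini.

Section Synthesis.
Context {R : realType}.
Implicit Types (c d : nat -> R).

(** Coefficients are arbitrary because the time derivative of a projected curve is known only
    through its coefficients. *)
Definition syn N c d : R -> R :=
  fun x => \sum_(k < N) fw k * (c k * cc k x + d k * ss k x).

Lemma syn_pC1 N c d : pC1 (syn N c d) (syn N (fun k => k%:R * d k) (fun k => - (k%:R * c k))).
Proof.
apply: pC1_sum => k.
apply: (pC1_eq (pC1Z (fw k) (pC1D (pC1Z (c k) (cc_pC1 k)) (pC1Z (d k) (ss_pC1 k))))).
by move=> x /=; ring.
Qed.

Lemma fproj_syn N f : fproj N f = syn N (fun k => ip f (cc k)) (fun k => ip f (ss k)).
Proof. by []. Qed.

Definition Csyn N : R := \sum_(k < N) fw k * 2.

Lemma Csyn_ge0 N : 0 <= Csyn N.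
Proof. by apply: sumr_ge0 => k _; rewrite mulr_ge0 // ltW // fw_gt0. Qed.

Lemma syn_bound N c d (e : R) : (forall k, (k < N)%N -> `|c k| <= e) ->
  (forall k, (k < N)%N -> `|d k| <= e) -> forall x, `|syn N c d x| <= Csyn N * e.
Proof.
move=> hc hd x; rewrite /syn /Csyn mulr_suml; apply: (le_trans (ler_norm_sum _ _ _)).
apply: ler_sum => k _; rewrite normrM gtr0_norm ?fw_gt0 // -mulrA ler_wpM2l ?(ltW (fw_gt0 k)) //.
have h1 : `|cc k x| <= 1 by exact: cos_max.
have h2 : `|ss k x| <= 1 by exact: sin_max.
have := normD_le (normM_le (hc k (ltn_ord k)) h1) (normM_le (hd k (ltn_ord k)) h2).
by rewrite !mulr1 mulr_natl mulr2n.
Qed.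

End Synthesis.

Section MoreConvergence.
Context {R : realType} {I : Type} {F : set_system I} {FF : Filter F}.
Implicit Types (f g h : R -> R) (v u : I -> R -> R).

Lemma lcvB v f u g : lcv (F := F) v f -> lcv (F := F) u g -> lcv (F := F) (fun i => v i \- u i) (f \- g).
Proof.
move=> hv hu.
have : lcv (F := F) (fun i => v i \+ (-1 \*o u i)) (f \+ (-1 \*o g)).
  by apply: lcvD => //; exact: lcvZ.
have -> : f \+ (-1 \*o g) = f \- g by apply/funext => x /=; rewrite mulN1r.
have -> // : (fun i => v i \+ (-1 \*o u i)) = (fun i => v i \- u i).
by apply/funext => i; apply/funext => x /=; rewrite mulN1r.
Qed.

Lemma ucvB v f u g : ucv (F := F) v f -> ucv (F := F) u g -> ucv (F := F) (fun i => v i \- u i) (f \- g).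
Proof.
move=> hv hu.
have : ucv (F := F) (fun i => v i \+ (-1 \*o u i)) (f \+ (-1 \*o g)).
  by apply: ucvD => //; exact: ucvZ.
have -> : f \+ (-1 \*o g) = f \- g by apply/funext => x /=; rewrite mulN1r.
have -> // : (fun i => v i \+ (-1 \*o u i)) = (fun i => v i \- u i).
by apply/funext => i; apply/funext => x /=; rewrite mulN1r.
Qed.

End MoreConvergence.

Section WeakLimit.
Context {R : realType}.

Lemma wdF_lim (v v' : nat -> R -> R) (f f' : R -> R) : (forall n, pC1 (v n) (v' n)) ->
  lcv (F := \oo) v f -> lcv (F := \oo) v' f' -> wdF f f'.
Proof.
move=> hv c c'.
have uq (u : nat -> R) (x y : R) : u n @[n --> \oo] --> x -> u n @[n --> \oo] --> y -> x = y.
  move=> c1 c2; have e1 := cvg_lim (@Rhausdorff R) c1; have e2 := cvg_lim (@Rhausdorff R) c2.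
  by rewrite -e1 -e2.
have cI g (u : nat -> R -> R) h : lcv (F := \oo) u g -> l2 h -> ip (u n) h @[n --> \oo] --> ip g h.
  by move=> cu lh; apply: ip_lcv => //; exact: lcv_cst.
split; [exact: lcv_lim c | exact: lcv_lim c' | |] => k.
- apply: (uq _ _ _ (cI _ _ _ c' (cc_l2 k))).
  under eq_fun do rewrite (wdF_cc (pC1_wdF (hv _))).
  by apply: cvgM; [exact: cvg_cst | exact: cI].
- apply: (uq _ _ _ (cI _ _ _ c' (ss_l2 k))).
  under eq_fun do rewrite (wdF_ss (pC1_wdF (hv _))).
  by apply: cvgN; apply: cvgM; [exact: cvg_cst | exact: cI].
Qed.

End WeakLimit.

Section IntegralCalculus.
Context {R : realType}.
Implicit Types (f g : R -> R).

(** Integrability and value travel together, so that the integral of a long expression is assembled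
    following its syntax. *)
Definition tI f (c : R) := intg f /\ torus_int f = c.

Lemma tI_D f g c d : tI f c -> tI g d -> tI (fun x => f x + g x) (c + d).
Proof. by move=> [h1 <-] [h2 <-]; split; [exact: intgD | exact: tintD]. Qed.

Lemma tI_Z k f c : tI f c -> tI (fun x => k * f x) (k * c).
Proof. by move=> [h1 <-]; split; [exact: intgZ | exact: tintZ]. Qed.

Lemma tI_ip f g : l2 f -> l2 g -> tI (fun x => f x * g x) (ip f g).
Proof. by move=> h1 h2; split; [exact: l2M_intg | rewrite ipE]. Qed.

Lemma tI_eq f g c : tI f c -> f =1 g -> tI g c.
Proof. by move=> h /funext <-. Qed.

End IntegralCalculus.

(** * The zeroth-order terms and the Lyapunov functional, with continuity *)

Section Nonlinear.
Context {R : realType}.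
Variables (a a1 psi : R -> R) (lam kap eps : R) (m : nat).
Hypotheses (ha : pC1 a a1) (hpsi : pC1 psi (fun x => 1 - lam * a x)).
Implicit Types (r s : R -> R).

(** For v = r + i s the real and imaginary parts of a v + i |v|^(2m) v are [gn r s] and
    [gn s (\- r)], so one function serves both components. *)
Definition gn r s : R -> R := (a \* r) \- ((fun x => rho2 (r x) (s x) ^+ m) \* s).
Definition gn1 r (r1 : R -> R) s (s1 : R -> R) : R -> R :=
  ((a1 \* r) \+ (a \* r1)) \-
  (((((2 * m%:R) \*o (fun x => rho2 (r x) (s x) ^+ m.-1)) \* s) \* ((r \* r1) \+ (s \* s1)))
    \+ ((fun x => rho2 (r x) (s x) ^+ m) \* s1)).

Lemma gn_pC1 r (r1 : R -> R) s (s1 : R -> R) : pC1 r r1 -> pC1 s s1 -> pC1 (gn r s) (gn1 r r1 s s1).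
Proof.
move=> hr hs.
have hrho : pC1 (fun x => rho2 (r x) (s x)) (fun x => 2 * (r x * r1 x + s x * s1 x)).
  by rewrite /rho2; apply: pC1_eq; [pc1 | move=> x /=; ring].
apply: (pC1_eq (pC1B (pC1M ha hr) (pC1M (pC1X m hrho) hs))) => x /=.
by rewrite /gn1 /=; ring.
Qed.

Section Cvg.
Context {I : Type} {F : set_system I} {FF : Filter F}.
Variables (vr vs vr1 vs1 : I -> R -> R) (r s r1 s1 : R -> R).
Hypotheses (cr : ucv (F := F) vr r) (cs : ucv (F := F) vs s)
  (cr1 : lcv (F := F) vr1 r1) (cs1 : lcv (F := F) vs1 s1).

Lemma rho_ucv : ucv (F := F) (fun i x => rho2 (vr i x) (vs i x)) (fun x => rho2 (r x) (s x)).
Proof. exact: (ucvD (ucvX 2 cr) (ucvX 2 cs)). Qed.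

Lemma gn_ucv : ucv (F := F) (fun i => gn (vr i) (vs i)) (gn r s).
Proof. exact: (ucvB (ucvM (ucv_cst (pC1_pC ha)) cr) (ucvM (ucvX m rho_ucv) cs)). Qed.

Lemma gn1_lcv : lcv (F := F) (fun i => gn1 (vr i) (vr1 i) (vs i) (vs1 i)) (gn1 r r1 s s1).
Proof.
apply: lcvB.
- apply: lcvD; first exact: ucv_lcv (ucvM (ucv_cst (pC1_pC' ha)) cr).
  exact: ulcvM (ucv_cst (pC1_pC ha)) cr1.
- apply: lcvD; last exact: ulcvM (ucvX m rho_ucv) cs1.
  apply: ulcvM; first exact: ucvM (ucvZ _ (ucvX m.-1 rho_ucv)) cs.
  by apply: lcvD; exact: ulcvM.
Qed.

(** The integral of [ldens] rewritten with inner products: it then makes sense for derivatives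
    merely in L^2, and [ip_lcv] gives its continuity. *)
Definition lfun r (r1 : R -> R) s (s1 : R -> R) : R :=
  kap / 2 * (ip r r + ip s s) + 2^-1 * (ip r1 r1 + ip s1 s1)
  + (2 * m + 2)%:R^-1 * ip (fun x => rho2 (r x) (s x) ^+ m.+1) (fun=> 1)
  + (- eps) * (ip (psi \* r) s1 + (-1) * ip (psi \* s) r1).

Lemma lfun_cvg : lfun (vr i) (vr1 i) (vs i) (vs1 i) @[i --> F] --> lfun r r1 s s1.
Proof.
have cpsi : ucv (F := F) (fun=> psi) psi by exact: ucv_cst (pC1_pC hpsi).
have ll : lcv (F := F) (fun (_ : I) (_ : R) => 1) (fun _ : R => 1) by exact: lcv_cst (l2_cst 1).
have lr : lcv (F := F) vr r by exact: ucv_lcv.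
have ls : lcv (F := F) vs s by exact: ucv_lcv.
apply: cvgD; last first.
  apply: cvgM; first exact: cvg_cst.
  apply: cvgD; first by apply: ip_lcv => //; exact: ucv_lcv (ucvM cpsi cr).
  by apply: cvgM; [exact: cvg_cst | apply: ip_lcv => //; exact: ucv_lcv (ucvM cpsi cs)].
apply: cvgD; last first.
  apply: cvgM; first exact: cvg_cst.
  by apply: ip_lcv => //; exact: ucv_lcv (ucvX m.+1 rho_ucv).
by apply: cvgD; (apply: cvgM; first exact: cvg_cst); apply: cvgD; exact: ip_lcv.
Qed.

Definition efun r (r1 : R -> R) s (s1 : R -> R) (e e1 f f1 : R -> R) : R :=
  kap * (ip r e + ip s f) + (ip r1 e1 + ip s1 f1)
  + (ip ((fun x => rho2 (r x) (s x) ^+ m) \* r) e + ip ((fun x => rho2 (r x) (s x) ^+ m) \* s) f)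
  + eps * (ip ((fun x => 1 - lam * a x) \* r) f + (-1) * ip ((fun x => 1 - lam * a x) \* s) e
     + 2 * (ip (psi \* r1) f + (-1) * ip (psi \* s1) e)).

Lemma efun_cvg0 (e e1 f f1 : I -> R -> R) :
  lcv (F := F) e (fun=> 0) -> lcv (F := F) e1 (fun=> 0) -> lcv (F := F) f (fun=> 0) -> lcv (F := F) f1 (fun=> 0) ->
  efun (vr i) (vr1 i) (vs i) (vs1 i) (e i) (e1 i) (f i) (f1 i) @[i --> F] --> (0 : R).
Proof.
move=> he he1 hf hf1.
have z g : ip g (fun=> 0) = 0 :> R by rewrite ipC ip0l.
have -> : (0 : R) = efun r r1 s s1 (fun=> 0) (fun=> 0) (fun=> 0) (fun=> 0) by rewrite /efun !z; ring.
have cpsi : ucv (F := F) (fun=> psi) psi by exact: ucv_cst (pC1_pC hpsi).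
have cp : ucv (F := F) (fun=> fun x => 1 - lam * a x) (fun x => 1 - lam * a x) by exact: ucv_cst (pC1_pC' hpsi).
have hq : ucv (F := F) (fun i x => rho2 (vr i x) (vs i x) ^+ m) (fun x => rho2 (r x) (s x) ^+ m) by apply: (ucvX m); exact: rho_ucv.
have lr : lcv (F := F) vr r by exact: ucv_lcv.
have ls : lcv (F := F) vs s by exact: ucv_lcv.
apply: cvgD; first apply: cvgD; first apply: cvgD.
- by apply: cvgM; [exact: cvg_cst | apply: cvgD; exact: ip_lcv].
- by apply: cvgD; exact: ip_lcv.
- by apply: cvgD; apply: ip_lcv => //; apply: ucv_lcv; exact: ucvM.
- apply: cvgM; first exact: cvg_cst.
  apply: cvgD; first apply: cvgD.
  + by apply: ip_lcv => //; apply: ucv_lcv; exact: ucvM.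
  + by apply: cvgM; [exact: cvg_cst | apply: ip_lcv => //; apply: ucv_lcv; exact: ucvM].
  + apply: cvgM; first exact: cvg_cst.
    apply: cvgD; first by apply: ip_lcv => //; exact: ulcvM.
    by apply: cvgM; [exact: cvg_cst | apply: ip_lcv => //; exact: ulcvM].
Qed.

End Cvg.

Lemma tint_ldens r (r1 : R -> R) s (s1 : R -> R) : pC r -> l2 r1 -> pC s -> l2 s1 ->
  tI (fun x => ldens psi m kap eps x (r x) (r1 x) (s x) (s1 x)) (lfun r r1 s s1).
Proof.
move=> hr hr1 hs hs1.
have hp := pC1_pC hpsi.
have lr := pC_l2 hr; have ls := pC_l2 hs.
have lpr := pC_l2 (pCM hp hr); have lps := pC_l2 (pCM hp hs).
have lq : l2 (fun x => rho2 (r x) (s x) ^+ m.+1) by apply: pC_l2; rewrite /rho2; pc.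
apply: (tI_eq (tI_D (tI_D (tI_D
   (tI_Z (kap / 2) (tI_D (tI_ip lr lr) (tI_ip ls ls)))
   (tI_Z 2^-1 (tI_D (tI_ip hr1 hr1) (tI_ip hs1 hs1))))
   (tI_Z (2 * m + 2)%:R^-1 (tI_ip lq (l2_cst 1))))
   (tI_Z (- eps) (tI_D (tI_ip lpr hs1) (tI_Z (-1) (tI_ip lps hr1)))))) => x /=.
by rewrite /ldens; set q := _ ^+ m.+1; rewrite /rho2; ring.
Qed.

Lemma tint_derr r (r1 : R -> R) s (s1 : R -> R) (e e1 f f1 : R -> R) : pC r -> l2 r1 -> pC s -> l2 s1 ->
  l2 e -> l2 e1 -> l2 f -> l2 f1 ->
  tI (fun x => derr a psi lam m kap eps x (r x) (r1 x) (s x) (s1 x) (e x) (e1 x) (f x) (f1 x))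
    (efun r r1 s s1 e e1 f f1).
Proof.
move=> hr hr1 hs hs1 he he1 hf hf1.
have hp := pC1_pC hpsi; have hp1 := pC1_pC' hpsi.
have lr := pC_l2 hr; have ls := pC_l2 hs.
have hq : pC (fun x => rho2 (r x) (s x) ^+ m) by rewrite /rho2; pc.
have lqr := pC_l2 (pCM hq hr); have lqs := pC_l2 (pCM hq hs).
have lpr := pC_l2 (pCM hp1 hr); have lps := pC_l2 (pCM hp1 hs).
have lpr1 := pCl2_l2 hp hr1; have lps1 := pCl2_l2 hp hs1.
apply: (tI_eq (tI_D (tI_D (tI_D
   (tI_Z kap (tI_D (tI_ip lr he) (tI_ip ls hf)))
   (tI_D (tI_ip hr1 he1) (tI_ip hs1 hf1)))
   (tI_D (tI_ip lqr he) (tI_ip lqs hf)))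
   (tI_Z eps (tI_D (tI_D (tI_ip lpr hf) (tI_Z (-1) (tI_ip lps he)))
      (tI_Z 2 (tI_D (tI_ip lpr1 hf) (tI_Z (-1) (tI_ip lps1 he)))))))) => x /=.
by rewrite /derr; set q := _ ^+ m; ring.
Qed.

End Nonlinear.

(** * Decay along curves solving the equation weakly *)

Section Curves.
Context {R : realType}.

Lemma near_right_ex (P : R -> Prop) : (\forall h \near (0 : R)^'+, P h) ->
  exists2 h0 : R, 0 < h0 & forall h, 0 < h < h0 -> P h.
Proof.
move=> [d /= d0 hd]; exists d => // h /andP[h0 hh]; apply: hd => //=.
by rewrite sub0r normrN gtr0_norm.
Qed.

Lemma near_forall_lt (T : Type) (F : set_system T) (FF : Filter F) (P : nat -> T -> Prop) N :
  (forall k, \forall i \near F, P k i) -> \forall i \near F, forall k, (k < N)%N -> P k i.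
Proof.
move=> H; elim: N => [|N ih]; first exact: nearW.
apply: filterS2 ih (H N) => i h1 h2 k; rewrite ltnS leq_eqVlt => /predU1P[->//|]; exact: h1.
Qed.

(* [u t] is the continuous representative of an H^1 function of weak derivative [u' t]. *)
Record curve (u u' : R -> R -> R) : Prop := Curve {
  cu_wd : forall t, wdF (u t) (u' t);
  cu_pC : forall t, pC (u t);
  cu_err : forall t N x, `|fproj N (u t) x - u t x| <= Csup * (fprojerr (u t) N + fprojerr (u' t) N);
  cu_cvg : forall t, n2 (u s \- u t) @[s --> t] --> (0 : R);
  cu_cvg' : forall t, n2 (u' s \- u' t) @[s --> t] --> (0 : R) }.

Variables (u u' : R -> R -> R).
Hypothesis cu : curve u u'.

Lemma curve_l2 t : l2 (u t). Proof. exact: wdF_l2 (cu_wd cu t). Qed.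
Lemma curve_l2' t : l2 (u' t). Proof. exact: wdF_l2' (cu_wd cu t). Qed.

Lemma curve_lcv' t : lcv (F := nbhs t) u' (u' t).
Proof. by split; [move=> s; exact: curve_l2' | exact: curve_l2' | exact: (cu_cvg' cu t)]. Qed.

Lemma curve_fproj_pC1 N t : pC1 (fproj N (u t)) (fproj N (u' t)).
Proof. exact: fproj_wdF_pC1 (cu_wd cu t). Qed.

Lemma cvg_Csup (T : Type) (F : set_system T) (FF : Filter F) (p q : T -> R) :
  p i @[i --> F] --> (0 : R) -> q i @[i --> F] --> (0 : R) -> Csup * (p i + q i) @[i --> F] --> (0 : R).
Proof.
move=> hp hq; rewrite -[0 in X in _ --> X](mulr0 Csup) -[0 in X in _ --> X](addr0 0).
by apply: cvgM; [exact: cvg_cst | exact: cvgD].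
Qed.

Lemma ucv_of_bound (T : Type) (F : set_system T) (FF : Filter F) (v : T -> R -> R) f (b : T -> R) :
  (forall i, pC (v i)) -> pC f -> (forall i x, `|v i x - f x| <= b i) -> b i @[i --> F] --> (0 : R) ->
  ucv (F := F) v f.
Proof.
move=> hv hf hb /cvgrPdist_le b0; split => // e e0; apply: filterS (b0 _ e0) => i hi x.
by apply: (le_trans (hb i x)); move: hi; rewrite sub0r normrN; apply: le_trans; exact: ler_norm.
Qed.

(** Projections contract the H^1 distance, so the bound does not depend on N; joint limits in N and
    s rest on this. *)
Lemma curve_fproj_diff N s t x : `|fproj N (u s) x - fproj N (u t) x| <=
  Csup * (n2 (u s \- u t) + n2 (u' s \- u' t)).
Proof.
have h := pC1_sup (fproj_wdF_pC1 N (wdFB (cu_wd cu s) (cu_wd cu t))) x.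
rewrite (fprojB N (curve_l2 s) (curve_l2 t)) in h; apply: (le_trans h).
apply: ler_wpM2l; first exact: Csup_ge0.
apply: lerD.
- by rewrite -(fprojB N (curve_l2 s) (curve_l2 t)); apply: n2_fproj; exact: l2B (curve_l2 s) (curve_l2 t).
- by apply: n2_fproj; exact: l2B (curve_l2' s) (curve_l2' t).
Qed.

Lemma curve_fproj_ucv N t : ucv (F := nbhs t) (fun s => fproj N (u s)) (fproj N (u t)).
Proof.
apply: (@ucv_of_bound _ _ _ _ _ (fun s => Csup * (n2 (u s \- u t) + n2 (u' s \- u' t)))).
- by move=> s; exact: fproj_pC.
- exact: fproj_pC.
- by move=> s x; exact: curve_fproj_diff.
- by apply: cvg_Csup; [exact: (cu_cvg cu t) | exact: (cu_cvg' cu t)].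
Qed.

Lemma curve_err_cvg t : Csup * (fprojerr (u t) N + fprojerr (u' t) N) @[N --> \oo] --> (0 : R).
Proof. by apply: cvg_Csup; apply: fproj_cvg; [exact: curve_l2 | exact: curve_l2']. Qed.

Lemma curve_ucv_oo t : ucv (F := \oo) (fun N => fproj N (u t)) (u t).
Proof.
apply: ucv_of_bound (curve_err_cvg t).
- by move=> N; exact: fproj_pC.
- exact: (cu_pC cu t).
- by move=> N x; exact: (cu_err cu t N x).
Qed.

Lemma curve_ucv_pair t :
  ucv (F := filter_prod \oo (nbhs t)) (fun Ni => fproj Ni.1 (u Ni.2)) (u t).
Proof.
apply: (@ucv_of_bound _ _ _ _ _ (fun Ni => Csup * (n2 (u Ni.2 \- u t) + n2 (u' Ni.2 \- u' t)) +
   Csup * (fprojerr (u t) Ni.1 + fprojerr (u' t) Ni.1))).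
- by move=> Ni; exact: fproj_pC.
- exact: (cu_pC cu t).
- move=> [N s] x /=.
  have -> : fproj N (u s) x - u t x = (fproj N (u s) x - fproj N (u t) x) + (fproj N (u t) x - u t x) by ring.
  by apply: normD_le; [exact: curve_fproj_diff | exact: (cu_err cu t N x)].
- rewrite -[0 in X in _ --> X](addr0 0); apply: cvgD.
    have c0 : Csup * (n2 (u s \- u t) + n2 (u' s \- u' t)) @[s --> t] --> (0 : R).
      by apply: cvg_Csup; [exact: (cu_cvg cu t) | exact: (cu_cvg' cu t)].
    exact: (cvg_comp _ _ cvg_snd c0).
  exact: (cvg_comp _ _ cvg_fst (curve_err_cvg t)).
Qed.

Lemma curve_ucv t : ucv (F := nbhs t) u (u t).
Proof.
apply: (@ucv_of_bound _ _ _ _ _ (fun s => Csup * (n2 (u s \- u t) + n2 (u' s \- u' t)))).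
- by move=> s; exact: (cu_pC cu s).
- exact: (cu_pC cu t).
- move=> s x.
  have cx y : fproj N (u y) x @[N --> \oo] --> u y x.
    apply/cvgrPdist_le => e e0; apply: filterS (ucv_cvg (curve_ucv_oo y) e0) => N /(_ x).
    by rewrite distrC.
  have c : `|fproj N (u s) x - fproj N (u t) x| @[N --> \oo] --> `|u s x - u t x|.
    by apply: cvg_norm; apply: cvgB; exact: cx.
  by apply: (cvgr_to_le c); apply: nearW => N; exact: curve_fproj_diff.
- by apply: cvg_Csup; [exact: (cu_cvg cu t) | exact: (cu_cvg' cu t)].
Qed.

Lemma curve_lcv_pair' t :
  lcv (F := filter_prod \oo (nbhs t)) (fun Ni => fproj Ni.1 (u' Ni.2)) (u' t).
Proof. exact: lcv_fproj_pair (curve_lcv' t). Qed.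

Lemma fproj'_syn N (f : R -> R) : fproj' N f = syn N (fun k => k%:R * ip f (ss k)) (fun k => - (k%:R * ip f (cc k))).
Proof. by apply/funext => x; apply: eq_bigr => k _; rewrite /fterm'; ring. Qed.

Lemma curve_fproj'_coef N t : fproj' N (u' t) =
  syn N (fun k => - (k%:R ^+ 2 * ip (u t) (cc k))) (fun k => - (k%:R ^+ 2 * ip (u t) (ss k))).
Proof.
rewrite fproj'_syn; apply/funext => x; apply: eq_bigr => k _.
by rewrite (wdF_ss (cu_wd cu t)) (wdF_cc (cu_wd cu t)); ring.
Qed.

(** Only finitely many modes k < N enter, so the expansions of single coefficients add up uniformly
    in x; the space derivative costs one more factor k. *)
Lemma curve_fproj_expand N t (c d : nat -> R) :
  (forall k (eta : R), 0 < eta -> \forall h \near (0 : R)^'+,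
     `|ip (u (t + h)) (cc k) - ip (u t) (cc k) - h * c k| <= h * eta) ->
  (forall k (eta : R), 0 < eta -> \forall h \near (0 : R)^'+,
     `|ip (u (t + h)) (ss k) - ip (u t) (ss k) - h * d k| <= h * eta) ->
  forall eta : R, 0 < eta -> \forall h \near (0 : R)^'+,
    (forall x, `|fproj N (u (t + h)) x - fproj N (u t) x - h * syn N c d x| <= h * eta) /\
    (forall x, `|fproj N (u' (t + h)) x - fproj N (u' t) x -
        h * syn N (fun k => k%:R * d k) (fun k => - (k%:R * c k)) x| <= h * eta).
Proof.
move=> Hc Hd eta eta0.
have K0 : 0 < Csyn N * (N%:R + 1) + 1 :> R by rewrite ltr_wpDl // mulr_ge0 ?Csyn_ge0 // addr_ge0.
(* Tolerance per coefficient, small against the number of modes and the factor k; N is fixed while h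
   tends to 0. *)
pose e1 : R := eta / (Csyn N * (N%:R + 1) + 1).
have e10 : 0 < e1 by rewrite divr_gt0.
have hK : Csyn N * (N%:R + 1) * e1 <= eta.
  rewrite /e1 mulrCA ler_piMr ?(ltW eta0) // ler_pdivrMr // mul1r lerDl //.
near=> h.
have h0 : 0 < h by near: h; exact: nbhs_right_gt.
have hc : forall k, (k < N)%N -> `|ip (u (t + h)) (cc k) - ip (u t) (cc k) - h * c k| <= h * e1.
  by near: h; apply: near_forall_lt => k; exact: Hc.
have hd : forall k, (k < N)%N -> `|ip (u (t + h)) (ss k) - ip (u t) (ss k) - h * d k| <= h * e1.
  by near: h; apply: near_forall_lt => k; exact: Hd.
have he : 0 <= h * e1 by rewrite mulr_ge0 // ltW.
have C0 := @Csyn_ge0 R N.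
have fin : Csyn N * ((N%:R + 1) * (h * e1)) <= h * eta.
  have -> : Csyn N * ((N%:R + 1) * (h * e1)) = h * (Csyn N * (N%:R + 1) * e1) by ring.
  by rewrite ler_wpM2l // ltW.
have fin1 : Csyn N * (h * e1) <= h * eta.
  apply: le_trans fin; rewrite ler_wpM2l // ler_peMl // lerDr //.
split => x.
- have -> : fproj N (u (t + h)) x - fproj N (u t) x - h * syn N c d x =
    syn N (fun k => ip (u (t + h)) (cc k) - ip (u t) (cc k) - h * c k)
          (fun k => ip (u (t + h)) (ss k) - ip (u t) (ss k) - h * d k) x.
    rewrite !fproj_syn /syn mulr_sumr -!sumrB; apply: eq_bigr => k _; ring.
  exact: le_trans (syn_bound hc hd x) fin1.
- have -> : fproj N (u' (t + h)) x - fproj N (u' t) x - h * syn N (fun k => k%:R * d k) (fun k => - (k%:R * c k)) x =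
    syn N (fun k => k%:R * (ip (u (t + h)) (ss k) - ip (u t) (ss k) - h * d k))
          (fun k => - k%:R * (ip (u (t + h)) (cc k) - ip (u t) (cc k) - h * c k)) x.
    rewrite !fproj_syn /syn mulr_sumr -!sumrB; apply: eq_bigr => k _.
    rewrite !(wdF_ss (cu_wd cu _)) !(wdF_cc (cu_wd cu _)); ring.
  have kN k : (k < N)%N -> `|k%:R : R| <= N%:R + 1.
    by move=> kN; rewrite normr_nat natr1 ler_nat; exact: leqW (ltnW kN).
  apply: le_trans fin; apply: syn_bound => k kk.
    by apply: normM_le; [exact: kN | exact: hd].
  by apply: normM_le; [rewrite normrN; exact: kN | exact: hc].
Unshelve. all: by end_near.
Qed.

End Curves.

Lemma increment_le (R : realType) (h eta x1 x0 d q w : R) :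
  x1 - x0 - h * d <= q -> q <= h * eta -> h * d <= h * w -> x1 <= x0 + h * (w + eta).
Proof. lra. Qed.

Lemma dist_le_add (R : realType) (x y c : R) : `|y - x| <= c -> x <= y + c.
Proof. by rewrite ler_norml => /andP[]; lra. Qed.

Lemma half_shift_le (R : realType) (d l eta : R) : 0 < eta ->
  - d * l + eta / 2 <= eta - d * l.
Proof. lra. Qed.

Section CurveDecay.
Context {R : realType}.
Variables (a a1 psi : R -> R) (lam kap eps delta Psi : R) (m : nat).
Hypotheses (ha : pC1 a a1) (hpsi : pC1 psi (fun x => 1 - lam * a x))
  (psi_le : forall x, `|psi x| <= Psi) (m_gt0 : (0 < m)%N) (delta_gt0 : 0 < delta).
Hypothesis ldens_ge0 : forall x r r1 s s1, 0 <= ldens psi m kap eps x r r1 s s1.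
Hypothesis diss_delta : forall r r1 s s1 : R -> R, pC1 r r1 -> pC1 s s1 ->
    torus_int (fun x => diss a a1 psi lam m kap eps x (r x) (r1 x) (s x) (s1 x)) <=
    - delta * torus_int (fun x => ldens psi m kap eps x (r x) (r1 x) (s x) (s1 x)).
Variables (r r' s s' : R -> R -> R).
Hypotheses (cr : curve r r') (cs : curve s s').

(* The equation, written for the real and imaginary parts:
   r_t = - s_xx - g1 and s_t = r_xx - g2. *)
Let g1 t := gn a m (r t) (s t).
Let g2 t := gn a m (s t) (\- r t).
Let g1' t := gn1 a a1 m (r t) (r' t) (s t) (s' t).
Let g2' t := gn1 a a1 m (s t) (s' t) (\- r t) (\- r' t).

(** The equation u_t = - v_xx - g tested against each mode, where - d_xx becomes k^2, with the time
    derivative taken from the right. *)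
Definition weak_ode (u v g : R -> R -> R) := forall t, 0 <= t ->
  forall k (eta : R), 0 < eta ->
    (\forall h \near (0 : R)^'+, `|ip (u (t + h)) (cc k) - ip (u t) (cc k)
       - h * (k%:R ^+ 2 * ip (v t) (cc k) - ip (g t) (cc k))| <= h * eta) /\
    (\forall h \near (0 : R)^'+, `|ip (u (t + h)) (ss k) - ip (u t) (ss k)
       - h * (k%:R ^+ 2 * ip (v t) (ss k) - ip (g t) (ss k))| <= h * eta).

Hypotheses (ode_r : weak_ode r s g1) (ode_s : weak_ode s (fun t => \- r t) g2).

Let V (u : R -> R -> R) N t := fproj N (u t).

(** Commutator of truncation and nonlinearity: with these as perturbations [e] and [f], the
    truncated curve has the form required by [tint_dldens]. *)
Let err1 N t := fproj N (g1 t) \- gn a m (V r N t) (V s N t).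
Let err1' N t := fproj N (g1' t) \- gn1 a a1 m (V r N t) (V r' N t) (V s N t) (V s' N t).
Let err2 N t := fproj N (g2 t) \- gn a m (V s N t) (\- V r N t).
Let err2' N t := fproj N (g2' t) \- gn1 a a1 m (V s N t) (V s' N t) (\- V r N t) (\- V r' N t).

Let LN N t := lfun psi kap eps m (V r N t) (V r' N t) (V s N t) (V s' N t).
Let EN N t := efun a psi lam kap eps m (V r N t) (V r' N t) (V s N t) (V s' N t)
  (err1 N t) (err1' N t) (err2 N t) (err2' N t).
Let L t := lfun psi kap eps m (r t) (r' t) (s t) (s' t).

Let ucvN (T : Type) (F : set_system T) (FF : Filter F) (v : T -> R -> R) f :
  ucv (F := F) v f -> ucv (F := F) (fun i => \- v i) (\- f).
Proof.
move=> [v1 v2 v3]; split; [by move=> i; exact: pCN | exact: pCN |].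
move=> e e0; apply: filterS (v3 e e0) => i hi x /=.
by rewrite -opprD normrN; exact: hi.
Qed.

Let lcvN (T : Type) (F : set_system T) (FF : Filter F) (v : T -> R -> R) f :
  lcv (F := F) v f -> lcv (F := F) (fun i => \- v i) (\- f).
Proof.
move=> [v1 v2 v3]; split; [by move=> i; exact: l2N | exact: l2N |].
have -> : (fun i => n2 ((\- v i) \- (\- f))) = (fun i => n2 (v i \- f)) => //.
apply/funext => i; rewrite -n2N; congr n2; apply/funext => x /=; ring.
Qed.

Let rho2N (x y : R) : rho2 x (- y) = rho2 x y.
Proof. by rewrite /rho2; ring. Qed.

Let rho2C (x y : R) : rho2 x y = rho2 y x.
Proof. by rewrite /rho2 addrC. Qed.

Let wd_g1 t : wdF (g1 t) (g1' t).
Proof.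
apply: (@wdF_lim _ (fun N => gn a m (V r N t) (V s N t)) (fun N => gn1 a a1 m (V r N t) (V r' N t) (V s N t) (V s' N t))).
- by move=> N; exact: (gn_pC1 m ha (curve_fproj_pC1 cr N t) (curve_fproj_pC1 cs N t)).
- by apply: ucv_lcv; apply: (gn_ucv _ ha); [exact: (curve_ucv_oo cr t) | exact: (curve_ucv_oo cs t)].
- apply: (gn1_lcv _ ha); first exact: (curve_ucv_oo cr t). exact: (curve_ucv_oo cs t).
  exact: lcv_fproj_oo (curve_l2' cr t). exact: lcv_fproj_oo (curve_l2' cs t).
Qed.

Let wd_g2 t : wdF (g2 t) (g2' t).
Proof.
apply: (@wdF_lim _ (fun N => gn a m (V s N t) (\- V r N t)) (fun N => gn1 a a1 m (V s N t) (V s' N t) (\- V r N t) (\- V r' N t))).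
- by move=> N; exact: (gn_pC1 m ha (curve_fproj_pC1 cs N t) (pC1N (curve_fproj_pC1 cr N t))).
- by apply: ucv_lcv; apply: (gn_ucv _ ha); [exact: (curve_ucv_oo cs t) | apply: ucvN; exact: (curve_ucv_oo cr)].
- apply: (gn1_lcv _ ha); first exact: (curve_ucv_oo cs t).
  + by apply: ucvN; exact: (curve_ucv_oo cr t).
  + exact: lcv_fproj_oo (curve_l2' cs t).
  + by apply: lcvN; exact: lcv_fproj_oo (curve_l2' cr t).
Qed.

Let err1_pC1 N t : pC1 (err1 N t) (err1' N t).
Proof.
apply: pC1B; first exact: fproj_wdF_pC1 (wd_g1 t).
exact: (gn_pC1 m ha (curve_fproj_pC1 cr N t) (curve_fproj_pC1 cs N t)).
Qed.

Let err2_pC1 N t : pC1 (err2 N t) (err2' N t).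
Proof.
apply: pC1B; first exact: fproj_wdF_pC1 (wd_g2 t).
exact: (gn_pC1 m ha (curve_fproj_pC1 cs N t) (pC1N (curve_fproj_pC1 cr N t))).
Qed.

Let lcv0 (T : Type) (F : set_system T) (FF : Filter F) (v : T -> R -> R) (f : R -> R) :
  lcv (F := F) v (f \- f) -> lcv (F := F) v (fun=> 0).
Proof. by have -> // : f \- f = (fun=> 0) by apply/funext => x /=; rewrite subrr. Qed.

(** Convergence is joint in N and time because the error must be small over a whole time interval
    for one and the same N. *)
Let EN_cvg (t : R) : EN Ni.1 Ni.2 @[Ni --> filter_prod \oo (nbhs t)] --> (0 : R).
Proof.
have ur := curve_ucv_pair cr t; have us := curve_ucv_pair cs t.
have lr := curve_lcv_pair' cr t; have ls := curve_lcv_pair' cs t.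
have G1 : ucv (F := nbhs t) g1 (g1 t).
  by apply: (gn_ucv _ ha); [exact: (curve_ucv cr t) | exact: (curve_ucv cs t)].
have G2 : ucv (F := nbhs t) g2 (g2 t).
  by apply: (gn_ucv _ ha); [exact: (curve_ucv cs t) | apply: ucvN; exact: (curve_ucv cr t)].
have G1' : lcv (F := nbhs t) g1' (g1' t).
  by apply: (gn1_lcv _ ha); [exact: (curve_ucv cr t) | exact: (curve_ucv cs t) | exact: (curve_lcv' cr t) | exact: (curve_lcv' cs t)].
have G2' : lcv (F := nbhs t) g2' (g2' t).
  apply: (gn1_lcv _ ha); first exact: (curve_ucv cs t).
  + by apply: ucvN; exact: (curve_ucv cr t).
  + exact: (curve_lcv' cs t).
  + by apply: lcvN; exact: (curve_lcv' cr t).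
apply: (efun_cvg0 _ _ _ hpsi ur us lr ls).
- apply: (@lcv0 _ _ _ _ (g1 t)); apply: lcvB; first by apply: lcv_fproj_pair; exact: ucv_lcv.
  by apply: ucv_lcv; exact: (gn_ucv _ ha).
- apply: (@lcv0 _ _ _ _ (g1' t)); apply: lcvB; first exact: lcv_fproj_pair.
  exact: (gn1_lcv _ ha).
- apply: (@lcv0 _ _ _ _ (g2 t)); apply: lcvB; first by apply: lcv_fproj_pair; exact: ucv_lcv.
  by apply: ucv_lcv; apply: (gn_ucv _ ha) => //; exact: ucvN.
- apply: (@lcv0 _ _ _ _ (g2' t)); apply: lcvB; first exact: lcv_fproj_pair.
  by apply: (gn1_lcv _ ha) => //; [exact: ucvN | exact: lcvN].
Qed.

Let LN_cvg (t : R) : LN Ni.1 Ni.2 @[Ni --> filter_prod \oo (nbhs t)] --> L t.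
Proof.
exact: (lfun_cvg hpsi (curve_ucv_pair cr t) (curve_ucv_pair cs t) (curve_lcv_pair' cr t) (curve_lcv_pair' cs t)).
Qed.

Let LN_cvg_oo (t : R) : LN N t @[N --> \oo] --> L t.
Proof.
apply: (lfun_cvg hpsi (curve_ucv_oo cr t) (curve_ucv_oo cs t)).
- exact: lcv_fproj_oo (curve_l2' cr t).
- exact: lcv_fproj_oo (curve_l2' cs t).
Qed.

Let LN_cont N : continuous (LN N).
Proof.
move=> t; apply: (lfun_cvg hpsi (curve_fproj_ucv cr N t) (curve_fproj_ucv cs N t)).
- by apply: lcv_fproj; exact: (curve_lcv' cr t).
- by apply: lcv_fproj; exact: (curve_lcv' cs t).
Qed.

Let L_cont : continuous L.
Proof.
by move=> t; exact: (lfun_cvg hpsi (curve_ucv cr t) (curve_ucv cs t) (curve_lcv' cr t) (curve_lcv' cs t)).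
Qed.

Let L_ge0 t : 0 <= L t.
Proof.
have [_ e] := tint_ldens kap eps m hpsi (cu_pC cr t) (curve_l2' cr t) (cu_pC cs t) (curve_l2' cs t).
by rewrite /L -e; apply: tint_ge0 => x _; exact: ldens_ge0.
Qed.

(** At fixed N all functions are smooth in x and expand in h uniformly in x, so [ldens_expand] can
    be integrated over the cell; [tint_dldens] and the dissipation inequality then bound the
    slope. *)
Let LN_deriv N t : 0 <= t -> forall eta : R, 0 < eta -> \forall h \near (0 : R)^'+,
  LN N (t + h) <= LN N t + h * (- delta * LN N t - EN N t + eta).
Proof.
move=> t0 eta eta0.
pose cA k := k%:R ^+ 2 * ip (s t) (cc k) - ip (g1 t) (cc k).
pose dA k := k%:R ^+ 2 * ip (s t) (ss k) - ip (g1 t) (ss k).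
pose cB k := k%:R ^+ 2 * ip (\- r t) (cc k) - ip (g2 t) (cc k).
pose dB k := k%:R ^+ 2 * ip (\- r t) (ss k) - ip (g2 t) (ss k).
pose al := syn N cA dA; pose be := syn N cB dB.
pose al1 := syn N (fun k => k%:R * dA k) (fun k => - (k%:R * cA k)).
pose be1 := syn N (fun k => k%:R * dB k) (fun k => - (k%:R * cB k)).
have hal : pC1 al al1 by exact: syn_pC1.
have hbe : pC1 be be1 by exact: syn_pC1.
have hr := curve_fproj_pC1 cr N t; have hs := curve_fproj_pC1 cs N t.
have hr1 := fproj_pC1 N (r' t); have hs1 := fproj_pC1 N (s' t).
(* Third derivatives enter [tint_dldens] only inside an exact derivative, so their existence is
   enough. *)
have hr2 : pC1 (fproj' N (r' t)) (derive1 (fproj' N (r' t))).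
  by rewrite fproj'_syn; apply: pC1_derive1; exact: syn_pC1.
have hs2 : pC1 (fproj' N (s' t)) (derive1 (fproj' N (s' t))).
  by rewrite fproj'_syn; apply: pC1_derive1; exact: syn_pC1.
(* The slope is the projected right-hand side; trading the projected nonlinearity for that of the
   truncated curve leaves [err1]. *)
have eal : al =1 (fun x => - fproj' N (s' t) x - a x * V r N t x + rho2 (V r N t x) (V s N t x) ^+ m * V s N t x - err1 N t x).
  move=> x; have -> : al x = - fproj' N (s' t) x - fproj N (g1 t) x.
    rewrite (curve_fproj'_coef cs) fproj_syn /al /syn -sumrN -sumrB; apply: eq_bigr => k _.
    by rewrite /cA /dA; ring.
  by rewrite /err1 /gn /=; ring.
have ebe : be =1 (fun x => fproj' N (r' t) x - a x * V s N t x - rho2 (V r N t x) (V s N t x) ^+ m * V r N t x - err2 N t x).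
  move=> x; have -> : be x = fproj' N (r' t) x - fproj N (g2 t) x.
    rewrite (curve_fproj'_coef cr) fproj_syn /be /syn -sumrB; apply: eq_bigr => k _.
    by rewrite /cB /dB !ipNl //; try exact: curve_l2 cr t; ring.
  by rewrite /err2 /gn /= rho2N (rho2C (V s N t x)); ring.
have pr := pC1_pC hr; have ps := pC1_pC hs; have pr1 := pC1_pC' hr; have ps1 := pC1_pC' hs.
have p1 := pC1_pC hpsi; have pa := pC1_pC ha; have pa1 := pC1_pC' ha.
have hE1 := err1_pC1 N t; have hE2 := err2_pC1 N t.
have pal := pC1_pC hal; have pal1 := pC1_pC' hal; have pbe := pC1_pC hbe; have pbe1 := pC1_pC' hbe.
have iD : intg (fun x => dldens psi m kap eps x (V r N t x) (V r' N t x) (V s N t x) (V s' N t x)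
    (al x) (al1 x) (be x) (be1 x)) by apply: pC_intg; rewrite /dldens /rho2; pc.
set D := torus_int (fun x => dldens psi m kap eps x (V r N t x) (V r' N t x) (V s N t x) (V s' N t x)
    (al x) (al1 x) (be x) (be1 x)).
have DE : D <= - delta * LN N t - EN N t.
  rewrite /D (tint_dldens ha hpsi m_gt0 kap eps hr hr1 hr2 hs hs1 hs2 hE1 hE2 eal ebe hal hbe).
  have [iE eE] := tint_derr kap eps m hpsi pr (pC_l2 pr1) ps (pC_l2 ps1)
    (pC_l2 (pC1_pC hE1)) (pC_l2 (pC1_pC' hE1)) (pC_l2 (pC1_pC hE2)) (pC_l2 (pC1_pC' hE2)).
  have iDi : intg (fun x => diss a a1 psi lam m kap eps x (V r N t x) (V r' N t x) (V s N t x) (V s' N t x)).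
    by apply: pC_intg; rewrite /diss /rho2; pc.
  have [_ eL] := tint_ldens kap eps m hpsi pr (pC_l2 pr1) ps (pC_l2 ps1).
  have h1 := tintB iDi iE; rewrite eE in h1.
  have h2 := diss_delta hr hs; rewrite eL in h2.
  apply: (le_trans (_ : _ <= torus_int (fun x => diss a a1 psi lam m kap eps x (V r N t x) (V r' N t x) (V s N t x) (V s' N t x)) - EN N t)).
    by rewrite -h1 lexx.
  by rewrite lerD2r.
have [M1 M10 hM1] := pC_bounded pr; have [M2 M20 hM2] := pC_bounded pr1.
have [M3 M30 hM3] := pC_bounded ps; have [M4 M40 hM4] := pC_bounded ps1.
have [M5 M50 hM5] := pC_bounded pal; have [M6 M60 hM6] := pC_bounded pal1.
have [M7 M70 hM7] := pC_bounded pbe; have [M8 M80 hM8] := pC_bounded pbe1.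
pose B := M1 + M2 + M3 + M4 + M5 + M6 + M7 + M8.
have B0 : 0 <= B by rewrite !addr_ge0.
have bB (f : R -> R) M : (forall x, `|f x| <= M) -> M <= B -> forall x, `|f x| <= B.
  by move=> hf hMB x; exact: le_trans (hf x) hMB.
have {}hM1 := bB _ _ hM1 ltac:(rewrite /B; lra). have {}hM2 := bB _ _ hM2 ltac:(rewrite /B; lra).
have {}hM3 := bB _ _ hM3 ltac:(rewrite /B; lra). have {}hM4 := bB _ _ hM4 ltac:(rewrite /B; lra).
have {}hM5 := bB _ _ hM5 ltac:(rewrite /B; lra). have {}hM6 := bB _ _ hM6 ltac:(rewrite /B; lra).
have {}hM7 := bB _ _ hM7 ltac:(rewrite /B; lra). have {}hM8 := bB _ _ hM8 ltac:(rewrite /B; lra).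
have [C C0 hC] := ldens_expand m psi_le kap eps B0.
pose C' : R := C * (pi *+ 2).
have C'0 : 0 <= C' by rewrite mulr_ge0 // ltW // twopi_gt0.
(* Makes C' (h + e1) at most eta when h < e1; the cap 1 is required by [ldens_expand]. *)
pose e1 : R := Num.min 1 (eta / (2 * (C' + 1))).
have e10 : 0 < e1 by rewrite lt_min ltr01 divr_gt0 // mulr_gt0 // ltr_wpDl.
have e11 : e1 <= 1 by rewrite ge_min lexx.
have Ce : C' * (e1 + e1) <= eta.
  have : e1 * (2 * (C' + 1)) <= eta.
    by rewrite -ler_pdivlMr ?ge_min ?lexx ?orbT // mulr_gt0 // ltr_wpDl.
  by have := mulr_ge0 C'0 (ltW e10); lra.
near=> h.
have h0 : 0 < h by near: h; exact: nbhs_right_gt.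
have hh : h < e1 by near: h; exact: nbhs_right_lt.
have [E1 E2] : (forall x, `|fproj N (r (t + h)) x - fproj N (r t) x - h * al x| <= h * e1) /\
    (forall x, `|fproj N (r' (t + h)) x - fproj N (r' t) x - h * al1 x| <= h * e1).
  near: h; apply: (curve_fproj_expand cr) => // k e e0; by have [] := ode_r t0 k e0.
have [E3 E4] : (forall x, `|fproj N (s (t + h)) x - fproj N (s t) x - h * be x| <= h * e1) /\
    (forall x, `|fproj N (s' (t + h)) x - fproj N (s' t) x - h * be1 x| <= h * e1).
  near: h; apply: (curve_fproj_expand cs) => // k e e0; by have [] := ode_s t0 k e0.
have hr_h := curve_fproj_pC1 cr N (t + h); have hs_h := curve_fproj_pC1 cs N (t + h).
have pr_h := pC1_pC hr_h; have ps_h := pC1_pC hs_h; have pr1_h := pC1_pC' hr_h; have ps1_h := pC1_pC' hs_h.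
have [i0 L0] := tint_ldens kap eps m hpsi pr (pC_l2 pr1) ps (pC_l2 ps1).
have [i1 L1] := tint_ldens kap eps m hpsi pr_h (pC_l2 pr1_h) ps_h (pC_l2 ps1_h).
have iB := intgB (intgB i1 i0) (intgZ h iD).
have h01 : 0 < h <= 1 by rewrite h0 (le_trans (ltW hh)).
have e01 : 0 <= e1 <= 1 by rewrite (ltW e10).
have bnd := tint_norm_bound iB (fun x _ => hC h e1 x _ _ _ _ _ _ _ _ _ _ _ _ h01 e01 (hM1 x) (hM2 x) (hM3 x) (hM4 x) (hM5 x) (hM6 x)
   (hM7 x) (hM8 x) (E1 x) (E2 x) (E3 x) (E4 x)).
rewrite (tintB (intgB i1 i0) (intgZ h iD)) (tintB i1 i0) (tintZ h iD) L0 L1 in bnd.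
have {}bnd : LN N (t + h) - LN N t - h * D <= C * h * (h + e1) * (pi *+ 2).
  exact: le_trans (ler_norm _) bnd.
have b2 : C * h * (h + e1) * (pi *+ 2) <= h * eta.
  have -> : C * h * (h + e1) * (pi *+ 2) = h * (C' * (h + e1)) by rewrite /C'; ring.
  rewrite ler_wpM2l ?(ltW h0) //; apply: le_trans Ce; rewrite ler_wpM2l // lerD2r; exact: ltW.
have b3 := ler_wpM2l (ltW h0) DE.
exact: increment_le bnd b2 b3.
Unshelve. all: by end_near.
Qed.

(** Limits in N preserve increments but not slopes. The inequality for [LN N] is therefore
    integrated over [t, t + h] first; then N tends to infinity, and [dini_decay] applies to the
    limit. *)
Theorem curve_decay t : 0 <= t -> L t <= L 0 * expR (- delta * t).
Proof.
move: t; apply: (@dini_decay _ L delta delta_gt0 L_cont L_ge0).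
move=> t t0 eta eta0; have eta2 : 0 < eta / 2 by rewrite divr_gt0.
have c : - delta * LN Ni.1 Ni.2 - EN Ni.1 Ni.2 @[Ni --> filter_prod \oo (nbhs t)] --> - delta * L t - 0.
  by apply: cvgB; [apply: cvgM; [exact: cvg_cst | exact: LN_cvg] | exact: EN_cvg].
(* Joint convergence yields a threshold N0 and a window d valid together: for N >= N0 the slope
   bound is within eta/2 of its limit at every time of the window. *)
rewrite subr0 in c; move/cvgrPdist_le : c => /(_ _ eta2) [[P Q] /= [[N0 _ hP] [d /= d0 hQ]] hPQ].
exists d => // h /andP[h0 hd].
have key N : (N0 <= N)%N -> LN N (t + h) <= LN N t + h * (eta - delta * L t).
  move=> NN; have := @dini_le _ (LN N) (- delta * L t + eta / 2) t (t + h) _ (@LN_cont N) _.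
  have -> : t + h - t = h by ring.
  move=> D; apply: (le_trans (D _ _)); first by rewrite lerDl ltW.
  - move=> x /andP[tx xh] e e0.
    have x0 : 0 <= x by exact: le_trans tx.
    have [k k0 hk] := near_right_ex (LN_deriv N x0 e0); exists k => // y hy.
    apply: (le_trans (hk y hy)); rewrite lerD2l; apply: ler_wpM2l; first by case/andP: hy => /ltW.
    rewrite lerD2r.
    have : `|- delta * L t - (- delta * LN N x - EN N x)| <= eta / 2.
      apply: (hPQ (N, x)); split => /=; first exact: hP.
      by apply: hQ => /=; rewrite distrC ger0_norm ?subr_ge0 // ltrBlDl (lt_trans xh) // ltrD2l hd.
    exact: dist_le_add.
  - rewrite lerD2l; apply: ler_wpM2l; first exact: ltW.
    exact: half_shift_le.
have c1 := @LN_cvg_oo (t + h).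
have c2 : LN N t + h * (eta - delta * L t) @[N --> \oo] --> L t + h * (eta - delta * L t).
  by apply: cvgD; [exact: LN_cvg_oo | exact: cvg_cst].
by apply: ler_cvg_to c1 c2 _; exists N0.
Qed.

End CurveDecay.

(** * Complex-valued functions and the damped group *)

Section AlmostEverywhere.
Context {R : realType}.
Implicit Types f g : R -> R.
Local Notation mu := (@lebesgue_measure R).

Lemma ae_imp (P Q : R -> Prop) : {ae mu, forall x, P x} -> (forall x, P x -> Q x) -> {ae mu, forall x, Q x}.
Proof.
move=> hP PQ; move: hP; apply: filterS; first exact: (ae_filter_ringOfSetsType mu).
exact: PQ.
Qed.

Lemma l2_ae f g : l2 f -> measurable_fun setT g ->
  {ae mu, forall x, period_cell x -> f x = g x} -> l2 g /\ n2 (f \- g) = 0.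
Proof.
move=> [mf if2] mg fg.
have z : (\int[mu]_(x in period_cell) (((f x - g x) ^+ 2)%:E) = 0)%E.
  rewrite (ae_eq_integral (cst 0%E)) ?integral0 //.
  - by apply/measurable_EFinP; apply: measurable_funTS; apply: measurable_funX; exact: measurable_funB.
  - by apply: (ae_imp fg) => x h Dx; rewrite (h Dx) subrr expr0n.
split; last first.
  rewrite n2E ipE /torus_int /Rintegral.
  have -> : (\int[mu]_(x in period_cell) (((f \- g) x * (f \- g) x)%:E))%E = 0%E.
    by rewrite -z; apply: eq_integral => x _; rewrite expr2.
  by rewrite /= sqrtr0.
split => //; apply/integrableP; split.
  by apply/measurable_EFinP; apply: measurable_funTS; exact: measurable_funX.
case/integrableP : if2 => _; apply: le_lt_trans; rewrite le_eqVlt; apply/orP; left; apply/eqP.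
apply: ae_eq_integral => //.
- by apply: measurableT_comp => //; apply/measurable_EFinP; apply: measurable_funTS; exact: measurable_funX.
- by apply: measurableT_comp => //; apply/measurable_EFinP; apply: measurable_funTS; exact: measurable_funX.
- by apply: (ae_imp fg) => x h Dx /=; rewrite (h Dx).
Qed.

Lemma n2_ae f g : l2 f -> l2 g -> n2 (f \- g) = 0 -> {ae mu, forall x, period_cell x -> f x = g x}.
Proof.
move=> hf hg h0; have hfg := l2B hf hg; have [mfg ifg] := hfg.
have z : torus_int (fun x => (f \- g) x ^+ 2) = 0.
  have := n2_sqr (f \- g); rewrite h0 expr0n /= ipE => e; rewrite [RHS]e.
  by congr torus_int; apply/funext => x; rewrite expr2.
have z' : (\int[mu]_(x in period_cell) `|((f x - g x) ^+ 2)%:E| = 0)%E.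
  have fin := integrable_fin_num measurable_cell ifg.
  under eq_integral do rewrite gee0_abs ?lee_fin ?sqr_ge0 //.
  by rewrite -[LHS](fineK fin); exact: (congr1 EFin z).
have mF : measurable_fun (period_cell : set (measurableTypeR R)) (fun x => ((f x - g x) ^+ 2)%:E).
  by apply/measurable_EFinP; apply: measurable_funTS; exact: measurable_funX.
have [/(_ z') ae _] := @ae_eq_integral_abs _ _ _ mu _ measurable_cell _ mF.
apply: (ae_imp ae) => x h Dx; have := h Dx => /= /eqP; rewrite eqe sqrf_eq0 subr_eq0.
by move/eqP.
Qed.

End AlmostEverywhere.

Section ComplexL2.
Context {R : realType}.
Local Open Scope complex_scope.
Implicit Types (f g h : R -> R[i]) (c : R).

Definition fr f : R -> R := fun x => complex.Re (f x).
Definition fi f : R -> R := fun x => complex.Im (f x).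

Lemma cmod_sqr (z : R[i]) : cmod z ^+ 2 = complex.Re z ^+ 2 + complex.Im z ^+ 2.
Proof. by case: z => x y; rewrite /cmod /= sqr_sqrtr // addr_ge0 // sqr_ge0. Qed.

Lemma L2P f : L2 f <-> [/\ periodic f (pi *+ 2), l2 (fr f) & l2 (fi f)].
Proof.
split.
  move=> [pf mr mi fin].
  have ic : intg (fun x => cmod (f x) ^+ 2).
    apply/integrableP; split.
      apply/measurable_EFinP; apply: measurable_funTS; under eq_fun do rewrite cmod_sqr.
      by apply: measurable_funD; exact: measurable_funX.
    apply: le_lt_trans fin; rewrite le_eqVlt; apply/orP; left; apply/eqP.
    by apply: eq_integral => x _; rewrite /= ger0_norm ?sqr_ge0.
  split => //; split => //.
  - apply: (intg_le (measurable_funX 2 mr) _ ic) => x _.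
    by rewrite ger0_norm ?sqr_ge0 // cmod_sqr lerDl sqr_ge0.
  - apply: (intg_le (measurable_funX 2 mi) _ ic) => x _.
    by rewrite ger0_norm ?sqr_ge0 // cmod_sqr lerDr sqr_ge0.
move=> [pf [mr ir] [mi ii]]; split => //.
have := integrable_lty measurable_cell (intgD ir ii).
by congr (_ < _)%E; apply: eq_integral => x _; rewrite /= cmod_sqr.
Qed.

Lemma L2_fr f : L2 f -> l2 (fr f). Proof. by move/L2P => []. Qed.
Lemma L2_fi f : L2 f -> l2 (fi f). Proof. by move/L2P => []. Qed.
Lemma L2_per f : L2 f -> periodic f (pi *+ 2). Proof. by move/L2P => []. Qed.

Definition sqC f : R := ip (fr f) (fr f) + ip (fi f) (fi f).
(** Equivalent to [normL2] up to a factor 2, and inherits its rules from the two components. The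
    exact squared norm [sqC] is kept for the dissipation argument, where a quadratic form is
    required. *)
Definition nC f : R := n2 (fr f) + n2 (fi f).

Lemma normL2_sqC f : L2 f -> normL2 f = Num.sqrt (sqC f).
Proof.
move=> hf; congr Num.sqrt; have hr := L2_fr hf; have hi := L2_fi hf.
rewrite /sqC !ipE -tintD; try exact: l2M_intg.
by congr torus_int; apply/funext => x /=; rewrite cmod_sqr !expr2.
Qed.

Lemma sqC_ge0 f : 0 <= sqC f. Proof. by rewrite addr_ge0 // ip_ge0. Qed.
Lemma nC_ge0 f : 0 <= nC f. Proof. by rewrite addr_ge0 // n2_ge0. Qed.

Lemma sqC_le_nC f : sqC f <= nC f ^+ 2.
Proof.
rewrite /sqC /nC -!n2_sqr; have := n2_ge0 (fr f); have := n2_ge0 (fi f).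
by move: (n2 (fr f)) (n2 (fi f)) => x y x0 y0; nra.
Qed.

Lemma nC_le_sqC f : nC f ^+ 2 <= 2 * sqC f.
Proof. by rewrite /sqC /nC -!n2_sqr; move: (n2 (fr f)) (n2 (fi f)) => x y; have := sqr_ge0 (x - y); lra. Qed.

Lemma normL2_le_nC f : L2 f -> normL2 f <= nC f.
Proof.
move=> hf; rewrite normL2_sqC // -[leRHS]ger0_norm ?nC_ge0 // -sqrtr_sqr.
by apply: ler_wsqrtr; exact: sqC_le_nC.
Qed.

Lemma nC_le_normL2 f : L2 f -> nC f <= 2 * normL2 f.
Proof.
move=> hf; rewrite normL2_sqC // -(ler_pXn2r (ltn0Sn 1)) ?nnegrE ?nC_ge0 ?mulr_ge0 ?sqrtr_ge0 //.
rewrite exprMn sqr_sqrtr ?sqC_ge0 //; apply: (le_trans (nC_le_sqC f)).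
by have := sqC_ge0 f; lra.
Qed.

Lemma frD f g : fr (f + g) = fr f \+ fr g.
Proof. by apply/funext => x; rewrite /fr /= !fctE; case: (f x) => ? ?; case: (g x). Qed.
Lemma fiD f g : fi (f + g) = fi f \+ fi g.
Proof. by apply/funext => x; rewrite /fi /= !fctE; case: (f x) => ? ?; case: (g x). Qed.
Lemma frN f : fr (- f) = \- fr f.
Proof. by apply/funext => x; rewrite /fr /= !fctE; case: (f x). Qed.
Lemma fiN f : fi (- f) = \- fi f.
Proof. by apply/funext => x; rewrite /fi /= !fctE; case: (f x). Qed.
Lemma frB f g : fr (f - g) = fr f \- fr g. Proof. by rewrite frD frN. Qed.
Lemma fiB f g : fi (f - g) = fi f \- fi g. Proof. by rewrite fiD fiN. Qed.
Lemma frZ c f : fr (c%:C \*o f) = c \*o fr f.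
Proof. by apply/funext => x; rewrite /fr /=; case: (f x) => p q /=; rewrite mul0r subr0. Qed.
Lemma fiZ c f : fi (c%:C \*o f) = c \*o fi f.
Proof. by apply/funext => x; rewrite /fi /=; case: (f x) => p q /=; rewrite mul0r addr0. Qed.
Lemma fr_i f : fr ('i \*o f) = \- fi f.
Proof. by apply/funext => x; rewrite /fr /fi /=; case: (f x) => p q /=; rewrite mul0r mul1r sub0r. Qed.
Lemma fi_i f : fi ('i \*o f) = fr f.
Proof. by apply/funext => x; rewrite /fr /fi /=; case: (f x) => p q /=; rewrite mul0r mul1r add0r. Qed.

Lemma L2D f g : L2 f -> L2 g -> L2 (f + g).
Proof.
move=> /L2P[pf f1 f2] /L2P[pg g1 g2]; apply/L2P; split; rewrite ?frD ?fiD; try exact: l2D.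
by move=> x; rewrite /= !fctE pf pg.
Qed.
Lemma L2N f : L2 f -> L2 (- f).
Proof.
move=> /L2P[pf f1 f2]; apply/L2P; split; rewrite ?frN ?fiN; try exact: l2N.
by move=> x; rewrite !fctE pf.
Qed.
Lemma L2B f g : L2 f -> L2 g -> L2 (f - g).
Proof. by move=> hf /L2N; exact: L2D. Qed.
Lemma L2Z c f : L2 f -> L2 (c%:C \*o f).
Proof.
move=> /L2P[pf f1 f2]; apply/L2P; split; rewrite ?frZ ?fiZ; try exact: l2Z.
by move=> x; rewrite /= pf.
Qed.
Lemma L2_i f : L2 f -> L2 ('i \*o f).
Proof.
move=> /L2P[pf f1 f2]; apply/L2P; split; rewrite ?fr_i ?fi_i //; try exact: l2N.
by move=> x; rewrite /= pf.
Qed.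

(** [dC f g = 0] plays the role of equality in L^2, the operators of the group acting on
    representatives. *)
Definition dC f g : R := nC (f - g).

Lemma dCE f g : dC f g = n2 (fr f \- fr g) + n2 (fi f \- fi g).
Proof. by rewrite /dC /nC frB fiB. Qed.

Lemma dC_ge0 f g : 0 <= dC f g. Proof. exact: nC_ge0. Qed.
Lemma dC_refl f : dC f f = 0.
Proof.
have z : n2 (fun _ : R => 0 : R) = 0 by rewrite n2E ip0l sqrtr0.
have e (p : R -> R) : p \- p = (fun=> 0) by apply/funext => x /=; rewrite subrr.
by rewrite dCE (e (fr f)) (e (fi f)) z addr0.
Qed.
Lemma dC_sym f g : dC f g = dC g f.
Proof. by rewrite !dCE (n2BC (fr f)) (n2BC (fi f)). Qed.
Lemma dC_tri g f h : L2 f -> L2 g -> L2 h -> dC f h <= dC f g + dC g h.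
Proof.
move=> hf hg hh; rewrite !dCE addrACA.
exact: lerD (n2_tri (L2_fr hf) (L2_fr hg) (L2_fr hh)) (n2_tri (L2_fi hf) (L2_fi hg) (L2_fi hh)).
Qed.
Lemma dCD f g f' g' : L2 f -> L2 g -> L2 f' -> L2 g' -> dC (f + g) (f' + g') <= dC f f' + dC g g'.
Proof.
move=> hf hg hf' hg'; rewrite !dCE !frD !fiD addrACA.
have e (p q p' q' : R -> R) : (p \+ q) \- (p' \+ q') = (p \- p') \+ (q \- q') by apply/funext => x /=; ring.
rewrite !e; exact: lerD (n2D (l2B (L2_fr hf) (L2_fr hf')) (l2B (L2_fr hg) (L2_fr hg')))
  (n2D (l2B (L2_fi hf) (L2_fi hf')) (l2B (L2_fi hg) (L2_fi hg'))).
Qed.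
Lemma dCN f g : dC (- f) (- g) = dC f g.
Proof.
rewrite !dCE !frN !fiN.
have e (p q : R -> R) : (\- p) \- (\- q) = \- (p \- q) by apply/funext => x /=; ring.
by rewrite !e !n2N.
Qed.
Lemma dCB f g f' g' : L2 f -> L2 g -> L2 f' -> L2 g' -> dC (f - g) (f' - g') <= dC f f' + dC g g'.
Proof. by move=> hf hg hf' hg'; rewrite -(dCN g g'); apply: dCD => //; exact: L2N. Qed.
Lemma dCZ c f g : L2 f -> L2 g -> dC (c%:C \*o f) (c%:C \*o g) = `|c| * dC f g.
Proof.
move=> hf hg; rewrite !dCE !frZ !fiZ mulrDr.
have e (p q : R -> R) : (c \*o p) \- (c \*o q) = c \*o (p \- q) by apply/funext => x /=; ring.
by rewrite !e (n2Z _ (l2B (L2_fr hf) (L2_fr hg))) (n2Z _ (l2B (L2_fi hf) (L2_fi hg))).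
Qed.
Lemma dC_i f g : dC ('i \*o f) ('i \*o g) = dC f g.
Proof.
rewrite !dCE !fr_i !fi_i.
have e (p q : R -> R) : (\- p) \- (\- q) = \- (p \- q) by apply/funext => x /=; ring.
by rewrite !e !n2N addrC.
Qed.

Lemma dC_normL2 f g : L2 f -> L2 g -> dC f g <= 2 * normL2 (f - g).
Proof. by move=> hf hg; apply: nC_le_normL2; exact: L2B. Qed.
Lemma normL2_dC f g : L2 f -> L2 g -> normL2 (f - g) <= dC f g.
Proof. by move=> hf hg; apply: normL2_le_nC; exact: L2B. Qed.

Lemma dC0_normL2 f g : L2 f -> L2 g -> dC f g = 0 -> normL2 (f - g) = 0.
Proof.
by move=> hf hg h; apply/eqP; rewrite eq_le sqrtr_ge0 andbT -h normL2_dC.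
Qed.
Lemma normL20_dC f g : L2 f -> L2 g -> normL2 (f - g) = 0 -> dC f g = 0.
Proof.
move=> hf hg h; apply/eqP; rewrite eq_le dC_ge0 andbT.
by apply: (le_trans (dC_normL2 hf hg)); rewrite h mulr0.
Qed.

Lemma dC_eq0_trans g f h : L2 f -> L2 g -> L2 h -> dC f g = 0 -> dC g h = 0 -> dC f h = 0.
Proof.
move=> hf hg hh h1 h2; apply/eqP; rewrite eq_le dC_ge0 andbT.
by apply: (le_trans (dC_tri hf hg hh)); rewrite h1 h2 addr0.
Qed.

Lemma nC_le f g : L2 f -> L2 g -> nC f <= nC g + dC f g.
Proof.
move=> hf hg.
have e (p q : R -> R) : p = q \+ (p \- q) by apply/funext => x /=; ring.
rewrite dCE /nC addrACA; apply: lerD.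
- rewrite {1}(e (fr f) (fr g)); apply: n2D; first exact: L2_fr.
  by apply: l2B; exact: L2_fr.
- rewrite {1}(e (fi f) (fi g)); apply: n2D; first exact: L2_fi.
  by apply: l2B; exact: L2_fi.
Qed.

Lemma ip_dC f g phi : L2 f -> L2 g -> l2 phi ->
  `|ip (fr f) phi - ip (fr g) phi| <= dC f g * n2 phi /\ `|ip (fi f) phi - ip (fi g) phi| <= dC f g * n2 phi.
Proof.
move=> hf hg hp.
have [f1 f2 g1 g2] := And4 (L2_fr hf) (L2_fi hf) (L2_fr hg) (L2_fi hg).
rewrite -!ipBl // dCE; split; apply: le_trans (cauchy_schwarz _ hp) _; try exact: l2B.
- by rewrite ler_wpM2r ?n2_ge0 // lerDl n2_ge0.
- by rewrite ler_wpM2r ?n2_ge0 // lerDr n2_ge0.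
Qed.

End ComplexL2.

Section ComplexSobolev.
Context {R : realType}.
Local Open Scope complex_scope.
Implicit Types (f g h : R -> R[i]) (c : R).

Lemma ReMc (z : R[i]) c : complex.Re (z * c%:C) = complex.Re z * c.
Proof. by case: z => p q /=; rewrite mulr0 subr0. Qed.
Lemma ImMc (z : R[i]) c : complex.Im (z * c%:C) = complex.Im z * c.
Proof. by case: z => p q /=; rewrite mulr0 add0r. Qed.

Lemma weak_derivativeP f g : weak_derivative f g <-> L2 g /\ forall phi, torus_smooth phi ->
  ip (fr f) (derive1 phi) = - ip (fr g) phi /\ ip (fi f) (derive1 phi) = - ip (fi g) phi.
Proof.
have e (k : R -> R[i]) (psi : R -> R) : torus_cint (fun x => k x * (psi x)%:C) = ip (fr k) psi +i* ip (fi k) psi.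
  by rewrite /torus_cint !ipE; congr (torus_int _ +i* torus_int _); apply/funext => x; rewrite ?ReMc ?ImMc.
split=> -[Lg H]; split => // phi sp; have := H _ sp; rewrite !e.
  by move=> [-> ->].
by move=> [-> ->].
Qed.

Lemma weak_wdF f g : L2 f -> weak_derivative f g -> wdF (fr f) (fr g) /\ wdF (fi f) (fi g).
Proof.
move=> hf /weak_derivativeP[hg H]; split; apply: wdF_smooth.
- exact: L2_fr hf.
- exact: L2_fr hg.
- by move=> phi sp; have [] := H _ sp.
- exact: L2_fi hf.
- exact: L2_fi hg.
- by move=> phi sp; have [] := H _ sp.
Qed.

Lemma wderivP f g : weak_derivative f g -> weak_derivative f (wderiv f).
Proof. by move=> h; apply: (@xgetPex _ (cst 0) [set g | weak_derivative f g]); exists g. Qed.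

Lemma weak_L2 f g : weak_derivative f g -> L2 g. Proof. by case. Qed.

Lemma Hs_L2 k f : Hs k f -> L2 f. Proof. by case: k => [|k] // []. Qed.

Lemma Hs1_wd f : Hs 1 f -> weak_derivative f (wderiv f).
Proof. by move=> [_ [g hg _]]; exact: wderivP hg. Qed.

Lemma weak_unique f g h : L2 f -> weak_derivative f g -> weak_derivative f h -> dC g h = 0.
Proof.
move=> hf hg hh; have [g1 g2] := weak_wdF hf hg; have [h1 h2] := weak_wdF hf hh.
by rewrite dCE (wdF_unique g1 h1) (wdF_unique g2 h2) addr0.
Qed.

Lemma dC0_ip f g phi : L2 f -> L2 g -> dC f g = 0 -> l2 phi ->
  ip (fr f) phi = ip (fr g) phi /\ ip (fi f) phi = ip (fi g) phi.
Proof.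
move=> hf hg h0 hp; have [] := ip_dC hf hg hp; rewrite h0 mul0r !normr_le0 !subr_eq0.
by move=> /eqP -> /eqP ->.
Qed.

Lemma weak_dC f g h : L2 f -> L2 g -> dC f g = 0 -> weak_derivative f h -> weak_derivative g h.
Proof.
move=> hf hg h0 /weak_derivativeP[hh H]; apply/weak_derivativeP; split => // phi sp.
have lp := pC_l2 (pC1_pC' (smooth_pC1 sp)).
by have [<- <-] := dC0_ip hf hg h0 lp; exact: H.
Qed.

(** Membership in [Hs 2] is witnessed by some weak derivative, whereas [wderiv] selects another
    representative of it; both have the same weak derivatives. *)
Lemma Hs2_wd f : Hs 2 f -> [/\ L2 f, weak_derivative f (wderiv f) &
  weak_derivative (wderiv f) (wderiv (wderiv f))].
Proof.
move=> [hf [g hg [_ [h hh _]]]]; have hw := wderivP hg.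
have wh : weak_derivative (wderiv f) h.
  exact: (weak_dC (weak_L2 hg) (weak_L2 hw) (weak_unique hf hg hw) hh).
split; [exact: hf | exact: hw | exact: (wderivP wh)].
Qed.

Lemma trigp_deriv (p : R -> R) : trigp p -> exists2 p', trigp p' & pC1 p p'.
Proof.
elim=> [k|k|f g _ [f' tf df] _ [g' tg dg]|c f _ [f' tf df]].
- by exists (- k%:R \*o ss k); [exact: trigpZ (trigp_ss k) | exact: cc_pC1].
- by exists (k%:R \*o cc k); [exact: trigpZ (trigp_cc k) | exact: ss_pC1].
- by exists (f' \+ g'); [exact: trigpD | exact: pC1D].
- by exists (c \*o f'); [exact: trigpZ | exact: pC1Z].
Qed.

Definition mkC (p q : R -> R) : R -> R[i] := fun x => p x +i* q x.

Lemma fr_mkC p q : fr (mkC p q) = p. Proof. by []. Qed.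
Lemma fi_mkC p q : fi (mkC p q) = q. Proof. by []. Qed.

Lemma L2_mkC p q : pC p -> pC q -> L2 (mkC p q).
Proof.
move=> hp hq; apply/L2P; split; [|exact: pC_l2|exact: pC_l2].
by move=> x; rewrite /mkC (pC_per hp) (pC_per hq).
Qed.

Lemma weak_mkC p p' q q' : pC1 p p' -> pC1 q q' -> weak_derivative (mkC p q) (mkC p' q').
Proof.
move=> hp hq; apply/weak_derivativeP; split; first exact: L2_mkC (pC1_pC' hp) (pC1_pC' hq).
by move=> phi /smooth_pC1 sp; split; exact: ip_ibp.
Qed.

Lemma Hs2_trig p q : trigp p -> trigp q -> Hs 2 (mkC p q).
Proof.
move=> tp tq; have [p' tp' dp] := trigp_deriv tp; have [q' tq' dq] := trigp_deriv tq.
have [p2 tp2 dp2] := trigp_deriv tp'; have [q2 tq2 dq2] := trigp_deriv tq'.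
split; first exact: L2_mkC (trigp_pC tp) (trigp_pC tq).
exists (mkC p' q'); first exact: weak_mkC.
split; first exact: L2_mkC (trigp_pC tp') (trigp_pC tq').
exists (mkC p2 q2); first exact: weak_mkC.
exact: L2_mkC (trigp_pC tp2) (trigp_pC tq2).
Qed.

(** Density of the domain of the generator: orbits are differentiated from H^2 data, and bounds are
    then extended to L^2. *)
Lemma trig_denseC f (e : R) : L2 f -> 0 < e -> exists q, [/\ Hs 2 q, L2 q & dC f q <= e].
Proof.
move=> hf e0; have e2 : 0 < e / 2 by rewrite divr_gt0.
have [p tp hp] := trigp_dense (L2_fr hf) e2; have [q tq hq] := trigp_dense (L2_fi hf) e2.
exists (mkC p q); split; first exact: Hs2_trig.
- exact: L2_mkC (trigp_pC tp) (trigp_pC tq).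
- by rewrite dCE fr_mkC fi_mkC [leRHS]splitr; exact: lerD.
Qed.

End ComplexSobolev.

(** * The group generated by the damped Schrodinger operator *)

Section Group.
Context {R : realType}.
Local Open Scope complex_scope.
Implicit Types (f g q z : R -> R[i]) (c t h : R).
Variables (a : R -> R) (S : R -> (R -> R[i]) -> (R -> R[i])).
Hypotheses (a_pC : pC a) (a_ge0 : forall x, 0 <= a x) (HS : damped_schrodinger_group a S).

Lemma S_L2 t f : L2 f -> L2 (S t f). Proof. by case: HS => -[H _ _ _ _] _; exact: H. Qed.

Lemma S_bd t : exists2 M : R, 0 <= M & forall f g, L2 f -> L2 g -> dC (S t f) (S t g) <= M * dC f g.
Proof.
case: HS => -[_ lin bd _ _] _.
have [M hM] := bd t; exists (2 * `|M|); first by rewrite mulr_ge0.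
move=> f g hf hg.
have hfg := L2B hf hg.
have L1 : L2 ((-1)%:C \*o S t g + S t f) by apply: L2D; [apply: L2Z|]; exact: S_L2.
have L0 : L2 ((-1)%:C \*o g + f) by apply: L2D => //; exact: L2Z.
have e0 : (-1)%:C \*o g + f = f - g.
  by apply/funext => x; rewrite !fctE /= rmorphN1 mulN1r addrC.
have h1 := normL20_dC (S_L2 t L0) L1 (lin t (-1)%:C g f hg hf).
have e1 : (-1)%:C \*o S t g + S t f = S t f - S t g.
  by apply/funext => x; rewrite !fctE /= rmorphN1 mulN1r addrC.
rewrite e0 e1 in h1.
have h2 := nC_le (L2B (S_L2 t hf) (S_L2 t hg)) (S_L2 t hfg).
rewrite dC_sym h1 addr0 in h2.
apply: (le_trans h2); apply: (le_trans (nC_le_normL2 (S_L2 t hfg))).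
rewrite -mulrA ler_wpM2l //; apply: (le_trans (hM _ hfg)).
apply: (le_trans (_ : _ <= `|M| * normL2 (f - g))).
  by rewrite ler_wpM2r ?sqrtr_ge0 // ler_norm.
by rewrite ler_wpM2l //; exact: normL2_dC.
Qed.

Lemma S_linZ t c f g : L2 f -> L2 g ->
  dC (S t (c%:C \*o f + g)) (c%:C \*o S t f + S t g) = 0.
Proof.
move=> hf hg; case: HS => -[_ lin _ _ _] _.
apply: normL20_dC; last exact: lin.
  by apply: S_L2; apply: L2D => //; exact: L2Z.
by apply: L2D; [apply: L2Z|]; exact: S_L2.
Qed.

Lemma S_linB t f g : L2 f -> L2 g -> dC (S t (f - g)) (S t f - S t g) = 0.
Proof.
move=> hf hg; have := S_linZ t (-1) hg hf.
have e (p q : R -> R[i]) : (-1)%:C \*o q + p = p - q.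
  by apply/funext => x; rewrite !fctE /= rmorphN1 mulN1r addrC.
by rewrite !e.
Qed.

Lemma S_add s t f : L2 f -> dC (S (s + t) f) (S s (S t f)) = 0.
Proof.
move=> hf; case: HS => -[_ _ _ [_ add] _] _.
by apply: normL20_dC; [exact: S_L2 | by apply: S_L2; exact: S_L2 | exact: add].
Qed.

Lemma S_0 f : L2 f -> dC (S 0 f) f = 0.
Proof.
move=> hf; case: HS => -[_ _ _ [z _] _] _.
by apply: normL20_dC => //; [exact: S_L2 | exact: z].
Qed.

Lemma S_cont0 f : L2 f -> dC (S t f) f @[t --> (0 : R)] --> (0 : R).
Proof.
move=> hf; case: HS => -[_ _ _ _ c] _.
apply: (@cvg0_le _ _ _ _ _ (fun t => 2 * normL2 (S t f - f))).
- by move=> t; exact: dC_ge0.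
- by apply: nearW => t; apply: dC_normL2 => //; exact: S_L2.
- by rewrite -[0 in X in _ --> X](mulr0 2); apply: cvgM; [exact: cvg_cst | exact: c].
Qed.

(** Writing S s = S t S (s - t) transfers continuity at 0 through the bound of the single operator S
    t. *)
Lemma S_cont t f : L2 f -> dC (S s f) (S t f) @[s --> t] --> (0 : R).
Proof.
move=> hf; have [M M0 hM] := S_bd t.
have c : M * dC (S (s - t) f) f @[s --> t] --> (0 : R).
  rewrite -[0 in X in _ --> X](mulr0 M); apply: cvgM; first exact: cvg_cst.
  have k : (s - t) @[s --> t] --> (0 : R).
    by rewrite -(subrr t); apply: cvgB; [exact: cvg_id | exact: cvg_cst].
  exact: (cvg_comp _ _ k (S_cont0 hf)).
apply: (cvg0_le _ _ c); first by move=> s; exact: dC_ge0.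
apply: nearW => s; have h1 := S_add t (s - t) hf.
rewrite addrC subrK in h1.
apply: (le_trans (dC_tri (S_L2 s hf) (S_L2 t (S_L2 (s - t) hf)) (S_L2 t hf))).
by rewrite h1 add0r; apply: hM => //; exact: S_L2.
Qed.

Let A := schrodinger_op a.

Lemma fr_A z : fr (A z) = (\- fi (wderiv (wderiv z))) \- (a \* fr z).
Proof.
apply/funext => x; rewrite /A /schrodinger_op /fr /fi /=.
by case: (wderiv (wderiv z) x) => p q; case: (z x) => p' q' /=; ring.
Qed.

Lemma fi_A z : fi (A z) = fr (wderiv (wderiv z)) \- (a \* fi z).
Proof.
apply/funext => x; rewrite /A /schrodinger_op /fr /fi /=.
by case: (wderiv (wderiv z) x) => p q; case: (z x) => p' q' /=; ring.
Qed.

Lemma A_L2 z : Hs 2 z -> L2 (A z).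
Proof.
move=> /Hs2_wd[hz hw /weak_L2 hw2]; apply/L2P; rewrite fr_A fi_A; split.
- by move=> x; rewrite /A /schrodinger_op (L2_per hz) (L2_per hw2) (pC_per a_pC).
- by apply: l2B; [apply: l2N; exact: L2_fi | apply: pCl2_l2 => //; exact: L2_fr].
- by apply: l2B; [exact: L2_fr | apply: pCl2_l2 => //; exact: L2_fi].
Qed.

Lemma gen_cvg z : Hs 2 z -> dC (h^-1%:C \*o (S h z - z)) (A z) @[h --> (0 : R)^'] --> (0 : R).
Proof.
move=> hz; have [_ gen] := HS; have Lz := Hs_L2 hz; have LA := A_L2 hz.
have [_ /(_ _)] := gen z (A z) Lz LA.
have L h : L2 (h^-1%:C \*o (S h z - z)) by apply: L2Z; apply: L2B => //; exact: S_L2.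
have z0 : normL2 (A z - schrodinger_op a z) = 0 by apply: dC0_normL2 => //; exact: dC_refl.
move=> /(_ (conj hz z0)) c.
apply: (@cvg0_le _ _ _ _ _ (fun h => 2 * normL2 (h^-1%:C \*o (S h z - z) - A z))).
- by move=> h; exact: dC_ge0.
- by apply: nearW => h; exact: dC_normL2.
- by rewrite -[0 in X in _ --> X](mulr0 2); apply: cvgM; [exact: cvg_cst | exact: c].
Qed.

(** The difference quotient of S t z is S t applied to that of z, hence converges; since the
    generator characterises its domain by such limits, S t z lies in H^2. Most of the work is that
    linearity and the group law hold up to null functions. *)
Lemma S_Hs2 t z : Hs 2 z -> Hs 2 (S t z).
Proof.
move=> hz; have [_ gen] := HS; have Lz := Hs_L2 hz; have LA := A_L2 hz.
have LS := S_L2 t Lz; have LSA := S_L2 t LA.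
suff c : dC (h^-1%:C \*o (S h (S t z) - S t z)) (S t (A z)) @[h --> (0 : R)^'] --> (0 : R).
  have [/(_ _) H _] := gen (S t z) (S t (A z)) LS LSA.
  apply: (H _).1.
  apply: (cvg0_le _ _ c); first by move=> h; exact: sqrtr_ge0.
  apply: nearW => h; apply: normL2_dC => //.
  by apply: L2Z; apply: L2B => //; exact: S_L2.
have [M M0 hM] := S_bd t.
have c : M * dC (h^-1%:C \*o (S h z - z)) (A z) @[h --> (0 : R)^'] --> (0 : R).
  by rewrite -[0 in X in _ --> X](mulr0 M); apply: cvgM; [exact: cvg_cst | exact: gen_cvg].
apply: (cvg0_le _ _ c); first by move=> h; exact: dC_ge0.
apply: nearW => h.
have Lh := S_L2 h Lz; have Ld := L2B Lh Lz; have LSh := S_L2 h LS.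
have LtSh := S_L2 t Lh.
have e1 : dC (S h (S t z)) (S t (S h z)) = 0.
  apply: (dC_eq0_trans _ (S_L2 (h + t) Lz) _) => //; first by rewrite dC_sym; exact: S_add.
  by rewrite addrC; exact: S_add.
have e2 : dC (h^-1%:C \*o (S h (S t z) - S t z)) (h^-1%:C \*o (S t (S h z - z))) = 0.
  rewrite dCZ; [|exact: L2B|exact: S_L2].
  apply/eqP; rewrite mulf_eq0; apply/orP; right; apply/eqP.
  apply: (dC_eq0_trans _ (L2B LtSh LS)); [exact: L2B|exact: S_L2| |by rewrite dC_sym; exact: S_linB].
  apply/eqP; rewrite eq_le dC_ge0 andbT; apply: (le_trans (dCB LSh LS LtSh LS)).
  by rewrite e1 dC_refl addr0.
have L0 : L2 (fun _ : R => 0 : R[i]) by apply: (L2_mkC (pC_cst 0) (pC_cst 0)).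
have Ldz := L2Z h^-1 Ld.
have e3 : dC (S t (h^-1%:C \*o (S h z - z))) (h^-1%:C \*o (S t (S h z - z))) = 0.
  have LSd := L2Z h^-1 (S_L2 t Ld); have LSz := S_L2 t L0.
  have := S_linZ t h^-1 Ld L0.
  have -> : h^-1%:C \*o (S h z - z) + (fun _ : R => 0 : R[i]) = h^-1%:C \*o (S h z - z).
    by apply/funext => x; rewrite fctE addr0.
  move=> k; apply: (dC_eq0_trans _ (L2D LSd LSz) _ k) => //; first exact: S_L2.
  have s0 : dC (S t (fun=> 0)) (fun _ : R => 0 : R[i]) = 0.
    have := S_linB t L0 L0.
    have -> : (fun _ : R => 0 : R[i]) - (fun _ : R => 0 : R[i]) = (fun _ : R => 0 : R[i]).
      by apply/funext => x; rewrite fctE subrr.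
    by rewrite subrr.
  apply/eqP; rewrite eq_le dC_ge0 andbT.
  have e0 : h^-1%:C \*o S t (S h z - z) + (fun _ : R => 0 : R[i]) = h^-1%:C \*o S t (S h z - z).
    by apply/funext => x; rewrite fctE addr0.
  have k0 : dC (h^-1%:C \*o S t (S h z - z) + S t (fun _ : R => 0 : R[i])) (h^-1%:C \*o S t (S h z - z) + (fun _ : R => 0 : R[i])) <= 0.
    by apply: (le_trans (dCD LSd LSz LSd L0)); rewrite dC_refl s0 addr0.
  rewrite e0 in k0.
  exact: k0.
have LX := L2Z h^-1 (L2B LSh LS); have LY := L2Z h^-1 (S_L2 t Ld); have LZ := S_L2 t Ldz.
apply: (le_trans (dC_tri LX LY LSA)); rewrite e2 add0r.
apply: (le_trans (dC_tri LY LZ LSA)); rewrite dC_sym e3 add0r.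
exact: hM.
Qed.

End Group.

Section Functional.
Context {R : realType}.
Local Open Scope complex_scope.
Implicit Types (f g : R -> R[i]) (p q : R -> R).

(** The real inner product of f with p + i q. *)
Definition ipC2 p q f : R := ip (fr f) p + ip (fi f) q.

Lemma ipC2_dist p q f g : l2 p -> l2 q -> L2 f -> L2 g ->
  `|ipC2 p q f - ipC2 p q g| <= dC f g * (n2 p + n2 q).
Proof.
move=> hp hq hf hg; have [h1 _] := ip_dC hf hg hp; have [_ h2] := ip_dC hf hg hq.
rewrite /ipC2 opprD addrACA mulrDr.
exact: le_trans (ler_normD _ _) (lerD h1 h2).
Qed.

Lemma ipC2_le p q f g : l2 p -> l2 q -> L2 f -> L2 g ->
  ipC2 p q f <= ipC2 p q g + dC f g * (n2 p + n2 q).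
Proof.
move=> hp hq hf hg; have := ler_norm (ipC2 p q f - ipC2 p q g).
by move=> h; rewrite -lerBlDl; exact: le_trans h (ipC2_dist hp hq hf hg).
Qed.

Lemma ipC2_incr p q f g (h : R) : h != 0 -> l2 p -> l2 q -> L2 f -> L2 g ->
  ipC2 p q f = ipC2 p q g + h * ipC2 p q (h^-1%:C \*o (f - g)).
Proof.
move=> h0 hp hq hf hg; have Ld := L2B hf hg.
rewrite /ipC2 frZ fiZ (ipZl _ (L2_fr Ld) hp) (ipZl _ (L2_fi Ld) hq) frB fiB.
rewrite (ipBl (L2_fr hf) (L2_fr hg) hp) (ipBl (L2_fi hf) (L2_fi hg) hq).
rewrite -mulrDr mulrA divff // mul1r.
by move: (ip (fr f) p) (ip (fr g) p) (ip (fi f) q) (ip (fi g) q) => x y z w; ring.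
Qed.

Lemma sqC_incr f g (h : R) : h != 0 -> L2 f -> L2 g -> let B := h^-1%:C \*o (f - g) in
  sqC f = sqC g + h * (2 * ipC2 (fr g) (fi g) B + h * sqC B).
Proof.
move=> h0 hf hg B.
have LB : L2 B by apply: L2Z; exact: L2B.
have LhB : L2 (h%:C \*o B) by exact: L2Z.
have -> : f = g + h%:C \*o B.
  apply/funext => x; rewrite /B !fctE /= mulrA -rmorphM divff // rmorph1 mul1r.
  by rewrite addrC subrK.
rewrite /sqC /ipC2 frD fiD frZ fiZ.
have E (u v : R -> R) : l2 u -> l2 v ->
    ip (u \+ (h \*o v)) (u \+ (h \*o v)) = ip u u + h * (2 * ip v u + h * ip v v).
  move=> hu hv; have hv' := l2Z h hv.
  rewrite (ipDl hu hv' (l2D hu hv')) (ipDr hu hv' hu) (ipDr hu hv' hv').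
  rewrite (ipZl h hv hu) (ipZl h hv hv') (ipC u (h \*o v)) (ipZl h hv hu) (ipC v (h \*o v)) (ipZl h hv hv).
  by move: (ip u u) (ip v u) (ip v v) => x y z; ring.
rewrite (E _ _ (L2_fr hg) (L2_fr LB)) (E _ _ (L2_fi hg) (L2_fi LB)).
by move: (ip _ _) (ip _ _) (ip _ _) (ip _ _) (ip _ _) (ip _ _) => x1 x2 x3 x4 x5 x6; ring.
Qed.

Lemma sqC_dC0 f g : L2 f -> L2 g -> dC f g = 0 -> sqC f = sqC g.
Proof.
move=> hf hg h0; have [] := dC0_ip hf hg h0 (L2_fr hf).
have [] := dC0_ip hf hg h0 (L2_fr hg); have [] := dC0_ip hf hg h0 (L2_fi hf).
have [] := dC0_ip hf hg h0 (L2_fi hg).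
rewrite /sqC !(ipC (fr g) (fr f)) !(ipC (fi g) (fi f)).
by move=> _ e1 _ e2 e3 _ e4 _; rewrite e4 e2 -e3 -e1.
Qed.

Lemma ipC2_dC0 p q f g : l2 p -> l2 q -> L2 f -> L2 g -> dC f g = 0 -> ipC2 p q f = ipC2 p q g.
Proof.
move=> hp hq hf hg h0; rewrite /ipC2.
by have [-> _] := dC0_ip hf hg h0 hp; have [_ ->] := dC0_ip hf hg h0 hq.
Qed.

Lemma sqC_dist f g : L2 f -> L2 g -> `|sqC f - sqC g| <= dC f g * (2 * nC g + dC f g).
Proof.
move=> hf hg; have h1 := sqC_incr (oner_neq0 R) hf hg.
have e : 1^-1%:C \*o (f - g) = f - g by apply/funext => x; rewrite /= invr1 mul1r.
rewrite /= e mul1r mul1r in h1; have Ld := L2B hf hg.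
have e2 : sqC f - sqC g = 2 * ipC2 (fr g) (fi g) (f - g) + sqC (f - g).
  by rewrite h1 addrC addKr.
have a1 : `|ipC2 (fr g) (fi g) (f - g)| <= dC f g * nC g.
  have := cauchy_schwarz (L2_fr Ld) (L2_fr hg); have := cauchy_schwarz (L2_fi Ld) (L2_fi hg).
  rewrite -/(nC g) /dC /ipC2 /nC.
  have := ler_normD (ip (fr (f - g)) (fr g)) (ip (fi (f - g)) (fi g)).
  have := n2_ge0 (fr (f - g)); have := n2_ge0 (fi (f - g)); have := n2_ge0 (fr g); have := n2_ge0 (fi g).
  move: (n2 _) (n2 _) (n2 _) (n2 _) (ip _ _) (ip _ _) => x1 x2 x3 x4 y1 y2.
  move: `|y1 + y2| `|y1| `|y2| => z z1 z2; nra.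
have a2 := sqC_le_nC (f - g); rewrite -/(dC f g) in a2.
have a3 := sqC_ge0 (f - g).
rewrite e2; apply: (le_trans (ler_normD _ _)); rewrite normrM (ger0_norm a3) ger0_norm //.
move: a1 a2; move: (`|_|) (sqC _) (dC f g) (nC g) => x y z w; nra.
Qed.

End Functional.

Lemma divMK {R : realType} (x c y : R) : y != 0 -> x / (c * y) * y = x / c.
Proof. by move=> y0; rewrite invfM mulrA mulfVK. Qed.

(** * Contraction property of the group forward in time *)

Section Contraction.
Context {R : realType}.
Local Open Scope complex_scope.
Implicit Types (f g q z : R -> R[i]) (c t h : R).
Variables (a : R -> R) (S : R -> (R -> R[i]) -> (R -> R[i])).
Hypotheses (a_pC : pC a) (a_ge0 : forall x, 0 <= a x) (HS : damped_schrodinger_group a S).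
Let A := schrodinger_op a.

(** The term i d_x^2 is skew-adjoint for the real inner product and contributes 0; what remains is
    minus the integral of a |z|^2. *)
Lemma A_dissip z : Hs 2 z -> ipC2 (fr z) (fi z) (A z) <= 0.
Proof.
move=> /Hs2_wd[hz hw hw2]; have Lw := weak_L2 hw; have Lw2 := weak_L2 hw2.
have [r1 s1] := weak_wdF hz hw; have [r2 s2] := weak_wdF Lw hw2.
rewrite /ipC2 fr_A fi_A.
have lr := L2_fr hz; have ls := L2_fi hz.
have lr2 := L2_fr Lw2; have ls2 := L2_fi Lw2.
have lar := pCl2_l2 a_pC lr; have las := pCl2_l2 a_pC ls.
rewrite (ipBl (l2N ls2) lar lr) (ipBl lr2 las ls) (ipNl ls2 lr).
have e1 := wdF_ibp r1 s2; have e2 := wdF_ibp s1 r2.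
rewrite (ipC _ (fr z)) e1 (ipC _ (fi z)) e2 (ipC (fi (wderiv z))).
have p (v : R -> R) : 0 <= ip (a \* v) v.
  rewrite ipE; apply: tint_ge0 => x _ /=; rewrite -mulrA mulr_ge0 //.
  by rewrite -expr2 sqr_ge0.
have := p (fr z); have := p (fi z).
move: (ip (a \* fr z) (fr z)) (ip (a \* fi z) (fi z)) (ip (fr (wderiv z)) (fi (wderiv z))) => x y w.
move=> y0 x0; rewrite opprK addrACA subrr add0r -opprD oppr_le0; exact: addr_ge0.
Qed.

Lemma sqC_S_continuous q : L2 q -> continuous (fun t => sqC (S t q)).
Proof.
move=> hq t; apply/subr_cvg0; apply/norm_cvg0P.
have c := S_cont HS t hq.
apply: (@cvg0_le _ _ _ _ _ (fun s => dC (S s q) (S t q) * (2 * nC (S t q) + dC (S s q) (S t q)))).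
- by move=> s; exact: normr_ge0.
- by apply: nearW => s; apply: sqC_dist; exact: (S_L2 HS).
- have c1 : (2 * nC (S t q) + dC (S s q) (S t q)) @[s --> t] --> 2 * nC (S t q) + 0.
    by apply: cvgD; [exact: cvg_cst | exact: c].
  have c2 : (dC (S s q) (S t q) * (2 * nC (S t q) + dC (S s q) (S t q))) @[s --> t] --> 0 * (2 * nC (S t q) + 0).
    exact: (cvgM c c1).
  by rewrite mul0r in c2; exact: c2.
Qed.

Lemma ipC2_S_continuous p1 p2 q : l2 p1 -> l2 p2 -> L2 q -> continuous (fun t => ipC2 p1 p2 (S t q)).
Proof.
move=> h1 h2 hq t; apply/subr_cvg0; apply/norm_cvg0P.
have c := S_cont HS t hq.
apply: (@cvg0_le _ _ _ _ _ (fun s => dC (S s q) (S t q) * (n2 p1 + n2 p2))).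
- by move=> s; exact: normr_ge0.
- by apply: nearW => s; apply: ipC2_dist => //; exact: (S_L2 HS).
- have c2 : (dC (S s q) (S t q) * (n2 p1 + n2 p2)) @[s --> t] --> 0 * (n2 p1 + n2 p2).
    by apply: cvgMl; exact: c.
  by rewrite mul0r in c2; exact: c2.
Qed.

Lemma gen_near z (e : R) : Hs 2 z -> 0 < e -> exists2 h0 : R, 0 < h0 & forall h, 0 < h < h0 ->
  dC (h^-1%:C \*o (S h z - z)) (A z) <= e.
Proof.
move=> hz e0; have c := gen_cvg a_pC HS hz.
have /c[d /= d0 hd] : \forall x \near (0 : R), x <= e.
  exists e => //= x; rewrite /= sub0r normrN => /ltW; exact: le_trans (ler_norm x).
exists d => // h /andP[h0 hh]; apply: hd => /=; last by rewrite gt_eqF.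
by rewrite sub0r normrN gtr0_norm.
Qed.

(** On H^2 the squared norm has right slope 2 [ipC2 (fr z) (fi z) (A z)], which is nonpositive by
    [A_dissip], so [dini_le] applies with slope 0. *)
Lemma sqC_S_Hs2 q t : Hs 2 q -> 0 <= t -> sqC (S t q) <= sqC q.
Proof.
move=> hq t0; have Lq := Hs_L2 hq.
rewrite -(sqC_dC0 (S_L2 HS 0 Lq) Lq (S_0 HS Lq)).
have := @dini_le R (fun t => sqC (S t q)) 0 0 t t0 (sqC_S_continuous Lq).
rewrite mulr0 addr0; apply => s _ eta eta0; rewrite add0r.
have hz := S_Hs2 a_pC HS s hq; have Lz := Hs_L2 hz; have LA := A_L2 a_pC hz.
set z := S s q in hz Lz LA *.
set K := n2 (fr z) + n2 (fi z); set N := nC (A z) + 1.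
have K0 : 0 <= K by exact: nC_ge0.
have N0 : 0 <= N by rewrite addr_ge0 ?nC_ge0.
(* Half of eta pays for replacing the difference quotient by the generator; the other half pays for
   the quadratic term [h * sqC B], which is bounded because e <= 1. *)
have [e [e0 e1 e2]] : exists e : R, [/\ 0 < e, e <= 1 & 2 * (e * K) <= eta / 2].
  exists (Num.min 1 (eta / (4 * (K + 1)))); have p : 0 < eta / (4 * (K + 1)).
    by rewrite divr_gt0 // mulr_gt0 // ltr_wpDl.
  split; [by rewrite lt_min ltr01 p | by rewrite ge_min lexx |].
  apply: (@le_trans _ _ (2 * (eta / (4 * (K + 1)) * (K + 1)))).
    rewrite ler_pM2l //; apply: ler_pM => //; first by rewrite le_min ler01 ltW.
    - by rewrite ge_min lexx orbT.
    - by rewrite lerDl.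
  rewrite divMK ?gt_eqF // ?ltr_wpDl //.
  by move: (eta) => y; lra.
have [h0 h00 H] := gen_near hz e0.
exists (Num.min h0 (eta / (2 * (N ^+ 2 + 1)))).
  rewrite lt_min h00 divr_gt0 // mulr_gt0 // ltr_wpDl //; exact: sqr_ge0.
move=> h /andP[hp]; rewrite lt_min => /andP[hh0 hh].
have /H hB : 0 < h < h0 by rewrite hp.
have hn : h != 0 by rewrite gt_eqF.
have Lh := S_L2 HS h Lz; have LB := L2Z h^-1 (L2B Lh Lz).
have e3 : sqC (S (s + h) q) = sqC (S h z).
  rewrite addrC; exact: (sqC_dC0 (S_L2 HS _ Lq) Lh (S_add HS h s Lq)).
rewrite e3 (sqC_incr hn Lh Lz); set B := _ \*o _ in hB LB *.
rewrite lerD2l ler_pM2l //.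
have i1 : ipC2 (fr z) (fi z) B <= e * K.
  apply: (le_trans (ipC2_le (L2_fr Lz) (L2_fi Lz) LB LA)).
  rewrite -[leRHS]add0r; apply: lerD; first exact: A_dissip.
  by apply: ler_wpM2r.
have i2 : sqC B <= N ^+ 2.
  apply: (le_trans (sqC_le_nC B)); rewrite ler_pXn2r // ?nnegrE ?nC_ge0 //.
  apply: (le_trans (nC_le LB LA)); rewrite lerD2l; exact: le_trans hB e1.
have i3 : h * sqC B <= eta / 2.
  apply: (@le_trans _ _ (eta / (2 * (N ^+ 2 + 1)) * (N ^+ 2 + 1))).
    apply: ler_pM; [exact: ltW | exact: sqC_ge0 | exact: ltW |].
    by rewrite (le_trans i2) // lerDl.
  by rewrite divMK // gt_eqF // ltr_wpDl // sqr_ge0.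
rewrite [leRHS]splitr; apply: lerD => //; apply: le_trans e2.
by rewrite ler_pM2l.
Qed.

(** The definition of a group bounds each S t by its own constant. Density of H^2 extends
    contraction to L^2 with a constant independent of t; the factor 2 comes from using [nC]. *)
Lemma S_contr f t : L2 f -> 0 <= t -> nC (S t f) <= 2 * nC f.
Proof.
move=> hf t0; have [M M0 hM] := S_bd HS t.
suff K (e : R) : 0 < e -> nC (S t f) <= 2 * nC f + e by apply/ler_addgt0Pr => e e0; exact: K.
move=> e0.
have d0 : 0 < e / (2 + M) by rewrite divr_gt0 // ltr_pwDl.
have [q [hq Lq dq]] := trig_denseC hf d0.
have LSf := S_L2 HS t hf; have LSq := S_L2 HS t Lq.
have i1 : nC (S t q) <= 2 * nC q.
  rewrite -(@ler_pXn2r _ 2) ?nnegrE ?nC_ge0 ?mulr_ge0 ?nC_ge0 //.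
  apply: (le_trans (nC_le_sqC _)); rewrite exprMn.
  have := sqC_S_Hs2 hq t0; have := sqC_le_nC q.
  move: (sqC (S t q)) (sqC q) (nC q ^+ 2) (sqC_ge0 q) => x y w; lra.
have i2 : nC q <= nC f + dC f q by rewrite dC_sym; exact: nC_le.
have i3 := nC_le LSf LSq; have i4 := hM _ _ hf Lq.
have i5 : (2 + M) * dC f q <= e.
  by rewrite -(@ler_pdivlMl _ (2 + M)) ?ltr_pwDl // mulrC.
move: i1 i2 i3 i4 i5; move: (nC (S t f)) (nC (S t q)) (nC q) (nC f) (dC f q) (dC (S t f) (S t q)).
clear => x y w v d d'. rewrite (mulrDl 2 M d); move: (M * d) => Md; lra.
Qed.

Lemma dC_S f g t : L2 f -> L2 g -> 0 <= t -> dC (S t f) (S t g) <= 2 * dC f g.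
Proof.
move=> hf hg t0; have Ld := L2B hf hg.
have := nC_le (L2B (S_L2 HS t hf) (S_L2 HS t hg)) (S_L2 HS t Ld).
rewrite dC_sym (S_linB HS t hf hg) addr0 => h; apply: (le_trans h).
exact: S_contr.
Qed.

Lemma S_right f (e : R) : L2 f -> 0 < e -> exists2 h0 : R, 0 < h0 & forall h, 0 <= h < h0 ->
  dC (S h f) f <= e.
Proof.
move=> hf e0; have c := S_cont0 HS hf.
have /c[d /= d0 hd] : \forall x \near (0 : R), x <= e.
  by exists e => //= x; rewrite /= sub0r normrN => /ltW; exact: le_trans (ler_norm x).
by exists d => // h /andP[h0 hh]; apply: hd => /=; rewrite sub0r normrN ger0_norm.
Qed.

End Contraction.

Lemma small_factor {R : realType} (K eta : R) : 0 <= K -> 0 < eta -> exists2 e : R, 0 < e & e * K <= eta.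
Proof.
move=> K0 eta0; have K1 : 0 < K + 1 by rewrite ltr_wpDl.
exists (eta / (K + 1)); first by rewrite divr_gt0.
apply: (@le_trans _ _ (eta / (K + 1) * (K + 1))); last by rewrite mulfVK // gt_eqF.
by rewrite ler_wpM2l ?lerDl // ltW // divr_gt0.
Qed.

Lemma weak_arith {R : realType} (x1 x2 x3 x4 x5 h d e K P : R) :
  x1 <= x2 + 2 * d * P -> x3 <= x4 + d * P -> x2 <= x3 + h * (x5 + (2 * d + e) * K) ->
  x1 <= x4 + h * (x5 + e * K) + d * (3 * P + h * (2 * K)).
Proof.
have -> : h * (x5 + (2 * d + e) * K) = h * (x5 + e * K) + d * (h * (2 * K)) by ring.
have -> : d * (3 * P + h * (2 * K)) = 3 * (d * P) + d * (h * (2 * K)) by ring.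
rewrite -(mulrA 2 d P).
move: (h * (_ + _)) (d * P) (d * _) => y1 y2 y3; lra.
Qed.

(** * The linear flow tested against smooth functions *)

Section WeakEquation.
Context {R : realType}.
Local Open Scope complex_scope.
Implicit Types (f g q z : R -> R[i]) (c t h : R).
Variables (a : R -> R) (S : R -> (R -> R[i]) -> (R -> R[i])).
Hypotheses (a_pC : pC a) (a_ge0 : forall x, 0 <= a x) (HS : damped_schrodinger_group a S).
Variables p1 p1' p1'' p2 p2' p2'' : R -> R.
Hypotheses (hp1 : pC1 p1 p1') (hp1' : pC1 p1' p1'') (hp2 : pC1 p2 p2') (hp2' : pC1 p2' p2'').
Let A := schrodinger_op a.
(** [d1] and [d2] are the real and imaginary parts of the adjoint operator - i d_x^2 - a applied to
    p1 + i p2. *)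
Let d1 := p2'' \- (a \* p1).
Let d2 := (\- p1'') \- (a \* p2).
Let l1 : l2 p1 := pC_l2 (pC1_pC hp1).
Let l2' : l2 p2 := pC_l2 (pC1_pC hp2).

Lemma d1_l2 : l2 d1.
Proof. by apply: pC_l2; apply: pCB; [exact: pC1_pC' hp2' | apply: pCM => //; exact: pC1_pC hp1]. Qed.
Lemma d2_l2 : l2 d2.
Proof. by apply: pC_l2; apply: pCB; [apply: pCN; exact: pC1_pC' hp1' | apply: pCM => //; exact: pC1_pC hp2]. Qed.

Lemma ipC2_A z : Hs 2 z -> ipC2 p1 p2 (A z) = ipC2 d1 d2 z.
Proof.
move=> /Hs2_wd[hz hw hw2]; have Lw := weak_L2 hw; have Lw2 := weak_L2 hw2.
have [r1 s1] := weak_wdF hz hw; have [r2 s2] := weak_wdF Lw hw2.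
rewrite /ipC2 fr_A fi_A.
have lr := L2_fr hz; have ls := L2_fi hz.
have lr2 := L2_fr Lw2; have ls2 := L2_fi Lw2.
have lar := pCl2_l2 a_pC lr; have las := pCl2_l2 a_pC ls.
have lap1 := pCl2_l2 a_pC l1; have lap2 := pCl2_l2 a_pC l2'.
have lp1 := pC_l2 (pC1_pC' hp1'); have lp2 := pC_l2 (pC1_pC' hp2').
rewrite (ipBl (l2N ls2) lar l1) (ipBl lr2 las l2') (ipNl ls2 l1).
rewrite (ipBr lp2 lap1 lr) (ipBr (l2N lp1) lap2 ls) (ipNr lp1 ls).
have e (w w1 w2 p p' p'' : R -> R) : wdF w w1 -> wdF w1 w2 -> pC1 p p' -> pC1 p' p'' -> ip w2 p = ip w p''.
  move=> h1 h2 /pC1_wdF h3 /pC1_wdF h4.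
  by rewrite (wdF_ibp h1 h4) ipC (wdF_ibp h3 h2) (ipC p').
rewrite (e _ _ _ _ _ _ r1 r2 hp2 hp2') (e _ _ _ _ _ _ s1 s2 hp1 hp1').
have e2 (v p : R -> R) : ip (a \* v) p = ip v (a \* p).
  by rewrite !ipE; congr (torus_int _); apply/funext => x /=; rewrite mulrCA mulrA.
rewrite (e2 (fr z)) (e2 (fi z)).
move: (ip (fr z) p2'') (ip (fr z) (a \* p1)) (ip (fi z) p1'') (ip (fi z) (a \* p2)) => x1 x2 x3 x4.
by clear; ring.
Qed.

(** The orbit of an L^2 function need not be differentiable, but the generator can be moved onto the
    test functions. An H^2 approximation q of g is followed over [0, h] by [dini_le], and then q
    tends to g with h fixed. *)
Lemma S_weak_le g (eta : R) : L2 g -> 0 < eta -> exists2 h0 : R, 0 < h0 & forall h, 0 < h < h0 ->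
  ipC2 p1 p2 (S h g) <= ipC2 p1 p2 g + h * (ipC2 d1 d2 g + eta).
Proof.
move=> Lg eta0; have ld1 := d1_l2; have ld2 := d2_l2.
set K := n2 d1 + n2 d2; set P := n2 p1 + n2 p2.
have K0 : 0 <= K by rewrite addr_ge0 // n2_ge0.
have P0 : 0 <= P by rewrite addr_ge0 // n2_ge0.
have [e e0 he] := small_factor K0 eta0.
have [h0 h00 H] := S_right HS Lg e0.
exists h0 => // h /andP[hp hh].
have C0 : 0 <= 3 * P + h * (2 * K) by rewrite addr_ge0 // mulr_ge0 ?mulr_ge0 // ltW.
(* The approximation distance [d] is chosen after [h], so its term can be made to vanish at fixed
   [h]. *)
suff F (d : R) : 0 < d -> ipC2 p1 p2 (S h g) <=
    ipC2 p1 p2 g + h * (ipC2 d1 d2 g + e * K) + d * (3 * P + h * (2 * K)).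
  apply: (@le_trans _ _ (ipC2 p1 p2 g + h * (ipC2 d1 d2 g + e * K))); last first.
    by rewrite lerD2l ler_pM2l // lerD2l.
  apply/ler_addgt0Pr => d d0; have [d' d'0 hd'] := small_factor C0 d0.
  by apply: (le_trans (F _ d'0)); rewrite lerD2l.
move=> dp; have [q [hq Lq dq]] := trig_denseC Lg dp.
have LSg := S_L2 HS h Lg; have LSq := S_L2 HS h Lq.
have b1 : ipC2 p1 p2 (S h g) <= ipC2 p1 p2 (S h q) + 2 * d * P.
  apply: (le_trans (ipC2_le l1 l2' LSg LSq)); rewrite lerD2l; apply: ler_wpM2r => //.
  apply: (le_trans (dC_S a_pC a_ge0 HS Lg Lq (ltW hp))).
  by rewrite ler_pM2l.
have b2 : ipC2 p1 p2 (S 0 q) <= ipC2 p1 p2 g + d * P.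
  rewrite (ipC2_dC0 l1 l2' (S_L2 HS 0 Lq) Lq (S_0 HS Lq)).
  apply: (le_trans (ipC2_le l1 l2' Lq Lg)); rewrite lerD2l dC_sym.
  exact: ler_wpM2r.
have b3 : ipC2 p1 p2 (S h q) <= ipC2 p1 p2 (S 0 q) + (h - 0) * (ipC2 d1 d2 g + (2 * d + e) * K).
  apply: (@dini_le R (fun t => ipC2 p1 p2 (S t q)) _ _ _ (ltW hp) (ipC2_S_continuous HS l1 l2' Lq)).
  move=> s /andP[s0 sh] eta' eta'0.
  have hz := S_Hs2 a_pC HS s hq; have Lz := Hs_L2 hz; have LA := A_L2 a_pC hz.
  have [e' e'0 he'] := small_factor P0 eta'0.
  have [h1 h10 H1] := gen_near a_pC HS hz e'0.
  exists h1 => // h' /andP[h'0 h'1].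
  have /H1 hB : 0 < h' < h1 by rewrite h'0.
  have hn : h' != 0 by rewrite gt_eqF.
  have Lh := S_L2 HS h' Lz; have LB := L2Z h'^-1 (L2B Lh Lz).
  have e3 : ipC2 p1 p2 (S (s + h') q) = ipC2 p1 p2 (S h' (S s q)).
    by rewrite addrC; exact: (ipC2_dC0 l1 l2' (S_L2 HS _ Lq) Lh (S_add HS h' s Lq)).
  rewrite e3 (ipC2_incr hn l1 l2' Lh Lz) lerD2l ler_pM2l //.
  apply: (le_trans (ipC2_le l1 l2' LB LA)); apply: lerD; last first.
    by apply: le_trans he'; exact: ler_wpM2r.
  rewrite (ipC2_A hz); apply: (le_trans (ipC2_le ld1 ld2 Lz Lg)).
  rewrite lerD2l; apply: ler_wpM2r => //.
  have LSsg := S_L2 HS s Lg.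
  apply: (le_trans (dC_tri Lz LSsg Lg)); apply: lerD; last by apply: H; rewrite s0 (lt_trans sh).
  apply: (le_trans (dC_S a_pC a_ge0 HS Lq Lg s0)).
  by rewrite ler_pM2l // dC_sym.
rewrite subr0 in b3; exact: (weak_arith b1 b2 b3).
Qed.

End WeakEquation.

(** * Riemann sums and the Duhamel formula *)

Section Sums.
Context {R : realType}.
Local Open Scope complex_scope.
Implicit Types (f g : nat -> R -> R[i]).

Lemma L2_0 : L2 (0 : R -> R[i]).
Proof. exact: (L2_mkC (pC_cst 0) (pC_cst 0)). Qed.

Lemma L2_sum n f : (forall k, (k < n)%N -> L2 (f k)) -> L2 (\sum_(k < n) f k).
Proof.
elim: n => [|n ih] hf; first by rewrite big_ord0; exact: L2_0.
rewrite big_ord_recr; apply: L2D; last exact: hf.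
by apply: ih => k kn; apply: hf; exact: ltnW.
Qed.

Lemma dC_sum n f g : (forall k, (k < n)%N -> L2 (f k)) -> (forall k, (k < n)%N -> L2 (g k)) ->
  dC (\sum_(k < n) f k) (\sum_(k < n) g k) <= \sum_(k < n) dC (f k) (g k).
Proof.
elim: n => [|n ih] hf hg; first by rewrite !big_ord0 dC_refl.
have hf' k : (k < n)%N -> L2 (f k) by move=> kn; apply: hf; exact: ltnW.
have hg' k : (k < n)%N -> L2 (g k) by move=> kn; apply: hg; exact: ltnW.
rewrite !big_ord_recr; apply: (le_trans (dCD _ _ _ _)).
- exact: L2_sum.
- exact: hf.
- exact: L2_sum.
- exact: hg.
- by rewrite lerD2r; exact: ih.
Qed.

End Sums.

Lemma third_arith {R : realType} (x y z e : R) : x <= 2 * y -> y <= e / 3 -> z <= e / 3 -> x + z <= e.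
Proof. lra. Qed.

Lemma duhamel_arith {R : realType} (x1 x3 x4 x5 x6 x7 d e : R) : x1 <= d / 3 -> x3 <= 2 * (d / 3) ->
  x4 <= 0 -> x5 <= e -> x6 <= x7 + x5 -> x7 <= x4 + x3 -> x1 + x6 <= e + d.
Proof. lra. Qed.

Section Duhamel.
Context {R : realType}.
Local Open Scope complex_scope.
Variables (a : R -> R) (S : R -> (R -> R[i]) -> (R -> R[i])).
Hypotheses (a_pC : pC a) (a_ge0 : forall x, 0 <= a x) (HS : damped_schrodinger_group a S).

Lemma S_i t (f : R -> R[i]) : L2 f -> dC (S t ('i \*o f)) ('i \*o S t f) = 0.
Proof.
move=> hf; case: (HS) => -[_ lin _ _ _] _; have L0 := @L2_0 R.
have Lif := L2_i hf; have LS := L2_i (S_L2 HS t hf); have LS0 := S_L2 HS t L0.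
have e0 (v : R -> R[i]) : v + 0 = v by exact: addr0.
have h1 := normL20_dC (S_L2 HS t (L2D Lif L0)) (L2D LS LS0) (lin t 'i f 0 hf L0).
rewrite e0 in h1.
apply: (dC_eq0_trans (S_L2 HS t Lif) (L2D LS LS0) LS h1).
have s0 : dC (S t 0) 0 = 0.
  have h2 := S_linB HS t L0 L0.
  by rewrite !subrr in h2.
apply/eqP; rewrite eq_le dC_ge0 andbT.
have h3 : dC ('i \*o S t f + S t 0) ('i \*o S t f + 0) <= 0.
  by apply: (le_trans (dCD LS LS0 LS L0)); rewrite dC_refl s0 addr0.
by rewrite e0 in h3.
Qed.

Lemma S_sum t n (c : nat -> R) (f : nat -> R -> R[i]) : (forall k, (k < n)%N -> L2 (f k)) ->
  dC (S t (\sum_(k < n) ((c k)%:C \*o f k))) (\sum_(k < n) ((c k)%:C \*o S t (f k))) = 0.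
Proof.
elim: n => [|n ih] hf.
  rewrite !big_ord0; have L0 := @L2_0 R.
  have h2 := S_linB HS t L0 L0.
  by rewrite !subrr in h2.
have hf' k : (k < n)%N -> L2 (f k) by move=> kn; apply: hf; exact: ltnW.
have hn : L2 (f n) by exact: hf.
have Ls : L2 (\sum_(k < n) ((c k)%:C \*o f k)) by apply: (@L2_sum _ _ (fun k => (c k)%:C \*o f k)) => k kn; apply: L2Z; exact: hf'.
have LS : L2 (\sum_(k < n) ((c k)%:C \*o S t (f k))).
  by apply: (@L2_sum _ _ (fun k => (c k)%:C \*o S t (f k))) => k kn; apply: L2Z; apply: (S_L2 HS); exact: hf'.
rewrite !big_ord_recr /= addrC [X in dC _ X]addrC.
have h1 := S_linZ HS t (c n) hn Ls.
have LcS := L2Z (c n) (S_L2 HS t hn).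
apply: (dC_eq0_trans _ (L2D LcS (S_L2 HS t Ls)) _ h1).
- by apply: (S_L2 HS); apply: L2D => //; exact: L2Z.
- exact: L2D.
- apply/eqP; rewrite eq_le dC_ge0 andbT.
  apply: (le_trans (dCD LcS (S_L2 HS t Ls) LcS LS)).
  by rewrite dC_refl ih // addr0.
Qed.

Variables (F : R -> R -> R[i]) (J : R -> R -> R[i]).
Hypotheses (FL2 : forall t : R, 0 <= t -> L2 (F t))
  (Fr : forall t e : R, 0 <= t -> 0 < e -> exists2 h0 : R, 0 < h0 & forall h : R, 0 <= h < h0 -> dC (F (t + h)) (F t) <= e)
  (HJ : forall t : R, 0 <= t -> is_L2_integral (fun tau => S (t - tau) (F tau)) 0 t (J t)).

Lemma J_approx (t e : R) : 0 <= t -> 0 < e -> exists2 delta : R, 0 < delta &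
    forall (n : nat) (sigma : nat -> R),
      sigma 0%N = 0 -> sigma n = t ->
      (forall k, (k < n)%N -> 0 <= sigma k.+1 - sigma k < delta) ->
      (forall k, (k < n)%N -> 0 <= sigma k) ->
      dC (\sum_(k < n) ((sigma k.+1 - sigma k)%:C \*o S (t - sigma k) (F (sigma k)))) (J t) <= e.
Proof.
move=> t0 e0; have [LJ H] := HJ t0; have e2 : 0 < e / 2 by rewrite divr_gt0.
have [d d0 hd] := H _ e2; exists d => // n sg s0 sn hs sp.
have hk k : (k < n)%N -> sg k <= sg k <= sg k.+1 /\ sg k.+1 - sg k < d.
  by move=> kn; have /andP[h1 h2] := hs k kn; rewrite lexx -subr_ge0 h1.
have h := ltW (hd n sg sg s0 sn hk); apply: (le_trans (dC_normL2 _ LJ)); last first.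
  by rewrite -ler_pdivlMl // mulrC; exact: h.
apply: (@L2_sum _ _ (fun k => (sg k.+1 - sg k)%:C \*o S (t - sg k) (F (sg k)))) => k kn.
by apply: L2Z; apply: (S_L2 HS); apply: FL2; exact: sp.
Qed.

(** A partition of [0, t + h] made of n equal steps up to t followed by n equal steps up to t + h;
    truncated subtraction makes [k - n] vanish on the first block. *)
Lemma part_eval (t h : R) n k : (0 < n)%N ->
  let sg k := t / n%:R * (minn k n)%:R + h / n%:R * (k - n)%:R : R in
  ((k < n)%N -> sg k = t / n%:R * k%:R /\ sg k.+1 - sg k = t / n%:R) /\
  (sg (n + k)%N = t + h / n%:R * k%:R /\ sg (n + k).+1 - sg (n + k)%N = h / n%:R).
Proof.
move=> n0 sg; have nn : (n%:R : R) != 0 by rewrite pnatr_eq0 -lt0n.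
have e1 j : (j <= n)%N -> sg j = t / n%:R * j%:R.
  by move=> jn; rewrite /sg (minn_idPl jn) (eqP (_ : (j - n == 0)%N)) ?subn_eq0 // mulr0 addr0.
have e2 j : sg (n + j)%N = t + h / n%:R * j%:R.
  by rewrite /sg (minn_idPr (leq_addr j n)) addKn divfK.
split; first by move=> kn; rewrite !e1 ?(ltnW kn) //; split => //; rewrite -mulrBr -natrB // subSnn mulr1.
by rewrite -addnS !e2; split => //; rewrite opprD addrACA subrr add0r -mulrBr -natrB // subSnn mulr1.
Qed.

Lemma sum_cstC (h : R) n (G : R -> R[i]) : (0 < n)%N ->
  \sum_(k < n) ((h / n%:R)%:C \*o G) = h%:C \*o G.
Proof.
move=> n0; apply/funext => x; rewrite fct_sumE /= sumr_const card_ord -mulrnAl -rmorphMn.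
by rewrite -mulr_natr mulfVK // pnatr_eq0 -lt0n.
Qed.

(** On a partition passing through t, the first block of the Riemann sum for J (t + h) is S h
    applied to a Riemann sum for J t. In the second block each integrand is close to F t, by right
    continuity of F and strong continuity of the group. *)
Lemma duhamel (t eta : R) : 0 <= t -> 0 < eta -> exists2 h0 : R, 0 < h0 & forall h : R, 0 < h < h0 ->
  dC (J (t + h)) (S h (J t) + h%:C \*o F t) <= h * eta.
Proof.
move=> t0 eta0; have e0 : 0 < eta / 3 by rewrite divr_gt0.
have LF := FL2 t0.
have [h1 h10 H1] := Fr t0 e0; have [h2 h20 H2] := S_right HS LF e0.
exists (Num.min h1 h2); first by rewrite lt_min h10.
move=> h /andP[hp]; rewrite lt_min => /andP[hh1 hh2].
have th0 : 0 <= t + h by rewrite addr_ge0 // ltW.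
have [LJh _] := HJ th0; have [LJt _] := HJ t0.
have LSJ := S_L2 HS h LJt; have LhF := L2Z h LF.
(* [d] measures the Riemann sum errors at fixed h: d/3 for J (t + h), and 2 d/3 for J t after
   applying S h. *)
apply/ler_addgt0Pr => d d0; have d7 : 0 < d / 3 by rewrite divr_gt0.
have [de1 de10 A1] := J_approx th0 d7; have [de2 de20 A2] := J_approx t0 d7.
(* One n makes both meshes t/n and h/n finer than the two thresholds. *)
have [n n0 [nt nh]] : exists2 n, (0 < n)%N & (t / n%:R < Num.min de1 de2 /\ h / n%:R < Num.min de1 de2).
  have dm : 0 < Num.min de1 de2 by rewrite lt_min de10.
  exists (Num.truncn ((t + h) / Num.min de1 de2)).+1 => //.
  have q : (t + h) / Num.min de1 de2 < (Num.truncn ((t + h) / Num.min de1 de2)).+1%:R by exact: truncnS_gt.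
  move: q; set N := _.+1%:R; have N0 : 0 < N :> R by rewrite ltr0n.
  rewrite ltr_pdivrMr // => q; split; rewrite ltr_pdivrMr // mulrC; apply: le_lt_trans q.
    by rewrite lerDl ltW.
  by rewrite lerDr.
pose sg (k : nat) : R := t / n%:R * (minn k n)%:R + h / n%:R * (k - n)%:R.
have P k := @part_eval t h n k n0.
have tn : 0 <= t / n%:R by rewrite divr_ge0.
have hn : 0 <= h / n%:R by rewrite divr_ge0 // ltW.
have sg0 k : 0 <= sg k by rewrite addr_ge0 // mulr_ge0.
have snn : sg (n + n)%N = t + h.
  have [_ [e _]] := P n; apply: (etrans e).
  by rewrite divfK // pnatr_eq0 -lt0n.
have sn : sg n = t.
  by have [_ [e _]] := P 0%N; rewrite mulr0 addr0 addn0 in e.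
have s0 : sg 0%N = 0 by have [/(_ n0)[e _] _] := P 0%N; apply: (etrans e); rewrite mulr0.
have K1 := A1 (n + n)%N sg s0 snn.
have K2 := A2 n sg s0 sn.
rewrite big_split_ord /= in K1.
pose X1 k := (t / n%:R)%:C \*o S (t + h - sg k) (F (sg k)).
pose Y1 k := S (t - sg k) (F (sg k)).
pose X2 k := (h / n%:R)%:C \*o S (t + h - sg (n + k)%N) (F (sg (n + k)%N)).
have LX1 k : L2 (X1 k) by apply: L2Z; apply: (S_L2 HS); exact: FL2.
have LY1 k : L2 (Y1 k) by apply: (S_L2 HS); exact: FL2.
have LX2 k : L2 (X2 k) by apply: L2Z; apply: (S_L2 HS); exact: FL2.
have E1 : \sum_(i < n) (sg i.+1 - sg i)%:C \*o S (t + h - sg i) (F (sg i)) = \sum_(i < n) X1 i.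
  by apply: eq_bigr => i _; have [/(_ (ltn_ord i))[_ ->] _] := P i.
have E2 : \sum_(i < n) (sg (n + i).+1 - sg (n + i)%N)%:C \*o S (t + h - sg (n + i)%N) (F (sg (n + i)%N)) = \sum_(i < n) X2 i.
  by apply: eq_bigr => i _; have [_ [_ ->]] := P i.
have E3 : \sum_(i < n) (sg i.+1 - sg i)%:C \*o S (t - sg i) (F (sg i)) = \sum_(i < n) ((t / n%:R)%:C \*o Y1 i).
  by apply: eq_bigr => i _; have [/(_ (ltn_ord i))[_ ->] _] := P i.
rewrite E1 E2 in K1; rewrite E3 in K2.
have {}K1 : dC (\sum_(i < n) X1 i + \sum_(i < n) X2 i) (J (t + h)) <= d / 3.
  apply: K1 => k kn; last exact: sg0.
  case: (ltnP k n) => kn'.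
    have [/(_ kn')[_ ->] _] := P k; rewrite tn; by apply: (lt_le_trans nt); rewrite ge_min lexx.
  have [_ [_]] := P (k - n)%N; rewrite subnKC // => ->.
  by rewrite hn; by apply: (lt_le_trans nh); rewrite ge_min lexx.
have {}K2 : dC (\sum_(i < n) ((t / n%:R)%:C \*o Y1 i)) (J t) <= d / 3.
  apply: K2 => k kn; last exact: sg0.
  have [/(_ kn)[_ ->] _] := P k; rewrite tn; by apply: (lt_le_trans nt); rewrite ge_min lexx orbT.
have LY : L2 (\sum_(i < n) ((t / n%:R)%:C \*o Y1 i)).
  by apply: (@L2_sum _ n (fun i => (t / n%:R)%:C \*o Y1 i)) => k _; exact: L2Z.
have LsX1 : L2 (\sum_(i < n) X1 i) by apply: L2_sum.
have LsX2 : L2 (\sum_(i < n) X2 i) by apply: L2_sum.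
have LSY := S_L2 HS h LY.
have K3 : dC (S h (\sum_(i < n) ((t / n%:R)%:C \*o Y1 i))) (S h (J t)) <= 2 * (d / 3).
  by apply: (le_trans (dC_S a_pC a_ge0 HS LY LJt (ltW hp))); rewrite ler_pM2l.
have K4 : dC (\sum_(i < n) X1 i) (S h (\sum_(i < n) ((t / n%:R)%:C \*o Y1 i))) <= 0.
  have LSs : L2 (\sum_(i < n) ((t / n%:R)%:C \*o S h (Y1 i))).
    by apply: (@L2_sum _ n (fun i => (t / n%:R)%:C \*o S h (Y1 i))) => k _; apply: L2Z; exact: (S_L2 HS).
  apply: (le_trans (dC_tri LsX1 LSs LSY)).
  rewrite [X in _ + X]dC_sym (@S_sum h n (fun=> t / n%:R) Y1) // addr0.
  apply: (le_trans (@dC_sum _ n X1 (fun i => (t / n%:R)%:C \*o S h (Y1 i)) _ _)) => [k _|k _|].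
  - exact: LX1.
  - by apply: L2Z; exact: (S_L2 HS).
  - rewrite big1 // => i _; rewrite /X1 dCZ; try exact: (S_L2 HS).
      have := S_add HS h (t - sg i) (FL2 (sg0 i)).
      by rewrite addrA [h + t]addrC => ->; rewrite mulr0.
    by apply: (S_L2 HS); exact: FL2.
have K5 : dC (\sum_(i < n) X2 i) (h%:C \*o F t) <= h * eta.
  rewrite -(@sum_cstC h n (F t) n0).
  apply: (le_trans (@dC_sum _ n X2 (fun i => (h / n%:R)%:C \*o F t) _ _)) => [k _|k _|].
  - exact: LX2.
  - exact: L2Z.
  - apply: (@le_trans _ _ (\sum_(i < n) (h / n%:R * eta))); last first.
      rewrite sumr_const card_ord -mulrnAl -mulr_natr mulfVK // pnatr_eq0 -lt0n //.
    apply: ler_sum => i _; have [_ [ei _]] := P i.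
    have LFi := FL2 (sg0 (n + i)%N).
    rewrite /X2 dCZ //; last exact: (S_L2 HS).
    rewrite ger0_norm //; apply: ler_wpM2l => //; rewrite -/(sg _) in ei; rewrite ei in LFi *.
    have ih : 0 <= h / n%:R * i%:R <= h.
      rewrite mulr_ge0 //= -mulrA -[leRHS]mulr1 ler_wpM2l ?(ltW hp) //.
      by rewrite mulrC ler_pdivrMr ?ltr0n // mul1r ler_nat ltnW.
    have /andP[ih0 ih1] := ih.
    rewrite opprD addrACA subrr add0r.
    have hi0 : 0 <= h - h / n%:R * i%:R by rewrite subr_ge0.
    apply: (le_trans (dC_tri (S_L2 HS _ LFi) (S_L2 HS _ LF) LF)).
    have q1 := dC_S a_pC a_ge0 HS LFi LF hi0.
    have q2 : dC (F (t + h / n%:R * i%:R)) (F t) <= eta / 3.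
      by apply: H1; rewrite ih0 (le_lt_trans ih1).
    have q3 : dC (S (h - h / n%:R * i%:R) (F t)) (F t) <= eta / 3.
      by apply: H2; rewrite hi0 (le_lt_trans _ hh2) // gerBl.
    exact: (third_arith q1 q2 q3).
have Lsum := L2D LsX1 LsX2; have Lgoal := L2D LSJ LhF.
apply: (le_trans (dC_tri LJh Lsum Lgoal)).
have K6 := dCD LsX1 LsX2 LSJ LhF.
have K7 := dC_tri LsX1 LSY LSJ.
rewrite [X in X + _]dC_sym.
exact: (duhamel_arith K1 K3 K4 K5 K6 K7).
Qed.

End Duhamel.

Lemma weak_step_arith {R : realType} (x y z h e : R) :
  x + h * (y + e / 2) + h * z + h * (e / 2) = x + h * ((y + z) + e).
Proof. by field. Qed.

Section MildStep.
Context {R : realType}.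
Local Open Scope complex_scope.
Variables (a : R -> R) (S : R -> (R -> R[i]) -> (R -> R[i])).
Hypotheses (a_pC : pC a) (a_ge0 : forall x, 0 <= a x) (HS : damped_schrodinger_group a S).
Variables (F : R -> R -> R[i]) (J : R -> R -> R[i]).
Hypotheses (FL2 : forall t : R, 0 <= t -> L2 (F t))
  (Fr : forall t e : R, 0 <= t -> 0 < e -> exists2 h0 : R, 0 < h0 & forall h : R, 0 <= h < h0 -> dC (F (t + h)) (F t) <= e)
  (HJ : forall t : R, 0 <= t -> is_L2_integral (fun tau => S (t - tau) (F tau)) 0 t (J t)).
Variables (u : R -> R -> R[i]) (u0 : R -> R[i]).
Hypotheses (Lu0 : L2 u0) (Lu : forall t : R, 0 <= t -> L2 (u t))
  (u_eq : forall t : R, 0 <= t -> dC (u t) (S t u0 - 'i \*o J t) = 0).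

(** u (t + h) = S h (u t) - i h F t + o(h): the group law carries S (t + h) u0 back to S h (S t u0),
    and [duhamel] treats the integral. *)
Lemma mild_step (t eta : R) : 0 <= t -> 0 < eta -> exists2 h0 : R, 0 < h0 & forall h : R, 0 < h < h0 ->
  dC (u (t + h)) (S h (u t) - 'i \*o (h%:C \*o F t)) <= h * eta.
Proof.
move=> t0 eta0; have [h0 h00 H] := duhamel a_pC a_ge0 HS FL2 Fr HJ t0 eta0.
exists h0 => // h hh; have /andP[hp _] := hh.
have th0 : 0 <= t + h by rewrite addr_ge0 // ltW.
have [LJh _] := HJ th0; have [LJt _] := HJ t0; have LF := FL2 t0.
have Lut := Lu t0; have LSu := S_L2 HS h Lut.
have LSJ := S_L2 HS h LJt; have LhF := L2Z h LF; have LihF := L2_i LhF.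
have LSthu := S_L2 HS (t + h) Lu0; have LStu := S_L2 HS t Lu0; have LShtu := S_L2 HS h LStu.
have LiJ := L2_i LJt; have LSiJ := S_L2 HS h LiJ; have LiSJ := L2_i LSJ.
have LW := L2B LStu LiJ; have LSW := S_L2 HS h LW.
have LX := L2B LSthu LiSJ; have LY := L2B LShtu LSiJ.
have e1 : dC (S h (u t)) (S h (S t u0 - 'i \*o J t)) = 0.
  apply/eqP; rewrite eq_le dC_ge0 andbT; apply: (le_trans (dC_S a_pC a_ge0 HS Lut LW (ltW hp))).
  by rewrite u_eq // mulr0.
have e2 := S_linB HS h LStu LiJ.
have e3 : dC (S h (S t u0) - S h ('i \*o J t)) (S (t + h) u0 - 'i \*o S h (J t)) = 0.
  apply/eqP; rewrite eq_le dC_ge0 andbT; apply: (le_trans (dCB LShtu LSiJ LSthu LiSJ)).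
  by rewrite (S_i HS h LJt) addr0 dC_sym addrC (S_add HS h t Lu0).
have e4 : dC (S h (u t)) (S (t + h) u0 - 'i \*o S h (J t)) = 0.
  exact: (dC_eq0_trans LSu LY LX (dC_eq0_trans LSu LSW LY e1 e2) e3).
have LZ := L2B LSu LihF; have LZ1 := L2B LX LihF.
have e5 : dC (S (t + h) u0 - 'i \*o S h (J t) - 'i \*o (h%:C \*o F t)) (S h (u t) - 'i \*o (h%:C \*o F t)) <= 0.
  by apply: (le_trans (dCB LX LihF LSu LihF)); rewrite dC_refl addr0 dC_sym e4.
have LiJh := L2_i LJh; have LV := L2B LSthu LiJh.
have LG := L2_i (L2D LSJ LhF).
have e6 : dC (S (t + h) u0 - 'i \*o J (t + h)) (S (t + h) u0 - 'i \*o (S h (J t) + h%:C \*o F t)) <= h * eta.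
  by apply: (le_trans (dCB LSthu LiJh LSthu LG)); rewrite dC_refl add0r dC_i; exact: H.
have e7 : S (t + h) u0 - 'i \*o (S h (J t) + h%:C \*o F t) = S (t + h) u0 - 'i \*o S h (J t) - 'i \*o (h%:C \*o F t).
  apply/funext => x; rewrite !fctE /=.
  by rewrite mulrDr opprD addrA.
rewrite e7 in e6.
apply: (le_trans (dC_tri (Lu th0) LV LZ)); rewrite u_eq // add0r.
apply: (le_trans (dC_tri LV LZ1 LZ)); rewrite -[leRHS]addr0; exact: lerD.
Qed.

Variables p1 p1' p1'' p2 p2' p2'' : R -> R.
Hypotheses (hp1 : pC1 p1 p1') (hp1' : pC1 p1' p1'') (hp2 : pC1 p2 p2') (hp2' : pC1 p2' p2'').

(** Testing [mild_step] combines the linear slope from [S_weak_le] with that of the term - i h F t;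
    each takes half of eta. *)
Lemma mild_weak (t eta : R) : 0 <= t -> 0 < eta -> exists2 h0 : R, 0 < h0 & forall h : R, 0 < h < h0 ->
  ipC2 p1 p2 (u (t + h)) <= ipC2 p1 p2 (u t) + h * ((ipC2 (p2'' \- (a \* p1)) ((\- p1'') \- (a \* p2)) (u t)
    + (ip (fi (F t)) p1 - ip (fr (F t)) p2)) + eta).
Proof.
move=> t0 eta0; have l1 := pC_l2 (pC1_pC hp1); have l2' := pC_l2 (pC1_pC hp2).
have eta2 : 0 < eta / 2 by rewrite divr_gt0.
have P0 : 0 <= n2 p1 + n2 p2 by rewrite addr_ge0 // n2_ge0.
have [e e0 he] := small_factor P0 eta2.
have [h1 h10 H1] := mild_step t0 e0.
have [h2 h20 H2] := S_weak_le a_pC a_ge0 HS hp1 hp1' hp2 hp2' (Lu t0) eta2.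
exists (Num.min h1 h2); first by rewrite lt_min h10.
move=> h /andP[hp]; rewrite lt_min => /andP[hh1 hh2].
have th0 : 0 <= t + h by rewrite addr_ge0 // ltW.
have k1 : dC (u (t + h)) (S h (u t) - 'i \*o (h%:C \*o F t)) <= h * e by apply: H1; rewrite hp.
have k2 := H2 h; rewrite hp hh2 in k2; have {}k2 := k2 isT.
have LF := FL2 t0; have LhF := L2Z h LF; have LihF := L2_i LhF.
have LSu := S_L2 HS h (Lu t0); have LZ := L2B LSu LihF.
have k3 := ipC2_le l1 l2' (Lu th0) LZ.
have k4 : dC (u (t + h)) (S h (u t) - 'i \*o (h%:C \*o F t)) * (n2 p1 + n2 p2) <= h * (eta / 2).
  apply: (@le_trans _ _ (h * e * (n2 p1 + n2 p2))); first exact: ler_wpM2r.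
  by rewrite -mulrA ler_pM2l.
have k5 : ipC2 p1 p2 (S h (u t) - 'i \*o (h%:C \*o F t)) =
   ipC2 p1 p2 (S h (u t)) + h * (ip (fi (F t)) p1 - ip (fr (F t)) p2).
  rewrite /ipC2 frB fiB fr_i fi_i frZ fiZ.
  have lf1 := L2_fr LF; have lf2 := L2_fi LF; have z1 := l2Z h lf1; have z2 := l2Z h lf2.
  rewrite (ipBl (L2_fr LSu) (l2N z2) l1) (ipBl (L2_fi LSu) z1 l2') (ipNl z2 l1).
  rewrite (ipZl h lf2 l1) (ipZl h lf1 l2').
  move: (ip (fr (S h (u t))) p1) (ip (fi (S h (u t))) p2) (ip (fi (F t)) p1) (ip (fr (F t)) p2) => x1 x2 x3 x4.
  by rewrite opprK addrACA -mulrBr.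
rewrite k5 in k3; apply: (le_trans k3); apply: (le_trans (lerD (lerD k2 (lexx _)) k4)).
by rewrite weak_step_arith.
Qed.

End MildStep.

(** * Mild solutions *)

Section Representatives.
Context {R : realType}.
Local Open Scope complex_scope.
Implicit Types (f g : R -> R[i]) (w v : R -> R) (m : nat).
Local Notation mu := (@lebesgue_measure R).

Lemma ae_and (P Q : R -> Prop) : {ae mu, forall x, P x} -> {ae mu, forall x, Q x} -> {ae mu, forall x, P x /\ Q x}.
Proof.
move=> hP hQ; have F := ae_filter_ringOfSetsType mu.
exact: filterI hP hQ.
Qed.

Lemma tint_ae (f g : R -> R) : measurable_fun setT f -> measurable_fun setT g ->
  {ae mu, forall x, period_cell x -> f x = g x} -> torus_int f = torus_int g.
Proof.
move=> mf mg fg; rewrite /torus_int /Rintegral; congr fine.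
apply: ae_eq_integral => //.
- by apply/measurable_EFinP; exact: measurable_funTS.
- by apply/measurable_EFinP; exact: measurable_funTS.
- by apply: (ae_imp fg) => x h Dx /=; rewrite (h Dx).
Qed.

(** For p = 2 m + 1 the factor |f|^(p-1) is the m-th power of |f|^2, free of square roots. *)
Lemma fr_nonlinearity m f : fr (nonlinearity (2 * m).+1 f) = (fun x => rho2 (fr f x) (fi f x) ^+ m) \* fr f.
Proof.
apply/funext => x; rewrite /fr /fi /nonlinearity /= exprM normc_def -rmorphXn sqr_sqrtr ?addr_ge0 ?sqr_ge0 //.
by rewrite -/(rho2 _ _) -rmorphXn mulrC ReMc mulrC.
Qed.

Lemma fi_nonlinearity m f : fi (nonlinearity (2 * m).+1 f) = (fun x => rho2 (fr f x) (fi f x) ^+ m) \* fi f.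
Proof.
apply/funext => x; rewrite /fr /fi /nonlinearity /= exprM normc_def -rmorphXn sqr_sqrtr ?addr_ge0 ?sqr_ge0 //.
by rewrite -/(rho2 _ _) -rmorphXn mulrC ImMc mulrC.
Qed.

Lemma measurable_rho2X m f : L2 f -> measurable_fun setT (fun x => rho2 (fr f x) (fi f x) ^+ m).
Proof.
move=> hf; apply: measurable_funX; apply: measurable_funD; apply: measurable_funX.
- exact: l2_measurable (L2_fr hf).
- exact: l2_measurable (L2_fi hf).
Qed.

Lemma rep_ae f w v : L2 f -> pC w -> pC v -> n2 (w \- fr f) = 0 -> n2 (v \- fi f) = 0 ->
  {ae mu, forall x, period_cell x -> w x = fr f x /\ v x = fi f x}.
Proof.
move=> hf hw hv h1 h2.
have A1 := n2_ae (pC_l2 hw) (L2_fr hf) h1; have A2 := n2_ae (pC_l2 hv) (L2_fi hf) h2.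
by apply: (ae_imp (ae_and A1 A2)) => x [k1 k2] Dx; split; [exact: k1 | exact: k2].
Qed.

(** The nonlinearity is in L^2 because it agrees almost everywhere on the cell with a polynomial in
    continuous representatives, which are bounded. *)
Lemma nonlinearity_rep m f w v : L2 f -> pC w -> pC v -> n2 (w \- fr f) = 0 -> n2 (v \- fi f) = 0 ->
  let F := nonlinearity (2 * m).+1 f in
  [/\ L2 F, n2 (((fun x => rho2 (w x) (v x) ^+ m) \* w) \- fr F) = 0 &
     n2 (((fun x => rho2 (w x) (v x) ^+ m) \* v) \- fi F) = 0].
Proof.
move=> hf hw hv h1 h2 F; have A := rep_ae hf hw hv h1 h2.
have q1 : pC ((fun x => rho2 (w x) (v x) ^+ m) \* w) by rewrite /rho2; pc.
have q2 : pC ((fun x => rho2 (w x) (v x) ^+ m) \* v) by rewrite /rho2; pc.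
have M := measurable_rho2X m hf.
have m1 : measurable_fun setT (fr F).
  rewrite /F fr_nonlinearity; apply: measurable_funM => //; exact: l2_measurable (L2_fr hf).
have m2 : measurable_fun setT (fi F).
  rewrite /F fi_nonlinearity; apply: measurable_funM => //; exact: l2_measurable (L2_fi hf).
have [l1 e1] : l2 (fr F) /\ n2 (((fun x => rho2 (w x) (v x) ^+ m) \* w) \- fr F) = 0.
  apply: (l2_ae (pC_l2 q1) m1); apply: (ae_imp A) => x k Dx; have [k1 k2] := k Dx.
  by rewrite /F fr_nonlinearity /= k1 k2.
have [l2' e2] : l2 (fi F) /\ n2 (((fun x => rho2 (w x) (v x) ^+ m) \* v) \- fi F) = 0.
  apply: (l2_ae (pC_l2 q2) m2); apply: (ae_imp A) => x k Dx; have [k1 k2] := k Dx.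
  by rewrite /F fi_nonlinearity /= k1 k2.
split => //; apply/L2P; split => // x.
by rewrite /F /nonlinearity /= (L2_per hf).
Qed.

Lemma energy_rep m f w v : Hs 1 f -> pC w -> pC v -> n2 (w \- fr f) = 0 -> n2 (v \- fi f) = 0 ->
  energy (2 * m).+1 f = torus_int (fun x => edens m (w x) (fr (wderiv f) x) (v x) (fi (wderiv f) x)).
Proof.
move=> hf hw hv h1 h2; have Lf := Hs_L2 hf; have Ld := weak_L2 (Hs1_wd hf).
have A := rep_ae Lf hw hv h1 h2.
have c2 g : (fun x => cmod (g x) ^+ 2) = (fun x => rho2 (fr g x) (fi g x)).
  by apply/funext => x; rewrite cmod_sqr.
have cm g : (fun x => cmod (g x) ^+ (2 * m).+2) = (fun x => rho2 (fr g x) (fi g x) ^+ m.+1).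
  by apply/funext => x; rewrite -[RHS]/((rho2 (fr g x) (fi g x)) ^+ m.+1) -[rho2 _ _]cmod_sqr -exprM mulnS.
have i1 : intg (fun x => rho2 (w x) (v x)) by apply: pC_intg; rewrite /rho2; pc.
have i3 : intg (fun x => rho2 (w x) (v x) ^+ m.+1) by apply: pC_intg; rewrite /rho2; pc.
have i2 : intg (fun x => rho2 (fr (wderiv f) x) (fi (wderiv f) x)).
  by apply: intgD; apply: l2_intg; [exact: L2_fr | exact: L2_fi].
rewrite /energy !c2 cm.
have e1 : torus_int (fun x => rho2 (fr f x) (fi f x)) = torus_int (fun x => rho2 (w x) (v x)).
  apply: tint_ae.
  - have -> : (fun x => rho2 (fr f x) (fi f x)) = (fun x => rho2 (fr f x) (fi f x) ^+ 1) by [].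
    exact: measurable_rho2X.
  - by apply: cont_measurable; apply: pC_cont; rewrite /rho2; pc.
  - by apply: (ae_imp A) => x k Dx; have [-> ->] := k Dx.
have e3 : torus_int (fun x => rho2 (fr f x) (fi f x) ^+ m.+1) = torus_int (fun x => rho2 (w x) (v x) ^+ m.+1).
  apply: tint_ae.
  - exact: measurable_rho2X.
  - by apply: cont_measurable; apply: pC_cont; rewrite /rho2; pc.
  - by apply: (ae_imp A) => x k Dx; have [-> ->] := k Dx.
rewrite e1 e3 -(tintZ _ i1) -(tintZ _ i2) -(tintZ _ i3).
rewrite -(tintD (intgZ _ i1) (intgZ _ i2)) -(tintD (intgD (intgZ _ i1) (intgZ _ i2)) (intgZ _ i3)).
by congr torus_int; apply/funext => x; rewrite /edens /= addn2.
Qed.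

Lemma fproj_n2 N (f g : R -> R) : l2 f -> l2 g -> n2 (f \- g) = 0 -> fproj N f = fproj N g.
Proof.
move=> hf hg h0; have E h : l2 h -> ip f h = ip g h.
  by move=> hh; apply/eqP; rewrite -subr_eq0 -(ipBl hf hg hh); apply/eqP/n2_eq0_ip => //; exact: l2B.
by apply/funext => x; apply: eq_bigr => k _; rewrite /fterm (E _ (cc_l2 k)) (E _ (ss_l2 k)).
Qed.

Lemma n2_rep (f g f' g' : R -> R) : l2 f -> l2 g -> l2 f' -> l2 g' -> n2 (f' \- f) = 0 -> n2 (g' \- g) = 0 ->
  n2 (f' \- g') = n2 (f \- g).
Proof.
move=> hf hg hf' hg' e1 e2; apply: n2_eq0_l; [exact: l2B | exact: l2B |].
have -> : (f' \- g') \- (f \- g) = (f' \- f) \- (g' \- g) by apply/funext => x /=; ring.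
apply/eqP; rewrite eq_le n2_ge0 andbT.
by have := n2B (l2B hf' hf) (l2B hg' hg); rewrite e1 e2 addr0.
Qed.

Lemma curve_rep (V V' : R -> R -> R) : (forall t, wdF (V t) (V' t)) ->
  (forall t, n2 (V s \- V t) @[s --> t] --> (0 : R)) -> (forall t, n2 (V' s \- V' t) @[s --> t] --> (0 : R)) ->
  exists W, curve W V' /\ forall t, n2 (W t \- V t) = 0.
Proof.
move=> hv cv cv'.
have [W hw] := choice (fun t => wdF_rep (hv t)); exists W.
have lv t := wdF_l2 (hv t).
have lw t : l2 (W t) by apply: pC_l2; have [] := hw t.
have e t : n2 (W t \- V t) = 0 by have [] := hw t.
have e' t : n2 (V t \- W t) = 0 by rewrite n2BC.
split => //; split.
- move=> t; apply: (wdF_ae (hv t) (lw t) (wdF_l2' (hv t)) (e' t)).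
  have -> : V' t \- V' t = (fun=> 0) by apply/funext => x /=; rewrite subrr.
  by rewrite n2E ip0l sqrtr0.
- by move=> t; have [] := hw t.
- move=> t N x; rewrite /fprojerr (fproj_n2 N (lw t) (lv t) (e t)).
  have -> : n2 (fproj N (V t) \- W t) = n2 (fproj N (V t) \- V t).
    apply: n2_rep => //; try exact: fproj_l2.
    have -> : fproj N (V t) \- fproj N (V t) = (fun=> 0) by apply/funext => y /=; rewrite subrr.
    by rewrite n2E ip0l sqrtr0.
  by have [_ _ + _] := hw t; apply.
- move=> t; have -> : (fun s => n2 (W s \- W t)) = (fun s => n2 (V s \- V t)); last exact: cv.
  by apply/funext => s; exact: n2_rep.
- exact: cv'.
Qed.

End Representatives.

Lemma ex_near_right {R : realType} (P : R -> Prop) :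
  (exists2 h0 : R, 0 < h0 & forall h : R, 0 < h < h0 -> P h) -> \forall h \near (0 : R)^'+, P h.
Proof.
move=> [h0 h00 H]; near=> h; apply: H; apply/andP; split.
- by near: h; exact: nbhs_right_gt.
- by near: h; exact: nbhs_right_lt.
Unshelve. all: by end_near. Qed.

Section H1Convergence.
Context {R : realType}.
Local Open Scope complex_scope.
Implicit Types (f g : R -> R[i]).

Lemma weak_derivativeB f g f' g' : L2 f -> L2 g -> weak_derivative f f' -> weak_derivative g g' ->
  weak_derivative (f - g) (f' - g').
Proof.
move=> Lf Lg /weak_derivativeP[Lf' hf] /weak_derivativeP[Lg' hg]; apply/weak_derivativeP.
split; first exact: L2B.
move=> phi sp; have lp := pC_l2 (pC1_pC (smooth_pC1 sp)); have lp' := pC_l2 (pC1_pC' (smooth_pC1 sp)).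
have [e1 e2] := hf _ sp; have [e3 e4] := hg _ sp; rewrite !frB !fiB; split.
- rewrite (ipBl (L2_fr Lf) (L2_fr Lg) lp') (ipBl (L2_fr Lf') (L2_fr Lg') lp) e1 e3.
  by rewrite opprB addrC opprK.
- rewrite (ipBl (L2_fi Lf) (L2_fi Lg) lp') (ipBl (L2_fi Lf') (L2_fi Lg') lp) e2 e4.
  by rewrite opprB addrC opprK.
Qed.

Lemma normH1_ge_L2 f : normL2 f <= normH1 f.
Proof.
rewrite /normH1 -{1}[normL2 f]ger0_norm ?sqrtr_ge0 // -sqrtr_sqr; apply: ler_wsqrtr.
by rewrite lerDl sqr_ge0.
Qed.

Lemma normH1_ge_wderiv f : normL2 (wderiv f) <= normH1 f.
Proof.
rewrite /normH1 -{1}[normL2 (wderiv f)]ger0_norm ?sqrtr_ge0 // -sqrtr_sqr; apply: ler_wsqrtr.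
by rewrite lerDr sqr_ge0.
Qed.

(** [wderiv] picks representatives, so [wderiv (f - g)] equals the difference of the derivatives
    only up to a null function. *)
Lemma dC_H1 f g : Hs 1 f -> Hs 1 g ->
  dC f g <= 2 * normH1 (f - g) /\ dC (wderiv f) (wderiv g) <= 2 * normH1 (f - g).
Proof.
move=> hf hg; have Lf := Hs_L2 hf; have Lg := Hs_L2 hg; have wf := Hs1_wd hf; have wg := Hs1_wd hg.
have Lwf := weak_L2 wf; have Lwg := weak_L2 wg.
split.
  by apply: (le_trans (dC_normL2 Lf Lg)); rewrite ler_pM2l //; exact: normH1_ge_L2.
have w1 := weak_derivativeB Lf Lg wf wg; have w2 := wderivP w1; have Lw2 := weak_L2 w2.
have e0 := weak_unique (L2B Lf Lg) w1 w2.
apply: (le_trans (nC_le (L2B Lwf Lwg) Lw2)); rewrite e0 addr0.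
apply: (le_trans (nC_le_normL2 Lw2)); rewrite ler_pM2l //; exact: normH1_ge_wderiv.
Qed.

Lemma tint_cmodX n f g : L2 f -> L2 g -> dC f g = 0 ->
  torus_int (fun x => cmod (f x) ^+ n.*2) = torus_int (fun x => cmod (g x) ^+ n.*2).
Proof.
move=> hf hg; rewrite dCE => /eqP; rewrite paddr_eq0 ?n2_ge0 // => /andP[/eqP h1 /eqP h2].
have e k : (fun x => cmod (k x) ^+ n.*2) = (fun x : R => rho2 (fr k x) (fi k x) ^+ n).
  by apply/funext => x; rewrite -mul2n exprM cmod_sqr.
rewrite !e; apply: tint_ae; [exact: measurable_rho2X | exact: measurable_rho2X |].
have A1 := n2_ae (L2_fr hf) (L2_fr hg) h1; have A2 := n2_ae (L2_fi hf) (L2_fi hg) h2.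
by apply: (ae_imp (ae_and A1 A2)) => x [k1 k2] Dx; rewrite (k1 Dx) (k2 Dx).
Qed.

(** The energy depends only on the class of the function; needed because u 0 and the datum u0 agree
    only in L^2. *)
Lemma energy_dC m f g : Hs 1 f -> Hs 1 g -> dC f g = 0 -> energy (2 * m).+1 f = energy (2 * m).+1 g.
Proof.
move=> hf hg h0; have Lf := Hs_L2 hf; have Lg := Hs_L2 hg; have wf := Hs1_wd hf; have wg := Hs1_wd hg.
have h1 := weak_unique Lg (weak_dC Lf Lg h0 wf) wg.
have e : (2 * m).+2 = m.+1.*2 by rewrite doubleS mul2n.
rewrite /energy e (tint_cmodX m.+1 Lf Lg h0); have e2 : 2%N = 1.*2 by [].
by rewrite e2 (tint_cmodX 1 Lf Lg h0) (tint_cmodX 1 (weak_L2 wf) (weak_L2 wg) h1).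
Qed.

Lemma cvg_norm_within (P : R -> R) (t l : R) :
  P s @[s --> within [set s : R | 0 <= s] (nbhs `|t|)] --> l -> P `|s| @[s --> t] --> l.
Proof.
move=> h; have k : `|s| @[s --> t] --> within [set s : R | 0 <= s] (nbhs `|t|).
  move=> A /= hA; have c : `|s| @[s --> t] --> `|t| by apply: cvg_norm; exact: cvg_id.
  have K : \forall s \near t, (0 : R) <= `|s| -> A `|s| by exact: (c _ hA).
  change (\forall s \near t, A `|s|).
  by apply: filterS K => s; apply; exact: normr_ge0.
exact: (cvg_comp _ _ k h).
Qed.

End H1Convergence.

(** The weak inequality holds for a test function and for its opposite; together they give the
    two-sided estimate. *)
Lemma sign_le_norm {R : realType} (x x0 h d e : R) :
  1 * x <= 1 * x0 + h * (1 * d + e) -> -1 * x <= -1 * x0 + h * (-1 * d + e) -> `|x - x0 - h * d| <= h * e.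
Proof.
rewrite !mulN1r !mul1r !mulrDr mulrN ler_norml; move: (h * d) (h * e) => y z h1 h2.
by apply/andP; split; lra.
Qed.

Lemma ode_arith {R : realType} (c1 c2 k h e rh sh rt st ra sa g1 g2 : R) :
  c1 * rh + c2 * sh <= c1 * rt + c2 * st + h * (- (c2 * k ^+ 2 * rt) - c1 * ra + (c1 * k ^+ 2 * st - c2 * sa)
    + (c1 * g2 - c2 * g1) + e) ->
  c1 * rh + c2 * sh <= c1 * rt + c2 * st + h * (c1 * (k ^+ 2 * st - (ra - g2)) + c2 * (k ^+ 2 * - rt - (sa + g1)) + e).
Proof. by move=> H; apply: (le_trans H); rewrite le_eqVlt; apply/orP; left; apply/eqP; ring. Qed.

Section MildCurve.
Context {R : realType}.
Local Open Scope complex_scope.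
Variables (m : nat) (a a1 : R -> R) (u0 : R -> R[i]) (u : R -> R -> R[i]).
Hypotheses (ha : pC1 a a1) (a_ge0 : forall x, 0 <= a x) (hu0 : Hs 1 u0) (hu : mild_solution (2 * m).+1 a u0 u).

(* Reflecting time makes the curve two-sidedly continuous at 0. *)
Let U (t : R) := u `|t|.
Let F t := nonlinearity (2 * m).+1 (u t).

Lemma U_Hs t : Hs 1 (U t). Proof. by have [[H _] _] := hu; apply: H; exact: normr_ge0. Qed.
Lemma U_L2 t : L2 (U t). Proof. exact: Hs_L2 (U_Hs t). Qed.
Lemma UE (t : R) : 0 <= t -> U t = u t. Proof. by move=> t0; rewrite /U ger0_norm. Qed.

Lemma U_cvg t : 2 * normH1 (U s - U t) @[s --> t] --> (0 : R).
Proof.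
have [[_ H] _] := hu; have c := cvg_norm_within (H `|t| (normr_ge0 t)).
have c2 : 2 * normH1 (U s - U t) @[s --> t] --> 2 * (0 : R) by apply: cvgMr; exact: c.
by rewrite mulr0 in c2.
Qed.

Lemma U_curves : exists r s, [/\ curve r (fun t => fr (wderiv (U t))), curve s (fun t => fi (wderiv (U t))),
  forall t, n2 (r t \- fr (U t)) = 0 & forall t, n2 (s t \- fi (U t)) = 0].
Proof.
have W t := weak_wdF (U_L2 t) (Hs1_wd (U_Hs t)).
have B t s := dC_H1 (U_Hs s) (U_Hs t).
have n1 (f g : R -> R[i]) : n2 (fr f \- fr g) <= dC f g by rewrite dCE lerDl n2_ge0.
have n2' (f g : R -> R[i]) : n2 (fi f \- fi g) <= dC f g by rewrite dCE lerDr n2_ge0.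
have [r [hr er]] : exists r, curve r (fun t => fr (wderiv (U t))) /\ forall t, n2 (r t \- fr (U t)) = 0.
  apply: curve_rep => t; first by have [] := W t.
  - apply: (@cvg0_le _ _ _ _ _ (fun s => 2 * normH1 (U s - U t))); last exact: U_cvg.
      by move=> s; exact: n2_ge0.
    by apply: nearW => s; apply: (le_trans (n1 _ _)); have [] := B t s.
  - apply: (@cvg0_le _ _ _ _ _ (fun s => 2 * normH1 (U s - U t))); last exact: U_cvg.
      by move=> s; exact: n2_ge0.
    by apply: nearW => s; apply: (le_trans (n1 _ _)); have [] := B t s.
have [s [hs es]] : exists s, curve s (fun t => fi (wderiv (U t))) /\ forall t, n2 (s t \- fi (U t)) = 0.
  apply: curve_rep => t; first by have [] := W t.
  - apply: (@cvg0_le _ _ _ _ _ (fun s => 2 * normH1 (U s - U t))); last exact: U_cvg.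
      by move=> s; exact: n2_ge0.
    by apply: nearW => s; apply: (le_trans (n2' _ _)); have [] := B t s.
  - apply: (@cvg0_le _ _ _ _ _ (fun s => 2 * normH1 (U s - U t))); last exact: U_cvg.
      by move=> s; exact: n2_ge0.
    by apply: nearW => s; apply: (le_trans (n2' _ _)); have [] := B t s.
by exists r, s.
Qed.

(** The definition of a mild solution provides one integral for each time; choice assembles them
    into a function of time, with arbitrary values at negative times. *)
Lemma mild_family : exists S J, [/\ damped_schrodinger_group a S,
  (forall t : R, 0 <= t -> is_L2_integral (fun tau => S (t - tau) (F tau)) 0 t (J t)) &
  (forall t : R, 0 <= t -> dC (u t) (S t u0 - 'i \*o J t) = 0)].
Proof.
have [_ [S HS H]] := hu.
have K t : exists J, 0 <= t -> is_L2_integral (fun tau => S (t - tau) (F tau)) 0 t J /\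
    dC (u t) (S t u0 - 'i \*o J) = 0.
  case: (leP 0 t) => t0; last by exists (cst 0).
  have [J hJ e] := H t t0; exists J => _; split => //; have [LJ _] := hJ.
  apply: normL20_dC => //; first by rewrite -(UE t0); exact: U_L2.
  by apply: L2B; [apply: (S_L2 HS); exact: Hs_L2 hu0 | exact: L2_i].
have [J hJ] := choice K; exists S, J; split => // t t0; by have [] := hJ t t0.
Qed.

Lemma u_initial : dC (u 0) u0 = 0.
Proof.
have [S [J [HS hJ he]]] := mild_family.
have [LJ H] := hJ 0 (lexx _); have e := he 0 (lexx _).
have Lu0 := Hs_L2 hu0; have Lu : L2 (u 0) by rewrite -(UE (lexx _)); exact: U_L2.
have L0 := @L2_0 R; have LS := S_L2 HS 0 Lu0; have LiJ := L2_i LJ.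
have J0 : dC 0 (J 0) = 0.
  apply: normL20_dC => //; apply/eqP; rewrite eq_le sqrtr_ge0 andbT; apply/ler_addgt0Pr => eps e0.
  have [d d0 hd] := H eps e0; rewrite [leRHS]add0r.
  (* For an interval of length 0 the partition with no step is admissible, so the empty sum 0 is
     within eps of J 0. *)
  have := hd 0%N (fun=> 0) (fun=> 0) erefl erefl; rewrite big_ord0 => k.
  by apply: ltW; apply: k.
have e0 (v : R -> R[i]) : v - 'i \*o (0 : R -> R[i]) = v.
  by apply/funext => x; rewrite !fctE /= mulr0 subr0.
have Li0 := L2_i L0.
have k1 : dC (S 0 u0 - 'i \*o (0 : R -> R[i])) (S 0 u0 - 'i \*o J 0) <= 0.
  by apply: (le_trans (dCB LS Li0 LS LiJ)); rewrite dC_refl add0r dC_i J0.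
rewrite e0 in k1.
have k2 : dC (S 0 u0 - 'i \*o J 0) (S 0 u0) = 0 by apply/eqP; rewrite dC_sym eq_le dC_ge0 andbT.
have LX := L2B LS LiJ.
exact: (dC_eq0_trans Lu LS Lu0 (dC_eq0_trans Lu LX LS e k2) (S_0 HS Lu0)).
Qed.

Lemma energy_initial : energy (2 * m).+1 (u 0) = energy (2 * m).+1 u0.
Proof. by apply: energy_dC => //; [rewrite -(UE (lexx _)); exact: U_Hs | exact: u_initial]. Qed.

Variables (r r' s s' : R -> R -> R).
Hypotheses (cr : curve r r') (cs : curve s s')
  (er : forall t, n2 (r t \- fr (U t)) = 0) (es : forall t, n2 (s t \- fi (U t)) = 0).

Let G1 t := (fun x => rho2 (r t x) (s t x) ^+ m) \* r t.
Let G2 t := (fun x => rho2 (r t x) (s t x) ^+ m) \* s t.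

Lemma F_rep (t : R) : 0 <= t -> [/\ L2 (F t), n2 (G1 t \- fr (F t)) = 0 & n2 (G2 t \- fi (F t)) = 0].
Proof.
move=> t0; rewrite /F -(UE t0).
exact: (nonlinearity_rep m (U_L2 t) (cu_pC cr t) (cu_pC cs t) (er t) (es t)).
Qed.

Lemma G_lcv t : lcv (F := nbhs t) G1 (G1 t) /\ lcv (F := nbhs t) G2 (G2 t).
Proof.
have ur := curve_ucv cr t; have us := curve_ucv cs t.
have ux : ucv (F := nbhs t) (fun i x => rho2 (r i x) (s i x) ^+ m) (fun x => rho2 (r t x) (s t x) ^+ m).
  by apply: (@ucvX _ _ _ _ m (fun i x => rho2 (r i x) (s i x))); apply: ucvD; apply: (@ucvX _ _ _ _ 2).
by split; apply: ucv_lcv; apply: ucvM.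
Qed.

Lemma F_right (t e : R) : 0 <= t -> 0 < e -> exists2 h0 : R, 0 < h0 &
  forall h : R, 0 <= h < h0 -> dC (F (t + h)) (F t) <= e.
Proof.
move=> t0 e0; have [c1 c2] := G_lcv t; have [l1 _ d1] := c1; have [l2' _ d2] := c2.
have d3 : n2 (G1 s \- G1 t) + n2 (G2 s \- G2 t) @[s --> t] --> (0 : R) + 0 by apply: cvgD.
rewrite addr0 in d3.
have /d3[d /= d0 hd] : \forall x \near (0 : R), x <= e.
  by exists e => //= x; rewrite /= sub0r normrN => /ltW; exact: le_trans (ler_norm x).
exists d => // h /andP[h0 hh]; have th0 : 0 <= t + h by rewrite addr_ge0.
have [LF e1 e2] := F_rep t0; have [LFh f1 f2] := F_rep th0.
rewrite dCE.
rewrite -(n2_rep (L2_fr LFh) (L2_fr LF) (l1 (t + h)) (l1 t) f1 e1).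
rewrite -(n2_rep (L2_fi LFh) (L2_fi LF) (l2' (t + h)) (l2' t) f2 e2).
by apply: hd; rewrite /= opprD addNKr normrN ger0_norm.
Qed.

Lemma ip_rep (f g phi : R -> R) : l2 f -> l2 g -> l2 phi -> n2 (f \- g) = 0 -> ip g phi = ip f phi.
Proof.
move=> hf hg hp h0; apply/esym/eqP; rewrite -subr_eq0 -(ipBl hf hg hp).
by apply/eqP/n2_eq0_ip => //; exact: l2B.
Qed.

(** The test function is c1 phi + i c2 phi: with c1 and c2 equal to 0, 1 or -1, one statement covers
    both components and both signs. *)
Lemma ode_signed (phi phi' : R -> R) (k c1 c2 : R) : pC1 phi phi' -> pC1 phi' (- k ^+ 2 \*o phi) ->
  forall t eta : R, 0 <= t -> 0 < eta -> exists2 h0 : R, 0 < h0 & forall h : R, 0 < h < h0 ->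
  c1 * ip (r (t + h)) phi + c2 * ip (s (t + h)) phi <= c1 * ip (r t) phi + c2 * ip (s t) phi
   + h * (c1 * (k ^+ 2 * ip (s t) phi - ip (gn a m (r t) (s t)) phi)
     + c2 * (k ^+ 2 * ip (\- r t) phi - ip (gn a m (s t) (\- r t)) phi) + eta).
Proof.
move=> dp dp' t eta t0 eta0; have [S [J [HS hJ he]]] := mild_family.
have Lu (t' : R) : 0 <= t' -> L2 (u t') by move=> t'0; rewrite -(UE t'0); exact: U_L2.
have FL2 (t' : R) : 0 <= t' -> L2 (F t') by move=> t'0; have [] := F_rep t'0.
have a_pC := pC1_pC ha.
have [h0 h00 H] := mild_weak a_pC a_ge0 HS FL2 F_right hJ (Hs_L2 hu0) Lu he
  (pC1Z c1 dp) (pC1Z c1 dp') (pC1Z c2 dp) (pC1Z c2 dp') t0 eta0.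
exists h0 => // h hh; have /andP[hp _] := hh; have {H} := H h hh.
have th0 : 0 <= t + h by rewrite addr_ge0 // ltW.
have lp := pC_l2 (pC1_pC dp); have lap := pCl2_l2 a_pC lp.
have lr t' := curve_l2 cr t'; have ls t' := curve_l2 cs t'.
have lfr t' := L2_fr (U_L2 t'); have lfi t' := L2_fi (U_L2 t').
have [LF e1 e2] := F_rep t0.
have lG1 := lcv_l2 (G_lcv t).1 t; have lG2 := lcv_l2 (G_lcv t).2 t.
have dsc (f : R -> R) : l2 f -> ip f ((c2 \*o (- k ^+ 2 \*o phi)) \- (a \* (c1 \*o phi))) =
    - (c2 * k ^+ 2 * ip f phi) - c1 * ip f (a \* phi).
  move=> hf; rewrite (ipBr (l2Z c2 (l2Z _ lp)) (pCl2_l2 a_pC (l2Z c1 lp)) hf).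
  rewrite (ipZr _ (l2Z _ lp) hf) (ipZr _ lp hf).
  have -> : a \* (c1 \*o phi) = c1 \*o (a \* phi) by apply/funext => x /=; rewrite mulrCA.
  by rewrite (ipZr _ lap hf) mulNr mulrN mulrA.
have dsc' (f : R -> R) : l2 f -> ip f ((\- (c1 \*o (- k ^+ 2 \*o phi))) \- (a \* (c2 \*o phi))) =
    c1 * k ^+ 2 * ip f phi - c2 * ip f (a \* phi).
  move=> hf; rewrite (ipBr (l2N (l2Z c1 (l2Z _ lp))) (pCl2_l2 a_pC (l2Z c2 lp)) hf).
  rewrite (ipNr (l2Z c1 (l2Z _ lp)) hf) (ipZr _ (l2Z _ lp) hf) (ipZr _ lp hf).
  have -> : a \* (c2 \*o phi) = c2 \*o (a \* phi) by apply/funext => x /=; rewrite mulrCA.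
  by rewrite (ipZr _ lap hf) mulNr mulrN opprK mulrA.
have lg1 : l2 (a \* r t) by exact: pCl2_l2.
have lg2 : l2 (a \* s t) by exact: pCl2_l2.
have am (f : R -> R) : ip (a \* f) phi = ip f (a \* phi).
  by rewrite !ipE; congr (torus_int _); apply/funext => x /=; rewrite mulrCA mulrA.
have gr : ip (gn a m (r t) (s t)) phi = ip (r t) (a \* phi) - ip (G2 t) phi.
  by rewrite /gn (ipBl lg1 lG2 lp) am.
have gs : ip (gn a m (s t) (\- r t)) phi = ip (s t) (a \* phi) + ip (G1 t) phi.
  have -> : gn a m (s t) (\- r t) = (a \* s t) \+ G1 t.
    by apply/funext => x; rewrite /gn /G1 /rho2 /= sqrrN mulrN opprK [r t x ^+ 2 + _]addrC.
  by rewrite (ipDl lg2 lG1 lp) am.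
rewrite gr gs (ipNl (lr t) lp) /ipC2 (dsc _ (L2_fr (Lu _ t0))) (dsc' _ (L2_fi (Lu _ t0))).
rewrite !(ipZr _ lp (L2_fr (Lu _ th0))) !(ipZr _ lp (L2_fi (Lu _ th0))).
rewrite !(ipZr _ lp (L2_fr (Lu _ t0))) !(ipZr _ lp (L2_fi (Lu _ t0))).
rewrite !(ipZr _ lp (L2_fr LF)) !(ipZr _ lp (L2_fi LF)).
rewrite -(UE t0) -(UE th0).
rewrite (ip_rep (lr t) (lfr t) lp (er t)) (ip_rep (ls t) (lfi t) lp (es t)).
rewrite (ip_rep (lr _) (lfr _) lp (er (t + h))) (ip_rep (ls _) (lfi _) lp (es (t + h))).
rewrite (ip_rep (lr t) (lfr t) lap (er t)) (ip_rep (ls t) (lfi t) lap (es t)).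
rewrite (ip_rep lG1 (L2_fr LF) lp e1) (ip_rep lG2 (L2_fi LF) lp e2).
exact: ode_arith.
Qed.

Lemma ode_step (phi phi' : R -> R) (k : R) : pC1 phi phi' -> pC1 phi' (- k ^+ 2 \*o phi) ->
  forall t eta : R, 0 <= t -> 0 < eta ->
  (\forall h \near (0 : R)^'+, `|ip (r (t + h)) phi - ip (r t) phi
       - h * (k ^+ 2 * ip (s t) phi - ip (gn a m (r t) (s t)) phi)| <= h * eta) /\
  (\forall h \near (0 : R)^'+, `|ip (s (t + h)) phi - ip (s t) phi
       - h * (k ^+ 2 * ip (\- r t) phi - ip (gn a m (s t) (\- r t)) phi)| <= h * eta).
Proof.
move=> dp dp' t eta t0 eta0; have H c1 c2 := ode_signed c1 c2 dp dp' t0 eta0.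
split; apply: ex_near_right.
- have [h1 h10 H1] := H 1 0; have [h2 h20 H2] := H (-1) 0.
  exists (Num.min h1 h2); first by rewrite lt_min h10.
  move=> h /andP[h0]; rewrite lt_min => /andP[k1 k2].
  have {H1} := H1 h; rewrite h0 k1 => /(_ isT); rewrite !mul0r !addr0 => q1.
  have {H2} := H2 h; rewrite h0 k2 => /(_ isT); rewrite !mul0r !addr0 => q2.
  exact: (sign_le_norm q1 q2).
- have [h1 h10 H1] := H 0 1; have [h2 h20 H2] := H 0 (-1).
  exists (Num.min h1 h2); first by rewrite lt_min h10.
  move=> h /andP[h0]; rewrite lt_min => /andP[k1 k2].
  have {H1} := H1 h; rewrite h0 k1 => /(_ isT); rewrite !mul0r !add0r => q1.
  have {H2} := H2 h; rewrite h0 k2 => /(_ isT); rewrite !mul0r !add0r => q2.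
  exact: (sign_le_norm q1 q2).
Qed.

Lemma cc_pC1' k : pC1 (- k%:R \*o ss k) (- k%:R ^+ 2 \*o (cc k : R -> R)).
Proof. by apply: (pC1_eq (pC1Z (- k%:R) (ss_pC1 k))) => x /=; move: (cc k x) => c; ring. Qed.

Lemma ss_pC1' k : pC1 (k%:R \*o cc k) (- k%:R ^+ 2 \*o (ss k : R -> R)).
Proof. by apply: (pC1_eq (pC1Z (k%:R) (cc_pC1 k))) => x /=; move: (ss k x) => c; ring. Qed.

Lemma mild_ode : weak_ode r s (fun t => gn a m (r t) (s t)) /\
  weak_ode s (fun t => \- r t) (fun t => gn a m (s t) (\- r t)).
Proof.
split=> t t0 k eta eta0; split.
- by have [] := ode_step (cc_pC1 k) (cc_pC1' k) t0 eta0.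
- by have [] := ode_step (ss_pC1 k) (ss_pC1' k) t0 eta0.
- by have [] := ode_step (cc_pC1 k) (cc_pC1' k) t0 eta0.
- by have [] := ode_step (ss_pC1 k) (ss_pC1' k) t0 eta0.
Qed.

Lemma energy_curve (t : R) : 0 <= t -> energy (2 * m).+1 (u t) =
  torus_int (fun x => edens m (r t x) (fr (wderiv (U t)) x) (s t x) (fi (wderiv (U t)) x)).
Proof.
move=> t0; rewrite -{1}(UE t0); exact: (energy_rep m (U_Hs t) (cu_pC cr t) (cu_pC cs t) (er t) (es t)).
Qed.

End MildCurve.

(** * The multiplier built from the damping *)

Section Damping.
Context {R : realType}.
Implicit Types (f g w : R -> R).

Lemma mvt_incr f f' (x h : R) : (forall y : R, is_derive y (1 : R) f (f' y)) ->
  exists2 c, `|c - x| <= `|h| & f (x + h) - f x = f' c * h.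
Proof.
move=> df; have cf := derive_continuous df.
have S (y z : R) : y <= z -> exists2 c, y <= c <= z & f z - f y = f' c * (z - y).
  move=> yz; have [c + e] := MVT_segment yz (fun t _ => df t) (continuous_subspaceT cf).
  by rewrite in_itv /= => hc; exists c.
case: (leP 0 h) => h0.
  have [|c /andP[c1 c2] e] := S x (x + h); first by rewrite lerDl.
  exists c; last by rewrite e addrAC subrr add0r.
  by rewrite !ger0_norm ?subr_ge0 // lerBlDl.
have [|c /andP[c1 c2] e] := S (x + h) x; first by rewrite gerDl ltW.
exists c.
  by rewrite ler0_norm ?subr_le0 // ltr0_norm // lerN2 lerBrDl.
by rewrite -opprB e opprD addrA subrr add0r mulrN opprK.
Qed.

Lemma taylor1 f f' f'' (M : R) : (forall y : R, is_derive y (1 : R) f (f' y)) ->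
  (forall y : R, is_derive y (1 : R) f' (f'' y)) -> (forall y, `|f'' y| <= M) ->
  forall x h : R, `|f (x + h) - f x - h * f' x| <= M * h ^+ 2.
Proof.
move=> df df' hM x h; have [c hc ->] := mvt_incr x h df.
have [d _] := mvt_incr x (c - x) df'; rewrite [x + (c - x)]addrC subrK => e.
rewrite mulrC -mulrBr e !normrM -(sqr_normr h) expr2 [leRHS]mulrCA.
rewrite ler_wpM2l //; apply: ler_pM => //; exact: hM.
Qed.

(** With an explicit quadratic remainder, differentiation under the integral sign amounts to
    integrating the remainder bound. *)
Lemma is_derive_quadratic f (x d C : R) : (forall h : R, `|f (x + h) - f x - h * d| <= C * h ^+ 2) ->
  is_derive x (1 : R) f d.
Proof.
move=> H.
have c : h^-1 *: (f (h *: (1 : R) + x) - f x) @[h --> (0 : R)^'] --> d.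
  apply/subr_cvg0; apply/norm_cvg0P.
  have z : C * `|h| @[h --> (0 : R)^'] --> (0 : R).
    have z0 : C * `|h| @[h --> (0 : R)] --> C * `|(0 : R)|.
      by apply: cvgMr; apply: cvg_norm; exact: cvg_id.
    rewrite normr0 mulr0 in z0; by move=> P /z0 HP; exact: (nbhs_dnbhs HP).
  apply: (@cvg0_le _ _ _ _ _ _ _ _ z); first by move=> h; exact: normr_ge0.
  have n0 : \forall h \near (0 : R)^', h != 0 by exact: nbhs_dnbhs_neq.
  apply: filterS n0 => h h0.
  have -> : h^-1 *: (f (h *: (1 : R) + x) - f x) - d = h^-1 * (f (x + h) - f x - h * d).
    by rewrite /GRing.scale /= mulr1 [h + x]addrC [RHS]mulrBr mulKf.
  rewrite normrM; apply: (@le_trans _ _ (`|h^-1| * (C * h ^+ 2))); first by rewrite ler_wpM2l.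
  rewrite -sqr_normr expr2 mulrCA normfV mulKf ?normr_eq0 //.
split; first by apply: cvgP; exact: c.
exact: (cvg_lim _ c).
Qed.

(** A nonnegative function with bounded second derivative stays above 0 along its Taylor parabola
    bound, so the discriminant of that parabola is nonpositive. *)
Lemma sqr_deriv_le f f' f'' (M : R) : (forall y : R, is_derive y (1 : R) f (f' y)) ->
  (forall y : R, is_derive y (1 : R) f' (f'' y)) -> (forall y, `|f'' y| <= M) -> 0 < M ->
  (forall y, 0 <= f y) -> forall x, f' x ^+ 2 <= 4 * M * f x.
Proof.
move=> df df' hM M0 f0 x.
(* Minimiser of f x + h f' x + M h^2. *)
pose h := - (f' x / (2 * M)).
have := f0 (x + h); have := taylor1 df df' hM x h.
have e1 : h * f' x = - (f' x ^+ 2 / (2 * M)) by rewrite /h mulNr mulrAC -expr2.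
have e2 : M * h ^+ 2 = f' x ^+ 2 / (2 * M) / 2.
  by rewrite /h sqrrN; field; rewrite gt_eqF.
rewrite e1 e2 opprK => /(le_trans (ler_norm _)).
have e3 : f' x ^+ 2 = (f' x ^+ 2 / (2 * M)) * (2 * M) by rewrite divfK // gt_eqF // mulr_gt0.
move=> h1 h2; rewrite e3; move: h1 h2; move: (f' x ^+ 2 / (2 * M)) (f (x + h)) => y z h1 h2.
have : y <= 2 * f x by lra.
have M2 : 0 <= 2 * M by rewrite mulr_ge0 // ltW.
move=> /(ler_wpM2r M2) /le_trans; apply.
by rewrite le_eqVlt; apply/orP; left; apply/eqP; ring.
Qed.

Lemma shift_pC f x : pC f -> pC (fun s => f (x + s)).
Proof.
move=> [pf cf]; split; first by move=> y; rewrite addrA pf.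
move=> y; apply: (@continuous_comp _ _ _ (fun s => x + s) f); last exact: cf.
by apply: cvgD; [exact: cvg_cst | exact: cvg_id].
Qed.

Lemma tint_shift_derive f f' f'' w : pC1 f f' -> pC1 f' f'' -> continuous w ->
  forall x, is_derive x (1 : R) (fun x => torus_int (fun s => w s * f (x + s)))
    (torus_int (fun s => w s * f' (x + s))).
Proof.
move=> hf hf' cw x; have [M M0 hM] := pC_bounded (pC1_pC' hf').
have [W W0 hW] := cont_bounded_cell cw.
have ci (g : R -> R) y : pC g -> intg (fun s => w s * g (y + s)).
  move=> hg; apply: cont_intg => s; apply: cvgM; first exact: cw.
  exact: (pC_cont (shift_pC y hg)).
apply: (@is_derive_quadratic _ _ _ (W * M * (pi *+ 2))) => h.
have i1 := ci _ (x + h) (pC1_pC hf); have i2 := ci _ x (pC1_pC hf); have i3 := ci _ x (pC1_pC hf').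
rewrite -(tintZ h i3) -(tintB i1 i2) -(tintB (intgB i1 i2) (intgZ h i3)).
have := @tint_norm_bound R _ (W * (M * h ^+ 2)) (intgB (intgB i1 i2) (intgZ h i3)).
have -> : W * M * (pi *+ 2) * h ^+ 2 = W * (M * h ^+ 2) * (pi *+ 2) by ring.
apply => s Ds /=.
have -> : w s * f (x + h + s) - w s * f (x + s) - h * (w s * f' (x + s)) =
    w s * (f (x + s + h) - f (x + s) - h * f' (x + s)).
  by rewrite [x + s + h]addrAC; ring.
rewrite normrM; apply: ler_pM => //; first exact: hW.
exact: (taylor1 (pC1_der hf) (pC1_der hf') hM).
Qed.

Lemma shift_pC1 f f' f'' x : pC1 f f' -> pC1 f' f'' -> pC1 (fun s => f (x + s)) (fun s => f' (x + s)).
Proof.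
move=> hf hf'; have [p1 _] := shift_pC x (pC1_pC hf); have [_ c1] := shift_pC x (pC1_pC hf').
split=> // s; have [M _ hM] := pC_bounded (pC1_pC' hf').
apply: (@is_derive_quadratic _ _ _ M) => h; rewrite addrA.
exact: (taylor1 (pC1_der hf) (pC1_der hf') hM).
Qed.

(** The derivative in x is the integral of an exact periodic derivative, hence 0; the weight 1
    brings the integral into the form of [tint_shift_derive]. *)
Lemma tint_shift f f' f'' x : pC1 f f' -> pC1 f' f'' -> torus_int (fun s => f (x + s)) = torus_int f.
Proof.
move=> hf hf'.
have e (g : R -> R) y : torus_int (fun s => 1 * g (y + s)) = torus_int (fun s => g (y + s)).
  by congr torus_int; apply/funext => s; rewrite mul1r.
have d y : is_derive y (1 : R) (fun x => torus_int (fun s => 1 * f (x + s))) 0.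
  have c1 : continuous (fun _ : R => 1 : R) by move=> s; exact: cvg_cst.
  have k : torus_int (fun s => 1 * f' (y + s)) = 0 by rewrite (e f' y); exact: tint_deriv0 (shift_pC1 y hf hf').
  by have := tint_shift_derive hf hf' c1 y; rewrite k.
have := is_derive_0_is_cst x 0 d; rewrite (e f x) (e f 0) => ->.
by congr torus_int; apply/funext => s; rewrite add0r.
Qed.

(* The primitive is the convolution of f with the sawtooth: integrating s f'(x + s) by parts over
   [0, 2pi] leaves 2pi f(x) minus the integral of f over a period. *)
Lemma periodic_primitive f f' f'' : pC1 f f' -> pC1 f' f'' -> torus_int f = 0 -> exists psi, pC1 psi f.
Proof.
move=> hf hf' f0; pose P x := torus_int (fun s => s * f (x + s)).
have cid : continuous (fun s : R => s) by move=> s; exact: cvg_id.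
have dP := tint_shift_derive hf hf' cid.
have eP x : torus_int (fun s => s * f' (x + s)) = (pi *+ 2) * f x.
  have h1 := shift_pC1 x hf hf'; have c1 := pC_cont (shift_pC x (pC1_pC hf)); have c2 := pC_cont (shift_pC x (pC1_pC hf')).
  have i1 : intg (fun s => f (x + s)) by exact: cont_intg.
  have i2 : intg (fun s => s * f' (x + s)) by apply: cont_intg => s; exact: cvgM (cid s) (c2 s).
  have d s : is_derive s (1 : R) (fun s => s * f (x + s)) (f (x + s) + s * f' (x + s)).
    have ds := pC1_der h1 s; apply: is_derive_eq.
    by rewrite /GRing.scale /= mulr1 addrC.
  have c : continuous (fun s => f (x + s) + s * f' (x + s)).
    by move=> s; apply: cvgD; [exact: c1 | exact: cvgM (cid s) (c2 s)].
  have := tint_deriv d c; rewrite (tintD i1 i2) (tint_shift x hf hf') f0 add0r => ->.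
  by rewrite mul0r subr0 (pC1_per hf).
exists ((pi *+ 2)^-1 \*o P); split.
- move=> x /=; congr (_ * torus_int _); apply/funext => s.
  by rewrite addrAC (pC1_per hf).
- move=> x; have dx := dP x; rewrite eP in dx.
  have -> : f x = (pi *+ 2)^-1 * ((pi *+ 2) * f x) by rewrite mulKf // gt_eqF // twopi_gt0.
  exact: is_deriveZ.
- exact: pC_cont (pC1_pC hf).
Qed.

(** Integrating by parts, the squared norm of f' is [- ip f'' f], so it vanishes as well; [pC1_sup]
    then gives a pointwise statement. *)
Lemma pC1_eq0 f f' f'' : pC1 f f' -> pC1 f' f'' -> n2 f = 0 -> forall x, f x = 0.
Proof.
move=> hf hf' f0 x; have lf := pC_l2 (pC1_pC hf).
have f'0 : n2 f' = 0.
  apply/eqP; rewrite n2E (ip_ibp hf' hf) ipC -sqrtr0; apply/eqP; congr Num.sqrt.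
  by rewrite (n2_eq0_ip lf (pC_l2 (pC1_pC' hf')) f0) oppr0.
by have := pC1_sup hf x; rewrite f0 f'0 addr0 mulr0 normr_le0 => /eqP.
Qed.

Lemma damping_multiplier a (a0 x0 : R) : torus_smooth a -> (forall x, 0 <= a x) -> 0 < a0 -> a0 <= a x0 ->
  exists A K lam psi Psi, [/\ forall x, a x <= A, forall x, derive1 a x ^+ 2 <= K * a x, 0 <= K /\ 0 <= lam,
    pC1 psi (fun x => 1 - lam * a x) & forall x, `|psi x| <= Psi].
Proof.
move=> sa a_ge0 a00 hx0.
have h1 := smooth_pC1 sa; have h2 := smooth_pC1 (smooth_derive sa).
have [A A0 hA] := pC_bounded (pC1_pC h1).
have aA x : a x <= A by exact: le_trans (ler_norm _) (hA x).
have [M M0 hM] := pC_bounded (pC1_pC' h2).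
have ia := pC_intg (pC1_pC h1); have ia2 : intg (fun x => a x * a x) by apply: pC_intg; pc.
(* If a had integral 0, so would a^2 <= A a; then a would vanish identically, against a x0 >= a0 >
   0. *)
have I0 : 0 < torus_int a.
  rewrite lt_neqAle tint_ge0 // andbT; apply/eqP => I0.
  have z : n2 a = 0.
    apply/eqP; rewrite n2E ipE sqrtr_eq0.
    apply: (@le_trans _ _ (torus_int (A \*o a))); last by rewrite (tintZ _ ia) -I0 mulr0.
    by apply: tint_le => // [|x _ /=]; [exact: intgZ | exact: ler_wpM2r].
  by move: hx0; rewrite (pC1_eq0 h1 h2 z) leNgt a00.
(* Gives 1 - lam a mean 0, the condition for a periodic primitive. *)
pose lam := (pi *+ 2) / torus_int a.
have hb := pC1B (pC1_cst 1) (pC1Z lam h1); have hb' := pC1B (pC1_cst 0) (pC1Z lam h2).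
have [|psi hpsi] := periodic_primitive hb hb'.
  rewrite (tintB (intg_cst 1) (intgZ lam ia)) (tintZ lam ia) tint_cst mul1r.
  by rewrite /lam divfK ?subrr // gt_eqF.
have [Psi _ hPsi] := pC_bounded (pC1_pC hpsi).
(* K comes from [sqr_deriv_le], with M + 1 in place of M to have a positive bound. *)
exists A, (4 * (M + 1)), lam, psi, Psi; split => //.
- have M1 : 0 < M + 1 by rewrite ltr_wpDl.
  have hM1 x : `|derive1 (derive1 a) x| <= M + 1 by apply: (le_trans (hM x)); rewrite lerDl.
  exact: (sqr_deriv_le (pC1_der h1) (pC1_der h2) hM1 M1 a_ge0).
- split; first by rewrite mulr_ge0 // addr_ge0.
  by rewrite divr_ge0 // ?(ltW I0) // ltW // twopi_gt0.
Qed.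

End Damping.

(** * Exponential decay of the energy *)

Section EnergyDecay.
Context {R : realType}.

Lemma intg_edens m (r r1 s s1 : R -> R) : pC r -> pC s -> l2 r1 -> l2 s1 ->
  intg (fun x => edens m (r x) (r1 x) (s x) (s1 x)).
Proof.
move=> hr hs lr ls.
have i1 : intg (fun x => rho2 (r x) (s x)) by apply: pC_intg; rewrite /rho2; pc.
have i3 : intg (fun x => rho2 (r x) (s x) ^+ m.+1) by apply: pC_intg; rewrite /rho2; pc.
have i2 : intg (fun x => rho2 (r1 x) (s1 x)) by apply: intgD; apply: l2_intg.
exact: (intgD (intgD (intgZ _ i1) (intgZ _ i2)) (intgZ _ i3)).
Qed.

(** The factor 2 C comes from E(t) <= 2 L(t), the decay of L, and L(0) <= C E(0). *)
Lemma curve_energy_decay m (a a1 psi : R -> R) (lam kap eps delta Psi C : R) (r r' s s' : R -> R -> R) :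
  pC1 a a1 -> pC1 psi (fun x => 1 - lam * a x) -> (forall x, `|psi x| <= Psi) -> (0 < m)%N -> 0 < delta ->
  (forall x y y1 z z1, edens m y y1 z z1 <= 2 * ldens psi m kap eps x y y1 z z1 /\
     ldens psi m kap eps x y y1 z z1 <= C * edens m y y1 z z1) ->
  (forall y y1 z z1 : R -> R, pC1 y y1 -> pC1 z z1 ->
    torus_int (fun x => diss a a1 psi lam m kap eps x (y x) (y1 x) (z x) (z1 x)) <=
    - delta * torus_int (fun x => ldens psi m kap eps x (y x) (y1 x) (z x) (z1 x))) ->
  curve r r' -> curve s s' -> weak_ode r s (fun t => gn a m (r t) (s t)) ->
  weak_ode s (fun t => \- r t) (fun t => gn a m (s t) (\- r t)) -> forall t : R, 0 <= t ->
  torus_int (fun x => edens m (r t x) (r' t x) (s t x) (s' t x)) <=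
  2 * C * torus_int (fun x => edens m (r 0 x) (r' 0 x) (s 0 x) (s' 0 x)) * expR (- delta * t).
Proof.
move=> ha hpsi hPsi m0 d0 cmp hdiss cr cs ode_r ode_s t t0.
have ldens_ge0 x y y1 z z1 : 0 <= ldens psi m kap eps x y y1 z z1.
  have [h _] := cmp x y y1 z z1; have := edens_ge0 m y y1 z z1.
  by move=> /le_trans/(_ h); rewrite pmulr_rge0.
have D := curve_decay ha hpsi hPsi m0 d0 ldens_ge0 hdiss cr cs ode_r ode_s t0.
have iE t' := intg_edens m (cu_pC cr t') (cu_pC cs t') (curve_l2' cr t') (curve_l2' cs t').
have TL t' := tint_ldens kap eps m hpsi (cu_pC cr t') (curve_l2' cr t') (cu_pC cs t') (curve_l2' cs t').
have [iL LE] := TL t; have [iL0 LE0] := TL 0.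
have up x : edens m (r t x) (r' t x) (s t x) (s' t x) <= 2 * ldens psi m kap eps x (r t x) (r' t x) (s t x) (s' t x).
  exact: (cmp x (r t x) (r' t x) (s t x) (s' t x)).1.
have lo x : ldens psi m kap eps x (r 0 x) (r' 0 x) (s 0 x) (s' 0 x) <= C * edens m (r 0 x) (r' 0 x) (s 0 x) (s' 0 x).
  exact: (cmp x (r 0 x) (r' 0 x) (s 0 x) (s' 0 x)).2.
have up' := tint_le (iE t) (intgZ 2 iL) (fun x _ => up x).
have lo' := tint_le iL0 (intgZ C (iE 0)) (fun x _ => lo x).
rewrite (tintZ 2 iL) LE in up'; rewrite (tintZ C (iE 0)) LE0 in lo'.
apply: (le_trans up'); rewrite -!(mulrA 2) ler_pM2l //; apply: (le_trans D).
by apply: ler_wpM2r; [exact: expR_ge0 | exact: lo'].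
Qed.

Lemma energy_decay m (a : R -> R) (a0 x0 : R) : (0 < m)%N -> torus_smooth a -> (forall x, 0 <= a x) ->
  0 < a0 -> a0 <= a x0 -> exists C delta : R, [/\ 0 < C, 0 < delta &
    forall (u0 : R -> R[i]) (u : R -> (R -> R[i])), Hs 1 u0 -> mild_solution (2 * m).+1 a u0 u ->
      forall t : R, 0 <= t -> energy (2 * m).+1 (u t) <= C * energy (2 * m).+1 u0 * expR (- delta * t)].
Proof.
move=> m0 sa a_ge0 a00 hx0.
have [A [K [lam [psi [Psi [hA hK [K0 l0] hpsi hPsi]]]]]] := damping_multiplier sa a_ge0 a00 hx0.
have ha := smooth_pC1 sa.
have [kap [eps [delta [C [e0 d0 C0 cmp hdiss]]]]] := lyapunov_exists ha a_ge0 hA hK K0 l0 hpsi hPsi m0.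
exists (2 * C), delta; split => //; first by rewrite mulr_gt0.
move=> u0 u hu0 hu t t0.
have [r [s [cr cs er es]]] := U_curves hu.
have [ode_r ode_s] := mild_ode ha a_ge0 hu0 hu cr cs er es.
rewrite -(energy_initial hu0 hu) (energy_curve hu cr cs er es t0) (energy_curve hu cr cs er es (lexx 0)).
exact: (curve_energy_decay ha hpsi hPsi m0 d0 cmp hdiss cr cs ode_r ode_s t0).
Qed.

End EnergyDecay.

Theorem proposition2p2 (R : realType) (p : nat) (p_ge3 : (3 <= p)%N)
  (p_odd : odd p) (a : R -> R) (a_smooth : torus_smooth a)
  (a_ge0 : forall x, 0 <= a x)
  (a0 : R) (a0_gt0 : 0 < a0) (I1 : set R) (I1_open : torus_open_set I1)
  (I1_nonempty : I1 !=set0) (a_ge_a0 : forall x, I1 x -> a0 <= a x) :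
  exists C beta : R, [/\ 0 < C, 0 < beta &
    forall (u0 : R -> R[i]) (u : R -> (R -> R[i])),
      Hs 1 u0 -> mild_solution p a u0 u ->
      forall t : R, 0 <= t ->
        energy p (u t) <= C * energy p u0 * expR (- beta * t)].
Proof.
have [x0 Ix0] := I1_nonempty.
have m0 : (0 < p./2)%N by case: p p_ge3 {p_odd} => [|[|[|]]].
(* Oddness gives p = 2 m + 1 with m = p./2, and p >= 3 makes m positive. *)
have ep : p = (2 * p./2).+1 by rewrite mul2n -[LHS]odd_double_half p_odd.
have [C [beta [C0 b0 H]]] := energy_decay m0 a_smooth a_ge0 a0_gt0 (a_ge_a0 x0 Ix0).
by exists C, beta; split=> // u0 u hu0; rewrite ep; exact: H.
Qed.
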